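(* The value function $v$ is a viscosity solution of the HJB equation $$\frac{\partial u}{\partial t}(x,t)+H\big(x,t,\nabla u(x,t)\big)=0,\qquad (x,t)\in Q,$$ and, for every $M>0$, the approximate value function $v^M$ is a viscosity supersolution (in the extended sense defined in the context, which allows the value $\infty$) of the modified HJB equation $$\frac{\partial u}{\partial t}(x,t)+H_M\big(x,t,\nabla u(x,t)\big)=0.$$
   Context: Let $U=\mathbb{R}\times(0,\infty)$ and $Q=U\times(0,\infty)$. Data. $c:[0,\infty)\to\mathbb{R}$ is a fixed continuous function. The function $\eta:[0,\infty)\to\mathbb{R}$ is a fixed realisation of a stochastic integral: in the filtering model $dX_t=\alpha_tX_t\,dt+\sqrt{\beta_t}\,dB_t$, $dY_t=c_tX_t\,dt+dW_t$, $Y_0=0$ (with independent Brownian motions $B,W$), one chooses a version of $\int_0^\cdot c_s\,dY_s$ (independent of the choice of the parameters) all of whose paths are locally H\''older continuous with every exponent strictly less than $1/2$, fixes an outcome $\omega$ and sets $\eta_t=(\int_0^tc_s\,dY_s)(\omega)$. Thus $\eta$ is a fixed deterministic function with $\eta_0=0$ which is locally H\''older continuous with every exponent $<1/2$. Dynamics. For $t\ge0$, $a\in\mathbb{R}$, $b\ge 0$, and $z=(z_1,z_2)\in\mathbb{R}^2$, set $$f(z,t,a,b)=\big(-(z_1+\eta_t)(a+bz_2),\ -bz_2^2-2az_2+c_t^2\big)\ \text{ if } z\in U,\qquad f(z,t,a,b)=\big(-(z_1+\eta_t)a,\ c_t^2\big)\ \text{ if } z\in\mathbb{R}^2\setminus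 U.$$ $\mathcal{A}$ is the set of measurable, locally bounded functions $(\alpha,\beta):[0,\infty)\to\mathbb{R}\times[0,\infty)$ (controls), and for $M>0$, $\mathcal{A}^M=\{(\alpha,\beta)\in\mathcal{A}: |\alpha_s|+\beta_s\le M\ \forall s\ge0\}$. For $x\in U$, $t\ge0$ and $(\alpha,\beta)\in\mathcal{A}$, $w(\cdot)=w(\cdot\,;x,t,\alpha,\beta)$ is the solution of $\frac{dw}{ds}(s)=f(w(s),s,\alpha_s,\beta_s)$ for $0<s<t$ with terminal condition $w(t)=x$. Running cost. $\gamma:[0,\infty)\times\mathbb{R}\times[0,\infty)\to[0,\infty]$ is continuous (as an extended-real-valued map), finite whenever $b>0$, and there is $p>1$ such that for every $T>0$, $\inf_{0\le t\le T}\frac{\gamma(t,a,b)}{|a|^p+b^p}\to\infty$ as $|a|+b\to\infty$. Initial cost. $v_0:\mathbb{R}^2\to\mathbb{R}\cup\{\infty\}$ equals $\infty$ on $\mathbb{R}^2\setminus U$, is finite-valued, bounded below and locally Lipschitz continuous on $U$, $v_0(x)\to\infty$ as $|x|\to\infty$, and $v_0(x_1,x_2)\to\infty$ as $x_2\to0^+$ uniformly in $x_1$. Value functions. For $x\in U$, $t\ge0$, $(\alpha,\beta)\in\mathcal{A}$ let $J(x,t;\alpha,\beta)=\int_0^t\gamma(s,\alpha_s,\beta_s)\,ds+v_0(w(0;x,t,\alpha,\beta))$, where the initial cost is taken to be $\infty$ if the trajectory blows up (backwards in time) before reaching $s=0$. Then $v(x,t)=\inf_{(\alpha,\beta)\in\mathcal{A}}J(x,t;\alpha,\beta)$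 and $v^M(x,t)=\inf_{(\alpha,\beta)\in\mathcal{A}^M}J(x,t;\alpha,\beta)$ (possibly $\infty$). Hamiltonians. $H(x,t,p)=\sup_{(a,b)\in\mathbb{R}\times[0,\infty)}\{f(x,t,a,b)\cdot p-\gamma(t,a,b)\}$, and $H_M(x,t,p)$ is the same supremum restricted to $(a,b)\in\mathbb{R}\times[0,\infty)$ with $|a|+b\le M$. Viscosity solutions. A continuous function $u$ on an open set $O\subset Q$ is a viscosity subsolution (resp. supersolution) of $\partial_tu+G(x,t,\nabla u)=0$ in $O$ if for every $C^1$ function $\varphi$ and every local maximum (resp. minimum) point $(x,t)\in O$ of $u-\varphi$, $\partial_t\varphi(x,t)+G(x,t,\nabla\varphi(x,t))\le0$ (resp. $\ge0$); a viscosity solution is both. Extended supersolutions: $\hat u:Q\to\mathbb{R}\cup\{\infty\}$ is a viscosity supersolution if the set $Q^{\hat u}=\{(x,t)\in Q:\hat u(x,t)<\infty\}$ is open, $\hat u$ is continuous on $Q^{\hat u}$ and satisfies the usual definition of viscosity supersolution there, and $\hat u(x,t)\to\infty$ as $(x,t)$ approaches the boundary of $Q\setminus Q^{\hat u}$. *)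

(* Defs.v *)
From HB Require Import structures.
From mathcomp Require Import all_boot all_order all_algebra.
From mathcomp Require Import all_classical all_reals all_analysis.

Set Implicit Arguments.
Unset Strict Implicit.
Unset Printing Implicit Defensive.

Import Order.TTheory GRing.Theory Num.Theory.
Import numFieldNormedType.Exports.

Local Open Scope classical_set_scope.
Local Open Scope ring_scope.

(* Functions of time are total functions on R of which only the values on
   [0, +oo[ matter. A point (x, t) of R^2 x R is a term of type R * R * R. *)

Section state_space.
Context {R : realType}.

Definition halfplane : set (R * R) := [set x | 0 < x.2].

Definition cylinder : set (R * R * R) := [set q | halfplane q.1 /\ 0 < q.2].

Definition boundary (T : topologicalType) (D : set T) : set T :=
  closure D `\` D°.

Definition holder_exponent_on (D : set R) (theta : R) (h : R -> R) : Prop :=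
  exists C : R, forall s t, D s -> D t -> `|h s - h t| <= C * `|s - t| `^ theta.

Definition locally_holder_below_half (h : R -> R) : Prop :=
  forall theta, 0 < theta < 2^-1 -> forall T, 0 < T ->
    holder_exponent_on `[0, T] theta h.

End state_space.

Section dynamics.
Context {R : realType}.
Variables c eta : R -> R.

Definition drift (z : R * R) (t : R) (ab : R * R) : R * R :=
  let: (a, b) := ab in
  if 0 < z.2 then
    (- (z.1 + eta t) * (a + b * z.2),
     - b * z.2 ^+ 2 - 2 * a * z.2 + c t ^+ 2)
  else (- (z.1 + eta t) * a, c t ^+ 2).

Definition control_values : set (R * R) := [set ab | 0 <= ab.2].

Definition control_values_le (M : R) : set (R * R) :=
  [set ab | 0 <= ab.2 /\ `|ab.1| + ab.2 <= M].

Definition locally_bounded (ab : R -> R * R) : Prop :=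
  forall T, exists K : R, forall s, 0 <= s <= T -> `|ab s| <= K.

(* The controls with values in A. *)
Definition controls (A : set (R * R)) : set (R -> R * R) :=
  [set ab | [/\ measurable_fun (`[0, +oo[ : set R) (ab : R -> R * R),
               locally_bounded ab &
               forall s, 0 <= s -> A (ab s)]].

(* As controls are merely measurable, the equation w' = f(w, s, alpha, beta),
   w(t) = x, is understood in the sense of Caratheodory, i.e. in integrated
   form. Continuity of w makes the integrands bounded on [0, t]. *)
Definition trajectory (x : R * R) (t : R) (ab : R -> R * R) (w : R -> R * R) :
    Prop :=
  {within `[0, t], continuous w} /\
  forall s, 0 <= s <= t ->
    (w s).1 =
      x.1 - \int[lebesgue_measure]_(r in `[s, t]) (drift (w r) r (ab r)).1 /\
    (w s).2 =
      x.2 - \int[lebesgue_measure]_(r in `[s, t]) (drift (w r) r (ab r)).2.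

Variables (gamma : R -> R -> R -> \bar R) (v0 : R * R -> \bar R).

(* The drift is locally Lipschitz in the state, so a trajectory, if any, is
   unique on [0, t], and there is none exactly when the backward solution blows
   up before reaching time 0. *)
Definition initial_cost (x : R * R) (t : R) (ab : R -> R * R) : \bar R :=
  if `[< exists w, trajectory x t ab w >]
  then v0 (get (trajectory x t ab) 0) else +oo%E.

Definition total_cost (x : R * R) (t : R) (ab : R -> R * R) : \bar R :=
  (\int[lebesgue_measure]_(s in `[0%R, t]) gamma s (ab s).1 (ab s).2
   + initial_cost x t ab)%E.

(* value control_values is v, and value (control_values_le M) is v^M. *)
Definition value (A : set (R * R)) (q : R * R * R) : \bar R :=
  ereal_inf [set total_cost q.1 q.2 ab | ab in controls A].

(* hamiltonian control_values is H, and hamiltonian (control_values_le M) is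
   H_M. *)
Definition hamiltonian (A : set (R * R)) (x : R * R) (t : R) (p : R * R) :
    \bar R :=
  ereal_sup [set (((drift x t ab).1 * p.1 + (drift x t ab).2 * p.2)%:E
                  - gamma t ab.1 ab.2)%E | ab in A].

End dynamics.

Section cost_hypotheses.
Context {R : realType}.

Definition running_cost (gamma : R -> R -> R -> \bar R) : Prop :=
  [/\ forall t a b, 0 <= t -> 0 <= b -> (0 <= gamma t a b)%E,
      {within [set q : R * R * R | 0 <= q.1.1 /\ 0 <= q.2],
        continuous (fun q => gamma q.1.1 q.1.2 q.2)},
      forall t a b, 0 <= t -> 0 < b -> (gamma t a b < +oo)%E &
      exists2 p : R, 1 < p &
        forall T, 0 < T -> forall K : R, exists r : R, forall a b,
          0 <= b -> r < `|a| + b ->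
          (K%:E <= ereal_inf [set gamma t a b *
                                  ((`|a| `^ p + b `^ p)^-1)%:E
                             | t in `[0%R, T]])%E].

Definition locally_lipschitz (D : set (R * R)) (g : R * R -> R) : Prop :=
  forall x, D x ->
    exists2 N, nbhs x N & [lipschitz g y | y in N `&` D].

Definition coercive_initial_cost (v0 : R * R -> \bar R) : Prop :=
  (forall K : R, exists r : R, forall x, r < `|x| -> (K%:E <= v0 x)%E) /\
  (forall K : R, exists2 d : R, 0 < d &
     forall x1 x2, 0 < x2 < d -> (K%:E <= v0 (x1, x2))%E).

Definition admissible_initial_cost (v0 : R * R -> \bar R) : Prop :=
  [/\ forall x, ~ halfplane x -> v0 x = +oo%E,
      forall x, halfplane x -> v0 x \is a fin_num,
      exists m : R, forall x, halfplane x -> (m%:E <= v0 x)%E,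
      locally_lipschitz halfplane (fine \o v0) &
      coercive_initial_cost v0].

End cost_hypotheses.

Section viscosity.
Context {R : realType}.
Implicit Types (O : set (R * R * R)) (phi u : R * R * R -> R).

Definition C1_on O phi : Prop :=
  forall q, O q -> differentiable phi q /\
    forall d : R * R * R, {for q, continuous (fun y => 'D_d phi y)}.

Definition time_derivative phi (q : R * R * R) : R := 'D_(0, 0, 1) phi q.

Definition space_gradient phi (q : R * R * R) : R * R :=
  ('D_(1, 0, 0) phi q, 'D_(0, 1, 0) phi q).

Definition local_max (h : R * R * R -> R) (q : R * R * R) : Prop :=
  \forall y \near q, h y <= h q.

Definition local_min (h : R * R * R -> R) (q : R * R * R) : Prop :=
  \forall y \near q, h q <= h y.

Variable G : R * R -> R -> R * R -> \bar R.

(* In the following definitions O is meant to be open, so that local extrema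
   relative to O and relative to the whole space coincide. *)
Definition viscosity_subsolution O u : Prop :=
  {within O, continuous u} /\
  forall phi, C1_on O phi -> forall q, O q ->
    local_max (fun y => u y - phi y) q ->
    ((time_derivative phi q)%:E + G q.1 q.2 (space_gradient phi q) <= 0)%E.

Definition viscosity_supersolution O u : Prop :=
  {within O, continuous u} /\
  forall phi, C1_on O phi -> forall q, O q ->
    local_min (fun y => u y - phi y) q ->
    (0 <= (time_derivative phi q)%:E + G q.1 q.2 (space_gradient phi q))%E.

Definition viscosity_solution O u : Prop :=
  viscosity_subsolution O u /\ viscosity_supersolution O u.

Definition finite_set_of (u : R * R * R -> \bar R) : set (R * R * R) :=
  [set q | cylinder q /\ (u q < +oo)%E].

(* The boundary is taken in R^2 x R, so it may contain points outside the
   cylinder; the approach is through points of the cylinder. *)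
Definition extended_viscosity_supersolution (u : R * R * R -> \bar R) : Prop :=
  [/\ forall q, cylinder q -> (-oo < u q)%E,
      open (finite_set_of u),
      viscosity_supersolution (finite_set_of u) (fine \o u) &
      forall q, boundary (cylinder `\` finite_set_of u) q ->
        u y @[y --> within cylinder (nbhs q)] --> +oo%E].

End viscosity.

(* Main.v *)
Require Import Defs.
From HB Require Import structures.
From mathcomp Require Import all_boot all_order all_algebra.
From mathcomp Require Import all_classical all_reals all_analysis.
From mathcomp Require Import measurable_realfun ring lra.

(** The system is triangular: the second coordinate of a trajectory solves a
    Riccati equation driven by the control, and the first one a linear
    equation whose coefficients depend on the second. The controls being
    merely measurable, trajectories are treated as primitives of bounded
    measurable functions. Their calculus (chain rule, integrating factors,
    uniqueness, positivity) is derived from a single remark: a function with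
    increments of order (t - s)^2 is constant ([quadratic_increment_cst],
    [primitive_comp]).

    A finite value means that some path in the half-plane has a real cost; the
    relation [attains] records this, and [attains_extend] and
    [attains_restrict] are the two inequalities of the dynamic programming
    principle. Superlinear growth of the running cost makes the controls of
    bounded cost equi-integrable, and coercivity of the initial cost confines
    the initial points. Paths of bounded cost therefore stay in a compact
    subset of the half-plane and are equicontinuous ([path_bounds],
    [path_modulus]).

    Regularity of the value comes from two constructions. The end point of a
    path can be moved while its control is kept, because the change of the
    second coordinate solves a Bernoulli equation, whose solution is explicit
    ([path_perturb]). Any point of the half-plane can be reached in a short
    time, at a cost proportional to that time, from a nearby point and with
    controls of arbitrarily small size ([steer]). Together they show that a
    cost attained at one point is attained, up to e, at all neighbouring
    points and times ([attains_nearby]). This single estimate gives the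
    openness of the set of finiteness, continuity on it, and divergence at
    those points of the boundary that lie over the open half-plane, including
    those at time 0. At the other boundary points divergence holds because
    paths of bounded cost cannot end near the boundary of the half-plane
    ([attains_away_from_boundary]).

    The viscosity inequalities follow the classical pattern. If the
    supersolution inequality fails at a minimum point of v - phi, the running
    cost exceeds f . grad phi + phi_t by a margin for all controls; the margin
    persists nearby, uniformly over the unbounded set of controls
    ([local_gap]), and integration along a nearly optimal path contradicts
    minimality ([supersolution]). If the subsolution inequality fails for some
    (a, b) with b > 0, the explicit path whose second coordinate is affine,
    with a control equal to (a, b) at the final time, contradicts maximality;
    the case b = 0 is a limit ([subsolution]). In both cases the increment of
    phi along the path is computed by the mean value theorem, with the
    derivatives of phi at one intermediate point.

    The data are given for t >= 0 and b >= 0. They are first replaced by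
    continuous extensions, composed with max(., 0), with the same value
    function and the same Hamiltonian on the cylinder. *)

Set Implicit Arguments.
Unset Strict Implicit.
Unset Printing Implicit Defensive.

Import Order.TTheory GRing.Theory Num.Theory.
Import numFieldNormedType.Exports.

Local Open Scope classical_set_scope.
Local Open Scope ring_scope.

(** Linear arithmetic from the hypotheses that have been pushed back into the
    goal, which singles them out in a long context. *)
Ltac lra_from_goal :=
  repeat match goal with H : is_true _ |- _ => clear H end; lra.

(** * Bounded measurable functions on a segment *)

Section tame.
Context {R : realType}.
Implicit Types (a b s t u L : R) (f g : R -> R).
Notation mu := (@lebesgue_measure R).

(** The right-hand sides of the equations belong to this class, which is an
    algebra of integrable functions. The bound is pointwise, so that it can be
    used at each time and not only under an integral. *)
Definition tame a b f : Prop :=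
  measurable_fun (`[a, b] : set R) f /\
  exists L, forall r, a <= r <= b -> `|f r| <= L.

Lemma tame_eq a b f g :
  (forall r, a <= r <= b -> f r = g r) -> tame a b f -> tame a b g.
Proof.
move=> fg [mf [L fL]]; split.
  by apply: eq_measurable_fun mf => r; rewrite inE/= in_itv/= => /fg.
by exists L => r rab; rewrite -fg//; exact: fL.
Qed.

Lemma tame_sub a b s t f : a <= s -> t <= b -> tame a b f -> tame s t f.
Proof.
move=> as_ tb [mf [L fL]]; split.
  apply: measurable_funS mf => // r /=; rewrite !in_itv/= => /andP[sr rt].
  by rewrite (le_trans as_ sr) (le_trans rt tb).
by exists L => r /andP[sr rt]; apply: fL;
  rewrite (le_trans as_ sr) (le_trans rt tb).
Qed.

Lemma tame_bound a b f : tame a b f ->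
  exists2 L, 0 < L & forall r, a <= r <= b -> `|f r| <= L.
Proof.
move=> [_ [L fL]]; exists (`|L| + 1); first by rewrite ltr_wpDl.
by move=> r /fL fr; rewrite (le_trans fr)// (le_trans (ler_norm L))// lerDl.
Qed.

Lemma tame_cst a b k : tame a b (fun=> k).
Proof. by split; [exact: measurable_cst|exists `|k|]. Qed.

Lemma tameD a b f g : tame a b f -> tame a b g -> tame a b (fun r => f r + g r).
Proof.
move=> [mf [L fL]] [mg [K gK]]; split; first exact: measurable_funD.
by exists (L + K) => r rab; rewrite (le_trans (ler_normD _ _))// lerD ?fL ?gK.
Qed.

Lemma tameN a b f : tame a b f -> tame a b (fun r => - f r).
Proof.
move=> [mf [L fL]]; split; first exact: measurableT_comp.
by exists L => r rab; rewrite normrN fL.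
Qed.

Lemma tameB a b f g : tame a b f -> tame a b g -> tame a b (fun r => f r - g r).
Proof. by move=> tf tg; apply: tameD => //; exact: tameN. Qed.

Lemma tameM a b f g : tame a b f -> tame a b g -> tame a b (fun r => f r * g r).
Proof.
move=> [mf [L fL]] [mg [K gK]]; split; first exact: measurable_funM.
by exists (L * K) => r rab; rewrite normrM ler_pM ?fL ?gK.
Qed.

Lemma tameX a b f n : tame a b f -> tame a b (fun r => f r ^+ n).
Proof.
move=> tf; elim: n => [|n IH]; first exact: tame_cst.
by apply: tame_eq (tameM tf IH) => r _; rewrite exprS.
Qed.

Lemma tame_norm a b f : tame a b f -> tame a b (fun r => `|f r|).
Proof.
move=> [mf [L fL]]; split; first exact: measurableT_comp.
by exists L => r rab; rewrite normr_id fL.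
Qed.

Lemma tame_max0 a b f : tame a b f -> tame a b (fun r => Num.max (f r) 0).
Proof.
move=> tf; apply: (@tame_eq _ _ (fun r => 2^-1 * (f r + `|f r|))).
  move=> r _; case: (lerP 0 (f r)) => fr.
    by rewrite ger0_norm//; field.
  by rewrite ltr0_norm// subrr mulr0.
by apply: tameM; [exact: tame_cst|apply: tameD => //; exact: tame_norm].
Qed.

(** A continuous function on a segment has compact image. *)
Lemma tame_within a b f : {within `[a, b], continuous f} -> tame a b f.
Proof.
move=> cf; split; first exact: subspace_continuous_measurable_fun.
have cfab : compact (f @` `[a, b]).
  by apply: continuous_compact => //; exact: segment_compact.
have [M [_ /(_ (M + 1))]] := compact_bounded cfab.
rewrite ltrDl => /(_ ltr01) fM; exists (M + 1) => r rab; apply: fM => /=.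
by exists r => //=; rewrite in_itv.
Qed.

Lemma tame_continuous a b f : continuous f -> tame a b f.
Proof. by move=> cf; apply: tame_within; exact: continuous_subspaceT. Qed.

Definition clamp s t r : R := Num.min (Num.max s r) t.

Lemma clampP s t r : s <= t -> s <= clamp s t r <= t.
Proof.
by move=> st; rewrite /clamp le_min le_max lexx st/= ge_min lexx orbT.
Qed.

Lemma clamp_id s t r : s <= r <= t -> clamp s t r = r.
Proof. by move=> /andP[sr rt]; rewrite /clamp (max_idPr sr) (min_idPl rt). Qed.

Lemma clamp_continuous s t : continuous (clamp s t).
Proof.
move=> r; apply: (@continuous_min _ _ (fun r => Num.max s r) (fun=> t)).
  by apply: (@continuous_max _ _ (fun=> s) id); [exact: cvg_cst|exact: cvg_id].
exact: cvg_cst.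
Qed.

Lemma tame_integrable a b f s t : tame a b f -> a <= s -> t <= b ->
  mu.-integrable `[s, t] (EFin \o f).
Proof.
move=> tf as_ tb; have [mf [L fL]] := tame_sub as_ tb tf.
apply: measurable_bounded_integrable => //=.
  by rewrite lebesgue_measure_itv/=; case: ifP => // _; rewrite -EFinB ltry.
exists L; split; first by rewrite num_real.
move=> K LK r /=; rewrite in_itv/= => rst.
by rewrite (le_trans (fL _ rst))// ltW.
Qed.

Lemma rint_split a b f s u t : tame a b f -> a <= s -> s <= u -> u <= t ->
    t <= b ->
  \int[mu]_(r in `[s, t]) f r =
  \int[mu]_(r in `[s, u]) f r + \int[mu]_(r in `[u, t]) f r.
Proof.
move=> tf as_ su ut tb.
have ist := tame_integrable tf as_ tb.
have := @Rintegral_itvB R f (BLeft s) (BRight t) u ist.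
rewrite !bnd_simp => /(_ su ut) /eqP; rewrite subr_eq => /eqP ->.
rewrite addrC; congr (_ + _); rewrite Rintegral_itv_obnd_cbnd//.
apply: integrableS ist => // r /=; rewrite !in_itv/= => /andP[ur ->].
by rewrite andbT ltW// (le_lt_trans su).
Qed.

Lemma rint_cst s t k : s <= t -> \int[mu]_(r in `[s, t]) k = k * (t - s).
Proof.
move=> st; rewrite Rintegral_cst//= lebesgue_measure_itv/= lte_fin.
by case: ltP => [//|ts]; rewrite (@le_anti _ _ s t) ?st// subrr.
Qed.

Lemma rint_pt f s : \int[mu]_(r in `[s, s]) f r = 0.
Proof. by rewrite set_itv1 Rintegral_set1. Qed.

Lemma eq_rint f g s t : (forall r, s <= r <= t -> f r = g r) ->
  \int[mu]_(r in `[s, t]) f r = \int[mu]_(r in `[s, t]) g r.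
Proof.
by move=> fg; apply: eq_Rintegral => r; rewrite inE/= in_itv/= => /fg.
Qed.

Lemma rintD a b f g s t : tame a b f -> tame a b g -> a <= s -> t <= b ->
  \int[mu]_(r in `[s, t]) (f r + g r) =
  \int[mu]_(r in `[s, t]) f r + \int[mu]_(r in `[s, t]) g r.
Proof.
by move=> tf tg as_ tb; apply: RintegralD => //; exact: (@tame_integrable a b).
Qed.

Lemma rintZ a b f k s t : tame a b f -> a <= s -> t <= b ->
  \int[mu]_(r in `[s, t]) (k * f r) = k * \int[mu]_(r in `[s, t]) f r.
Proof.
by move=> tf as_ tb; apply: RintegralZl => //; exact: (@tame_integrable a b).
Qed.

Lemma le_rint a b f g s t : tame a b f -> tame a b g -> a <= s -> t <= b ->
  (forall r, s <= r <= t -> f r <= g r) ->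
  \int[mu]_(r in `[s, t]) f r <= \int[mu]_(r in `[s, t]) g r.
Proof.
move=> tf tg as_ tb fg; apply: le_Rintegral => [//| | |].
- exact: tame_integrable tf as_ tb.
- exact: tame_integrable tg as_ tb.
- by move=> r /=; rewrite in_itv/= => /fg.
Qed.

Lemma ler_norm_rint a b f g s t :
  tame a b f -> tame a b g -> a <= s -> t <= b ->
  (forall r, s <= r <= t -> `|f r| <= g r) ->
  `|\int[mu]_(r in `[s, t]) f r| <= \int[mu]_(r in `[s, t]) g r.
Proof.
move=> tf tg as_ tb fg.
apply: le_trans (le_normr_Rintegral _ (tame_integrable tf as_ tb)) _ => //.
exact: le_rint (tame_norm tf) tg _ _ _.
Qed.

End tame.

(** * Primitives of bounded measurable functions *)

Section primitive.
Context {R : realType}.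
Implicit Types (a b s t u L : R) (f g F G : R -> R).
Notation mu := (@lebesgue_measure R).

(** Absolute continuity with a bounded density, in integrated form: f is a
    derivative of F almost everywhere, but differentiation does not occur. *)
Definition primitive a b F f : Prop := tame a b f /\
  forall s t, a <= s -> s <= t -> t <= b ->
    F t - F s = \int[mu]_(r in `[s, t]) f r.

Lemma primitive_eq a b F f G g :
  (forall r, a <= r <= b -> F r = G r) ->
    (forall r, a <= r <= b -> f r = g r) ->
  primitive a b F f -> primitive a b G g.
Proof.
move=> FG fg [tf Ff]; split; first exact: tame_eq tf.
move=> s t as_ st tb; rewrite -!FG ?Ff//; last 2 first.
  by rewrite as_ (le_trans st).
  by rewrite (le_trans as_ st).
apply: eq_rint => r /andP[sr rt].
by rewrite fg// (le_trans as_ sr) (le_trans rt tb).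
Qed.

Lemma primitive_sub a b s t F f : a <= s -> t <= b ->
  primitive a b F f -> primitive s t F f.
Proof.
move=> as_ tb [tf Ff]; split; first exact: tame_sub tf.
by move=> u v su uv vt; apply: Ff => //;
  [exact: le_trans su|exact: le_trans tb].
Qed.

Lemma primitive_lipschitz a b F f : primitive a b F f ->
  exists2 L, 0 < L & forall s t, a <= s <= b -> a <= t <= b ->
    `|F t - F s| <= L * `|t - s|.
Proof.
move=> [tf Ff]; have [L L0 fL] := tame_bound tf; exists L => //.
have key s t : a <= s -> s <= t -> t <= b -> `|F t - F s| <= L * `|t - s|.
  move=> as_ st tb; rewrite Ff// (@ger0_norm _ (t - s)) ?subr_ge0//.
  rewrite -rint_cst//; apply: (ler_norm_rint tf (tame_cst a b L)) => // r
    /andP[sr rt].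
  by apply: fL; rewrite (le_trans as_ sr) (le_trans rt tb).
move=> s t /andP[as_ sb] /andP[at_ tb].
have [st|/ltW ts] := leP s t; first exact: key.
by rewrite distrC (distrC t); exact: key.
Qed.

(** Composition with [clamp] turns a function that is Lipschitz on the segment
    into one that is continuous on the line. *)
Lemma lipschitz_tame a b F L : 0 <= L ->
  (forall s t, a <= s <= b -> a <= t <= b -> `|F t - F s| <= L * `|t - s|) ->
  tame a b F.
Proof.
move=> L0 FL.
have [ab|ba] := leP a b; last first.
  have e : [set` `[a, b]] = set0 :> set R.
    by rewrite set_itv_ge// bnd_simp -ltNge.
  split; first by rewrite e; exact: measurable_fun_set0.
  by exists 0 => r /andP[ar rb]; have := le_lt_trans (le_trans ar rb) ba;
    rewrite ltxx.
apply: (@tame_eq _ _ _ (F \o clamp a b)).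
  by move=> r /clamp_id /= ->.
apply: tame_continuous => t; apply/cvgrPdist_lt => e e0.
near=> s; rewrite /= (le_lt_trans (FL _ _ (clampP s ab) (clampP t ab)))//.
have : `|clamp a b t - clamp a b s| < e / (L + 1).
  near: s; apply: (@cvgr_dist_lt _ _ _ _ _ (clamp a b)).
    exact: clamp_continuous.
  by rewrite divr_gt0// ltr_wpDl.
rewrite ltr_pdivlMr ?ltr_wpDl// => h.
by apply: le_lt_trans h; rewrite mulrC ler_wpM2l// lerDl.
Unshelve. all: by end_near. Qed.

Lemma primitive_tame a b F f : primitive a b F f -> tame a b F.
Proof. by move=> /primitive_lipschitz[L /ltW L0]; exact: lipschitz_tame. Qed.

(** Cutting [s, t] into n equal pieces bounds the increment by C (t - s)^2 /
    n. This is the substitute for the fact that a function with zero derivative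
    is constant. *)
Lemma quadratic_increment_cst a b C F :
  (forall s t, a <= s -> s <= t -> t <= b -> `|F t - F s| <=
    C * (t - s) ^+ 2) ->
  forall s t, a <= s -> s <= t -> t <= b -> F t = F s.
Proof.
move=> FC s t as_ st tb.
have step n d : 0 <= d -> s + n%:R * d <= b ->
    `|F (s + n%:R * d) - F s| <= n%:R * (C * d ^+ 2).
  move=> d0; elim: n => [|n IH] nb; first by rewrite !mul0r addr0 subrr normr0.
  have e : s + n.+1%:R * d = (s + n%:R * d) + d by rewrite -natr1; ring.
  have nd0 : 0 <= n%:R * d by rewrite mulr_ge0.
  have h1 : s + n%:R * d <= b by rewrite (le_trans _ nb)// e lerDl.
  have h2 : `|F (s + n.+1%:R * d) - F (s + n%:R * d)| <= C * d ^+ 2.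
    have := FC (s + n%:R * d) (s + n.+1%:R * d).
    rewrite e (_ : s + n%:R * d + d - (s + n%:R * d) = d); last by ring.
    apply; [by lra|by lra|by rewrite -e].
  have -> : F (s + n.+1%:R * d) - F s =
    (F (s + n.+1%:R * d) - F (s + n%:R * d)) + (F (s + n%:R * d) - F s) by ring.
  have -> : n.+1%:R * (C * d ^+ 2) = C * d ^+ 2 + n%:R * (C * d ^+ 2).
    by rewrite -natr1; ring.
  by rewrite (le_trans (ler_normD _ _))// lerD// IH.
apply/eqP; rewrite -subr_eq0 -normr_le0 leNgt; apply/negP => ne0.
set X := C * (t - s) ^+ 2.
have bound n : n.+1%:R * `|F t - F s| <= X.
  have n0 : (n.+1%:R : R) != 0 by rewrite pnatr_eq0.
  have := step n.+1 ((t - s) / n.+1%:R).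
  have -> : s + n.+1%:R * ((t - s) / n.+1%:R) = t by field.
  rewrite divr_ge0 ?subr_ge0// => /(_ isT tb) h.
  have -> : X = n.+1%:R * (n.+1%:R * (C * ((t - s) / n.+1%:R) ^+ 2)).
    by rewrite /X; field.
  by rewrite ler_pM2l// ltr0n.
have := archi_boundP (normr_ge0 (X / `|F t - F s|)).
set n := Num.bound _ => hn.
have := bound n; apply/negP; rewrite -ltNge.
rewrite -ltr_pdivrMr// (le_lt_trans (ler_norm _))// (lt_trans hn)//.
by rewrite ltr_nat.
Qed.

End primitive.

(** * Differential calculus for primitives *)

Section primitive_calculus.
Context {R : realType}.
Implicit Types (a b s t u L : R) (f g F G : R -> R).
Notation mu := (@lebesgue_measure R).

Lemma primitive_cst a b k : primitive a b (fun=> k) (fun=> 0).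
Proof.
split; first exact: tame_cst.
by move=> s t _ st _; rewrite rint_cst// subrr mul0r.
Qed.

Lemma primitive_id a b : primitive a b (fun s => s) (fun=> 1).
Proof.
split; first exact: tame_cst.
by move=> s t _ st _; rewrite rint_cst// mul1r.
Qed.

Lemma primitiveD a b F f G g : primitive a b F f -> primitive a b G g ->
  primitive a b (fun r => F r + G r) (fun r => f r + g r).
Proof.
move=> [tf Ff] [tg Gg]; split; first exact: tameD.
move=> s t as_ st tb; rewrite (rintD tf tg)// -Ff// -Gg//; ring.
Qed.

Lemma primitiveZ a b F f k : primitive a b F f ->
  primitive a b (fun r => k * F r) (fun r => k * f r).
Proof.
move=> [tf Ff]; split; first by apply: tameM => //; exact: tame_cst.
move=> s t as_ st tb; rewrite (rintZ _ tf)// -Ff//; ring.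
Qed.

Lemma primitiveN a b F f : primitive a b F f ->
  primitive a b (fun r => - F r) (fun r => - f r).
Proof.
by move=> /(primitiveZ (-1)); apply: primitive_eq => r _; rewrite mulN1r.
Qed.

Lemma primitiveB a b F f G g : primitive a b F f -> primitive a b G g ->
  primitive a b (fun r => F r - G r) (fun r => f r - g r).
Proof. by move=> pF pG; apply: primitiveD => //; exact: primitiveN. Qed.

Lemma primitive_rint a b f : tame a b f ->
  primitive a b (fun s => \int[mu]_(r in `[a, s]) f r) f.
Proof.
move=> tf; split=> // s t as_ st tb.
rewrite (@rint_split _ a b f a s t)//; ring.
Qed.

Lemma le_primitive a b F f G g s t : primitive a b F f -> primitive a b G g ->
  a <= s -> s <= t -> t <= b -> (forall r, s <= r <= t -> f r <= g r) ->
  F t - F s <= G t - G s.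
Proof.
by move=> [tf Ff] [tg Gg] as_ st tb fg; rewrite Ff// Gg//;
  exact: le_rint tf tg _ _ _.
Qed.

Lemma primitive_nondecreasing a b F f s t : primitive a b F f ->
  a <= s -> s <= t -> t <= b -> (forall r, s <= r <= t -> 0 <= f r) ->
    F s <= F t.
Proof.
move=> pF as_ st tb f0.
by have := le_primitive (primitive_cst a b 0) pF as_ st tb f0;
  rewrite subrr subr_ge0.
Qed.

(** The chain rule. The hypotheses hold when phi is of class C^1 on the range of
    F with a Lipschitz derivative dphi. The difference between phi o F and the
    integral of its expected density then has quadratic increments, so that it
    is constant. *)
Lemma primitive_comp a b F f phi dphi C : 0 <= C -> primitive a b F f ->
  (forall s t, a <= s <= b -> a <= t <= b ->
     `|phi (F t) - phi (F s) - dphi (F s) * (F t - F s)| <=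
     C * (F t - F s) ^+ 2) ->
  (forall s t, a <= s <= b -> a <= t <= b ->
     `|dphi (F t) - dphi (F s)| <= C * `|F t - F s|) ->
  primitive a b (fun r => phi (F r)) (fun r => dphi (F r) * f r).
Proof.
move=> C0 pF phi1 phi2; have [tf Ff] := pF.
have [L L0 FL] := primitive_lipschitz pF.
have [K K0 fK] := tame_bound tf.
have tdphi : tame a b (fun r => dphi (F r)).
  apply: (@lipschitz_tame _ _ _ _ (C * L)); first by rewrite mulr_ge0// ltW.
  move=> s t sab tab; rewrite (le_trans (phi2 _ _ sab tab))// -mulrA.
  by rewrite ler_wpM2l// FL.
have tg := tameM tdphi tf; split=> //.
set g := fun r => dphi (F r) * f r in tg *.
pose h s := phi (F s) - \int[mu]_(r in `[a, s]) g r.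
suff hcst s t : a <= s -> s <= t -> t <= b -> h t = h s.
  move=> s t as_ st tb; have := hcst s t as_ st tb.
  rewrite /h (@rint_split _ a b g a s t)//; lra.
apply: (@quadratic_increment_cst _ _ _ (C * L ^+ 2 + C * L * K)) =>
  {}s {}t as_ st tb.
have sab : a <= s <= b by rewrite as_ (le_trans st).
have tab : a <= t <= b by rewrite tb (le_trans as_).
(* Freeze dphi o F at its value at s: what is left is the Taylor remainder of
   phi and the integral of a variation of dphi o F. *)
have -> : h t - h s = (phi (F t) - phi (F s) - dphi (F s) * (F t - F s)) +
    \int[mu]_(r in `[s, t]) ((dphi (F s) - dphi (F r)) * f r).
  rewrite /h (@rint_split _ a b g a s t)//.
  have -> : \int[mu]_(r in `[s, t]) ((dphi (F s) - dphi (F r)) * f r) =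
      dphi (F s) * \int[mu]_(r in `[s, t]) f r - \int[mu]_(r in `[s, t]) g r.
    rewrite -(rintZ _ tf)// -[X in _ = _ + X]mulN1r -(rintZ _ tg)//.
    rewrite -(@rintD _ a b)//; first by apply: eq_rint => r _; rewrite /g; ring.
    - by apply: tameM => //; exact: tame_cst.
    - by apply: tameM => //; exact: tame_cst.
  rewrite -Ff//; ring.
rewrite (le_trans (ler_normD _ _))// mulrDl lerD//.
  rewrite (le_trans (phi1 _ _ sab tab))// -mulrA ler_wpM2l// -exprMn.
  rewrite -[leLHS]real_normK ?num_real// ler_sqr ?nnegrE//; last first.
    by rewrite mulr_ge0// ?(ltW L0)// subr_ge0.
  by have := FL s t sab tab; rewrite (@ger0_norm _ (t - s)) ?subr_ge0.
have -> : C * L * K * (t - s) ^+ 2 = (C * (L * (t - s)) * K) * (t - s) by ring.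
rewrite -rint_cst//; apply: (@ler_norm_rint _ a b) => //.
- by apply: tameM => //; apply: tameB => //; exact: tame_cst.
- exact: tame_cst.
move=> r /andP[sr rt]; have rab : a <= r <= b.
  by rewrite (le_trans as_ sr) (le_trans rt tb).
rewrite normrM ler_pM ?fK// (le_trans (phi2 r s rab sab))// ler_wpM2l//.
rewrite (le_trans (FL _ _ rab sab))// ler_wpM2l ?(ltW L0)//.
by rewrite ler_norml; lra.
Qed.

Lemma primitive_sqr a b F f : primitive a b F f ->
  primitive a b (fun r => F r ^+ 2) (fun r => 2 * F r * f r).
Proof.
move=> pF;
  apply: (@primitive_comp a b F f (fun x => x ^+ 2) (fun x => 2 * x) 2) => //.
  move=> s t _ _; have -> : F t ^+ 2 - F s ^+ 2 - 2 * F s * (F t - F s) =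
    (F t - F s) ^+ 2 by ring.
  by rewrite ger0_norm ?sqr_ge0//; have := sqr_ge0 (F t - F s); lra.
by move=> s t _ _; rewrite -mulrBr normrM ger0_norm.
Qed.

(** By polarisation, F G = ((F + G)^2 - (F - G)^2) / 4. *)
Lemma primitiveM a b F f G g : primitive a b F f -> primitive a b G g ->
  primitive a b (fun r => F r * G r) (fun r => f r * G r + F r * g r).
Proof.
move=> pF pG;
  have := primitiveZ 4^-1 (primitiveB (primitive_sqr (primitiveD pF pG))
  (primitive_sqr (primitiveB pF pG))).
by apply: primitive_eq => r _; field.
Qed.

Lemma expR_tangent (x y : R) : expR x * (1 + (y - x)) <= expR y.
Proof.
have -> : expR y = expR x * expR (y - x).
  by rewrite -expRD; congr expR; rewrite addrC subrK.
by rewrite ler_pM2l ?expR_gt0// expR_ge1Dx.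
Qed.

(** Both estimates required by the chain rule follow from the tangent inequality
    on the bounded range of F. *)
Lemma primitive_expR a b F f : primitive a b F f ->
  primitive a b (fun r => expR (F r)) (fun r => expR (F r) * f r).
Proof.
move=> pF; have [B _ FB] := tame_bound (primitive_tame pF).
have le_expB x y : `|x| <= B -> x <= y -> y <= B ->
    0 <= expR y - expR x <= expR B * (y - x).
  move=> xB xy yB; rewrite subr_ge0 ler_expR xy/=.
  have h := expR_tangent y x.
  have h2 : expR y * (y - x) <= expR B * (y - x).
    by rewrite ler_wpM2r ?subr_ge0// ler_expR.
  lra.
have dexp x y : `|x| <= B -> `|y| <= B -> `|expR y - expR x| <=
  expR B * `|y - x|.
  move=> xB yB; have [xy|/ltW yx] := leP x y.
    have /andP[h1 h2] := le_expB _ _ xB xy (le_trans (ler_norm _) yB).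
    by rewrite ger0_norm// (@ger0_norm _ (y - x)) ?subr_ge0.
  have /andP[h1 h2] := le_expB _ _ yB yx (le_trans (ler_norm _) xB).
  by rewrite distrC ger0_norm// distrC (@ger0_norm _ (x - y)) ?subr_ge0.
apply: (@primitive_comp a b F f expR expR (expR B)) => //.
  move=> s t /FB sB /FB tB; move: (F s) (F t) sB tB => x y xB yB.
  have h1 : 0 <= expR y - expR x - expR x * (y - x).
    by have := expR_tangent x y; lra.
  have h2 : expR y - expR x - expR x * (y - x) <= (expR y - expR x) * (y - x).
    by have := expR_tangent y x; lra.
  rewrite ger0_norm// (le_trans h2)// (le_trans (ler_norm _))// normrM.
  by rewrite -[_ ^+ 2]real_normK ?num_real// expr2 mulrA ler_wpM2r// dexp.
by move=> s t /FB sB /FB tB; exact: dexp.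
Qed.

Lemma primitive_inv a b F f d : 0 < d -> (forall r, a <= r <= b -> d <= F r) ->
  primitive a b F f ->
  primitive a b (fun r => (F r)^-1) (fun r => - (f r / F r ^+ 2)).
Proof.
move=> d0 Fd pF.
(* Half of the bound 2 / d^3 for the second derivative of 1 / x on [d, +oo[. *)
have lem x y : d <= x -> d <= y -> (x ^+ 2 * y)^-1 <= d ^- 3.
  move=> dx dy; have x0 : 0 < x by lra.
  have y0 : 0 < y by lra.
  rewrite lef_pV2 ?posrE ?exprn_gt0// ?mulr_gt0// ?exprn_gt0//.
  by rewrite exprSr ler_pM ?sqr_ge0 ?(ltW d0)// ler_sqr ?nnegrE// ltW.
have := @primitive_comp a b F f (fun x => x^-1) (fun x => - x ^- 2)
  (2 * d ^- 3) _ pF.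
have d3 : 0 <= d ^- 3 by rewrite invr_ge0 exprn_ge0// ltW.
have -> : 0 <= 2 * d ^- 3 by rewrite mulr_ge0.
move=> h; apply: primitive_eq (h isT _ _) =>
  [//|r _ /=|s t /Fd ds /Fd dt|s t /Fd ds /Fd dt].
- by ring.
- move: (F s) (F t) ds dt => x y dx dy.
  have x0 : x != 0 by apply: lt0r_neq0; lra.
  have y0 : y != 0 by apply: lt0r_neq0; lra.
  have -> : y^-1 - x^-1 - - x ^- 2 * (y - x) = (x ^+ 2 * y)^-1 * (y - x) ^+ 2.
    by field; rewrite x0 y0.
  rewrite normrM (@ger0_norm _ (_ ^+ 2)) ?sqr_ge0// ler_wpM2r ?sqr_ge0//.
  rewrite ger0_norm ?invr_ge0; last by rewrite mulr_ge0 ?sqr_ge0//; lra.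
  by rewrite (le_trans (lem x y dx dy))//; lra.
- move: (F s) (F t) ds dt => x y dx dy.
  have x0 : x != 0 by apply: lt0r_neq0; lra.
  have y0 : y != 0 by apply: lt0r_neq0; lra.
  have -> : - y ^- 2 - - x ^- 2 = ((x ^+ 2 * y)^-1 + (y ^+ 2 * x)^-1) * (y - x).
    by field; rewrite x0 y0.
  rewrite normrM ler_wpM2r// ger0_norm; last first.
    by rewrite addr_ge0// invr_ge0 mulr_ge0 ?sqr_ge0//; lra.
  by have := lem x y dx dy; have := lem y x dy dx; lra.
Qed.

(** Multiplication by an integrating factor: k F cancels when f is of the form g
    - k F. *)
Lemma primitive_expM a b F f K k : primitive a b F f -> primitive a b K k ->
  primitive a b (fun r => F r * expR (K r))
                (fun r => (f r + k r * F r) * expR (K r)).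
Proof.
move=> pF pK; apply: primitive_eq (primitiveM pF (primitive_expR pK)) => // r _;
  ring.
Qed.

(** Variation of constants. The value is prescribed at the right end, as in the
    terminal condition of a trajectory. *)
Lemma linear_ode a b k g y : a <= b -> tame a b k -> tame a b g ->
  exists2 Y, primitive a b Y (fun r => g r - k r * Y r) & Y b = y.
Proof.
move=> ab tk tg.
have pK := primitive_rint tk; set K := (fun s => \int[_]_(_ in _) k _) in pK.
have pE := primitive_expR pK; have pN := primitive_expR (primitiveN pK).
have pI := primitive_rint (tameM tg (primitive_tame pE)).
set I := (fun s => \int[_]_(_ in _) _) in pI.
pose y0 := y * expR (K b) - I b.
exists (fun s => expR (- K s) * (y0 + I s)).
  apply: primitive_eq (primitiveM pN (primitiveD (primitive_cst a b y0) pI)) =>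
    // r _.
  have -> : expR (- K r) * (0 + g r * expR (K r)) =
    g r * (expR (K r) * expR (- K r)).
    by ring.
  rewrite expRxMexpNx_1; ring.
by rewrite /y0 subrK mulrC -mulrA expRxMexpNx_1 mulr1.
Qed.

(** Gronwall's lemma backwards in time: F^2 exp(2 L r) is nondecreasing and
    vanishes at b. *)
Lemma primitive_eq0 a b F f L : primitive a b F f -> F b = 0 ->
  (forall r, a <= r <= b -> `|f r| <= L * `|F r|) ->
  forall r, a <= r <= b -> F r = 0.
Proof.
move=> pF Fb0 fL r /andP[ar rb].
have pG := primitive_expM (primitive_sqr pF)
  (primitiveZ (2 * L) (primitive_id a b)).
have := primitive_nondecreasing pG ar rb (lexx b) _.
rewrite Fb0 expr0n/= mul0r => h.
have : F r ^+ 2 * expR (2 * L * r) <= 0.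
  apply: h => s /andP[rs sb]; apply: mulr_ge0; last exact: expR_ge0.
  have sab : a <= s <= b by rewrite sb (le_trans ar).
  have : `|F s * f s| <= L * F s ^+ 2.
    rewrite normrM -[_ ^+ 2]real_normK ?num_real// expr2 [leRHS]mulrCA.
    by rewrite ler_wpM2l// fL.
  by rewrite ler_norml; lra.
rewrite pmulr_lle0 ?expR_gt0// => Fr.
by apply/eqP; rewrite -sqrf_eq0 eq_le Fr sqr_ge0.
Qed.

(** By the first sign condition the square of the negative part of F is
    nonincreasing, hence zero. By the second one F times the exponential of a
    primitive of k is then nondecreasing, hence positive. *)
Lemma primitive_gt0 a b F f k : tame a b k -> primitive a b F f -> 0 < F a ->
  (forall r, a <= r <= b -> F r <= 0 -> 0 <= f r) ->
  (forall r, a <= r <= b -> 0 <= F r -> - (k r * F r) <= f r) ->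
  forall r, a <= r <= b -> 0 < F r.
Proof.
move=> tk pF Fa0 fneg fpos.
have F0 r : a <= r <= b -> 0 <= F r.
  move=> /andP[ar rb].
  have := @primitive_comp a b F f (fun x => Num.min x 0 ^+ 2)
    (fun x => 2 * Num.min x 0) 2 _ pF.
  move=> /(_ (ler0n R 2)) h0.
  have pG : primitive a b (fun r => Num.min (F r) 0 ^+ 2)
      (fun r => 2 * Num.min (F r) 0 * f r).
    apply: h0 => s t _ _; move: (F s) (F t) => x y.
    - have := (sqr_ge0 x, sqr_ge0 y, sqr_ge0 (y - x)) => -[[]].
      rewrite ler_norml; case: (lerP x 0) => x0; case: (lerP y 0) => y0.
      + by move=> *; nra.
      + by have := mulr_le0_ge0 x0 (ltW y0) => *; nra.
      + by have := mulr_ge0_le0 (ltW x0) y0 => *; nra.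
      + by move=> *; nra.
    - rewrite -mulrBr normrM ger0_norm// ler_wpM2l//.
      have := (ler_norm (y - x), ler_norm (- (y - x))) => -[]; rewrite normrN.
      by rewrite ler_norml; case: (lerP x 0) => ?; case: (lerP y 0) => ?; lra.
  have := le_primitive pG (primitive_cst a b 0) (lexx a) ar rb _.
  rewrite (min_idPr (ltW Fa0)) expr0n/= !subr0 => h.
  have : Num.min (F r) 0 ^+ 2 <= 0.
    apply: h => s /andP[as_ sr]; have sab : a <= s <=
      b by rewrite as_ (le_trans sr).
    have [Fs|Fs] := leP (F s) 0; last by rewrite mulr0 mul0r.
    by have := fneg s sab Fs; nra.
  rewrite le_eqVlt ltNge sqr_ge0 orbF sqrf_eq0 => /eqP e0.
  by rewrite leNgt; apply/negP => Fr; move: e0; rewrite min_l ?(ltW Fr)//; lra.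
move=> r /andP[ar rb].
have pG := primitive_expM pF (primitive_rint tk).
have := primitive_nondecreasing pG (lexx a) ar rb _.
rewrite rint_pt expR0 mulr1 => h.
have : F a <= F r * expR (\int[mu]_(s in `[a, r]) k s).
  apply: h => s /andP[as_ sr]; have sab : a <= s <=
    b by rewrite as_ (le_trans sr).
  rewrite mulr_ge0 ?expR_ge0//; have := fpos s sab (F0 s sab); lra.
move=> /(lt_le_trans Fa0); by rewrite pmulr_lgt0// expR_gt0.
Qed.

End primitive_calculus.

(** * The norm of a pair *)

Section pair_norm.
Context {R : realType}.
Implicit Types z : R * R.

Lemma norm_pairE z : `|z| = Num.max `|z.1| `|z.2|.
Proof. by case: z => x y; rewrite /Num.norm. Qed.

Lemma ler_norm1 z : `|z.1| <= `|z|.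
Proof. by rewrite norm_pairE le_max lexx. Qed.

Lemma ler_norm2 z : `|z.2| <= `|z|.
Proof. by rewrite norm_pairE le_max lexx orbT. Qed.

Lemma norm_pair_le z e : (`|z| <= e) = (`|z.1| <= e) && (`|z.2| <= e).
Proof. by rewrite norm_pairE ge_max. Qed.

Lemma norm_pair_lt z e : (`|z| < e) = (`|z.1| < e) && (`|z.2| < e).
Proof. by rewrite norm_pairE gt_max. Qed.

Lemma ler_dist_max0 (u v : R) : `|Num.max u 0 - Num.max v 0| <= `|u - v|.
Proof.
have := (ler_norm (u - v), ler_norm (- (u - v))) => -[]; rewrite normrN.
by rewrite ler_norml; case: (lerP u 0) => ?; case: (lerP v 0) => ?; lra.
Qed.

End pair_norm.

(** * Concatenation, and composition with a continuous function *)

Section within.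
Context {R : realType}.
Implicit Types (a b s t u : R) (f g F G : R -> R).
Notation mu := (@lebesgue_measure R).

Lemma primitive_within a b F f : primitive a b F f ->
  {within `[a, b], continuous F}.
Proof.
move=> /primitive_lipschitz[L L0 FL]; apply/subspace_continuousP => t /=.
rewrite in_itv/= => tab; apply/cvgrPdist_lt => e e0.
rewrite !near_withinE; near=> s; rewrite /= in_itv/= => sab.
rewrite (le_lt_trans (FL _ _ sab tab))// mulrC -ltr_pdivlMr//.
near: s; apply: (@cvgr_dist_lt _ _ _ _ _ id) => //.
by rewrite divr_gt0.
Unshelve. all: by end_near. Qed.

Lemma tame_cat a u b f g : a <= u -> u <= b ->
  tame a u f -> tame u b g -> (forall r, u < r <= b -> f r = g r) -> tame a b f.
Proof.
move=> au ub [mf [L fL]] [mg [K gK]] fg; split.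
  have -> : [set` `[a, b]] = [set` `[a, u]] `|` [set` `]u, b]].
    by rewrite -itv_bndbnd_setU// bnd_simp.
  apply/measurable_funU => //; split => //.
  apply: (@eq_measurable_fun _ _ _ _ _ g).
    by move=> r; rewrite inE/= in_itv/= => /fg.
  exact/measurable_fun_itv_obnd_cbndP.
exists (Num.max L K) => r /andP[ar rb]; rewrite le_max.
have [ru|ur] := leP r u; first by rewrite fL// ar.
by rewrite fg ?ur// gK ?(ltW ur)// orbT.
Qed.

(** Controls are concatenated by the test r <= u, which gives the instant u to
    the left piece; this is why the densities are compared on ]u, b]. *)
Lemma primitive_cat a u b F f g : a <= u -> u <= b ->
  primitive a u F f -> primitive u b F g ->
    (forall r, u < r <= b -> f r = g r) ->
  primitive a b F f.
Proof.
move=> au ub [tf Ff] [tg Fg] fg; have tfab := tame_cat au ub tf tg fg.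
have Ff2 s t : u <= s -> s <= t -> t <= b -> F t - F s =
  \int[mu]_(r in `[s, t]) f r.
  move=> us st tb; rewrite Fg//.
  rewrite -!Rintegral_itv_obnd_cbnd; last 2 first.
  - apply: integrableS (tame_integrable tfab (le_trans au us) tb) => // r /=.
    by rewrite !in_itv/= => /andP[/ltW -> ->].
  - apply: integrableS (tame_integrable tg us tb) => // r /=.
    by rewrite !in_itv/= => /andP[/ltW -> ->].
  apply: eq_Rintegral => r; rewrite inE/= in_itv/= => /andP[sr rt].
  by rewrite fg// (le_lt_trans us sr) (le_trans rt).
split=> // s t as_ st tb.
have [us|/ltW su] := leP u s; first exact: Ff2.
have [tu|/ltW ut] := leP t u; first exact: Ff.
rewrite (@rint_split _ a b f s u t)// -Ff// -Ff2//; ring.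
Qed.

(** An open set of the product is a countable union of boxes with rational
    centres and widths, and the preimage of a box is an intersection of three
    measurable sets. *)
Lemma continuous3_measurable (h : R * R * R -> \bar R) (D : set R) f1 f2 f3 :
  continuous h -> measurable D ->
  measurable_fun D f1 -> measurable_fun D f2 -> measurable_fun D f3 ->
  measurable_fun D (fun r => h (f1 r, f2 r, f3 r)).
Proof.
move=> ch mD m1 m2 m3 _.
apply: (measurability _ (ErealGenOInfty.measurableE R)) => //.
move=> _ [_ [x ->] <-].
pose box (q : rat * rat * rat * rat) : set (R * R * R) :=
  [set z | [/\ z.1.1 \in `](ratr q.1.1.1 - ratr q.2),
    (ratr q.1.1.1 + ratr q.2)[,
     z.1.2 \in `](ratr q.1.1.2 - ratr q.2), (ratr q.1.1.2 + ratr q.2)[ &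
     z.2 \in `](ratr q.1.2 - ratr q.2), (ratr q.1.2 + ratr q.2)[] ].
pose O := h @^-1` [set y | x%:E < y]%E.
have Oopen : open O.
  by apply: open_comp; [move=> *; exact: ch|exact: open_ereal_gt_ereal].
rewrite [X in measurable X](_ : _ = \bigcup_q (if `[< box q `<=` O >]
   then D `&` [set r | box q (f1 r, f2 r, f3 r)] else set0)).
  apply: countable_bigcupT_measurable; first exact: countableP.
  move=> q; case: ifP => // _.
  have := m1 mD _ (measurable_itv `](ratr q.1.1.1 - ratr q.2 : R),
    (ratr q.1.1.1 + ratr q.2)[).
  have := m2 mD _ (measurable_itv `](ratr q.1.1.2 - ratr q.2 : R),
    (ratr q.1.1.2 + ratr q.2)[).
  have := m3 mD _ (measurable_itv `](ratr q.1.2 - ratr q.2 : R),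
    (ratr q.1.2 + ratr q.2)[).
  move=> h3 h2 h1; have := measurableI _ _ (measurableI _ _ h1 h2) h3.
  set A := (X in measurable X) => mA; suff <- : A =
    D `&` [set r | box q (f1 r, f2 r, f3 r)].
    by [].
  rewrite {}/A in mA *; apply/seteqP; split => r /=; rewrite /box/=.
    by move=> [[[Dr r1] [_ r2]] [_ r3]].
  by move=> [Dr [r1 r2 r3]].
apply/seteqP; split => r /=.
  rewrite in_itv/= andbT => -[Dr Or].
  have : nbhs (f1 r, f2 r, f3 r) O by apply: open_nbhs_nbhs; split.
  move=> /nbhs_ballP[e /= e0 eO].
  have [p] := @rat_in_itvoo R 0 (e / 2) (divr_gt0 e0 (ltr0n _ 2)).
  rewrite in_itv/= => /andP[p0 pe].
  have appr (y : R) : exists q : rat, `|y - ratr q| < ratr p.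
    have yp : y - ratr p < y by rewrite gtrBl.
    have [q] := rat_in_itvoo yp.
    rewrite in_itv/= => /andP[q1 q2]; exists q.
    by rewrite ger0_norm; lra.
  have [q1 hq1] := appr (f1 r); have [q2 hq2] := appr (f2 r).
  have [q3 hq3] := appr (f3 r).
  exists (q1, q2, q3, p) => //=; case: asboolP => [_|[]].
    move: hq1 hq2 hq3; rewrite /box/= !in_itv/= !ltr_norml.
    by move=> /andP[? ?] /andP[? ?] /andP[? ?]; split=> //; split; apply/andP;
      lra.
  move=> [[z1 z2] z3]; rewrite /box/= !in_itv/= =>
    -[/andP[? ?] /andP[? ?] /andP[? ?]].
  apply: eO; move: hq1 hq2 hq3; rewrite !ltr_norml => /andP[? ?] /andP[? ?]
    /andP[? ?].
  by split; [split|]; rewrite /ball/= ltr_norml; apply/andP; lra.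
move=> [q _]; case: ifP => // /asboolP qO [Dr /qO ?]; split => //.
by rewrite in_itv/= andbT.
Qed.

End within.

(** * Trajectories in the half-plane *)

Section paths.
Context {R : realType}.
Variables c eta : R -> R.
Hypotheses (cc : continuous c) (ce : continuous eta).
Implicit Types (a b s t u : R) (ab w : R -> R * R).
Notation mu := (@lebesgue_measure R).

Definition tame_control s t ab : Prop :=
  tame s t (fun r => (ab r).1) /\ tame s t (fun r => (ab r).2).

(** The equation of motion as long as w stays in the half-plane, where the drift
    is given by the first of its two formulas. *)
Definition halfplane_path s t ab w : Prop :=
  [/\ primitive s t (fun r => (w r).1)
        (fun r => - ((w r).1 + eta r) * ((ab r).1 + (ab r).2 * (w r).2)),
      primitive s t (fun r => (w r).2)
        (fun r => - (ab r).2 * (w r).2 ^+ 2 - 2 * (ab r).1 * (w r).2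
                  + c r ^+ 2) &
      forall r, s <= r <= t -> 0 < (w r).2].

(** Replacing z.2 by its positive part merges the two formulas for the drift
    into one that is locally Lipschitz in z. *)
Lemma driftE z t (ab : R * R) : drift c eta z t ab =
  (- (z.1 + eta t) * (ab.1 + ab.2 * Num.max z.2 0),
   - ab.2 * Num.max z.2 0 ^+ 2 - 2 * ab.1 * Num.max z.2 0 + c t ^+ 2).
Proof.
case: ab => a b; rewrite /drift; case: ifPn => [z0|].
  by rewrite (max_idPl (ltW z0)).
rewrite -leNgt => z0 /=; rewrite (max_idPr z0); congr (_, _); ring.
Qed.

Lemma controls_tame A ab s t : 0 <= s -> controls A ab -> tame_control s t ab.
Proof.
move=> s0 [mab bab _].
have sub : [set` `[s, t]] `<=` [set` `[0, +oo[].
  by move=> r /=; rewrite !in_itv/= andbT => /andP[+ _]; exact: le_trans.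
have {}mab : measurable_fun [set` `[s, t]] ab.
  by apply: measurable_funS mab => //; exact: measurable_itv.
have [K abK] := bab t; split; split.
- by apply: measurableT_comp mab; exact: measurable_fst.
- exists K => r /andP[sr rt]; rewrite (le_trans (ler_norm1 _))// abK//.
  by rewrite rt (le_trans s0).
- by apply: measurableT_comp mab; exact: measurable_snd.
- exists K => r /andP[sr rt]; rewrite (le_trans (ler_norm2 _))// abK//.
  by rewrite rt (le_trans s0).
Qed.

Lemma tame_drift s t ab w : tame_control s t ab ->
  tame s t (fun r => (w r).1) -> tame s t (fun r => (w r).2) ->
  tame s t (fun r => (drift c eta (w r) r (ab r)).1) /\
  tame s t (fun r => (drift c eta (w r) r (ab r)).2).
Proof.
move=> [ta tb] t1 t2; have tm := tame_max0 t2; split.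
  apply: (@tame_eq _ _ _ (fun r => - ((w r).1 + eta r) *
     ((ab r).1 + (ab r).2 * Num.max (w r).2 0))); first by move=> r _;
       rewrite driftE.
  apply: tameM; last by apply: tameD => //; exact: tameM.
  by apply: tameN; apply: tameD => //; exact: tame_continuous.
apply: (@tame_eq _ _ _ (fun r => - (ab r).2 * Num.max (w r).2 0 ^+ 2 -
   2 * (ab r).1 * Num.max (w r).2 0 + c r ^+ 2)); first by move=> r _;
     rewrite driftE.
apply: tameD; last by apply: tameX; exact: tame_continuous.
apply: tameB; first by apply: tameM; [exact: tameN|exact: tameX].
by apply: tameM => //; apply: tameM => //; exact: tame_cst.
Qed.

Lemma trajectory_primitive x t ab w : 0 <= t -> tame_control 0 t ab ->
  trajectory c eta x t ab w ->
  [/\ primitive 0 t (fun r => (w r).1)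
        (fun r => (drift c eta (w r) r (ab r)).1),
      primitive 0 t (fun r => (w r).2)
        (fun r => (drift c eta (w r) r (ab r)).2) &
      w t = x].
Proof.
move=> t0 tab [cw wE].
have t1 : tame 0 t (fun r => (w r).1).
  apply: tame_within => r; apply: (cvg_comp _ _ (cw r)); exact: cvg_fst.
have t2 : tame 0 t (fun r => (w r).2).
  apply: tame_within => r; apply: (cvg_comp _ _ (cw r)); exact: cvg_snd.
have [td1 td2] := tame_drift tab t1 t2; split; first split=> //.
- move=> s u s0 su ut.
  have [-> _] := wE s (ltac:(by rewrite s0 (le_trans su))).
  have [-> _] := wE u (ltac:(by rewrite ut (le_trans s0))).
  rewrite (@rint_split _ 0 t _ s u t td1)//; ring.
- split=> // s u s0 su ut.
  have [_ ->] := wE s (ltac:(by rewrite s0 (le_trans su))).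
  have [_ ->] := wE u (ltac:(by rewrite ut (le_trans s0))).
  rewrite (@rint_split _ 0 t _ s u t td2)//; ring.
- have [] := wE t (ltac:(by rewrite t0 lexx)).
  by rewrite !rint_pt !subr0; case: (w t) x {wE} => ? ? [? ?] /= -> ->.
Qed.

Lemma halfplane_path_trajectory t ab w : 0 <= t -> halfplane_path 0 t ab w ->
  trajectory c eta (w t) t ab w.
Proof.
move=> t0 [p1 p2 w0]; split.
  have c1 := primitive_within p1; have c2 := primitive_within p2.
  have -> : w = (fun r => ((w r).1, (w r).2)).
    by apply/funext => r; rewrite -surjective_pairing.
  by move=> r; exact: (cvg_pair (c1 r) (c2 r)).
move=> s /andP[s0 st]; have [_ e1] := p1; have [_ e2] := p2; split.
- have -> : \int[mu]_(r in `[s, t]) (drift c eta (w r) r (ab r)).1 =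
    (w t).1 - (w s).1.
    rewrite e1//; apply: eq_rint => r /andP[sr rt].
    by rewrite driftE/= max_l ?ltW ?w0// (le_trans s0).
  by rewrite subKr.
- have -> : \int[mu]_(r in `[s, t]) (drift c eta (w r) r (ab r)).2 =
    (w t).2 - (w s).2.
    rewrite e2//; apply: eq_rint => r /andP[sr rt].
    by rewrite driftE/= max_l ?ltW ?w0// (le_trans s0).
  by rewrite subKr.
Qed.

(** The drift of the second coordinate depends on that coordinate only, and in a
    Lipschitz way on bounded sets, so that [primitive_eq0] applies to the
    difference of the second coordinates. Once these agree, it applies to the
    first ones. *)
Lemma trajectory_unique x t ab w w' : 0 <= t -> tame_control 0 t ab ->
  trajectory c eta x t ab w -> trajectory c eta x t ab w' ->
  forall r, 0 <= r <= t -> w r = w' r.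
Proof.
move=> t0 tab /(trajectory_primitive t0 tab)[p1 p2 wt]
  /(trajectory_primitive t0 tab)[p1' p2' wt'].
have [ta tb] := tab.
have [B B0 hB] := tame_bound tb; have [A A0 hA] := tame_bound ta.
have [Z Z0 hZ] := tame_bound (tame_max0 (primitive_tame p2)).
have [Z' Z'0 hZ'] := tame_bound (tame_max0 (primitive_tame p2')).
have e2 : forall r, 0 <= r <= t -> (w r).2 - (w' r).2 = 0.
  apply: (primitive_eq0 (L := B * (Z + Z') + 2 * A) (primitiveB p2 p2')).
    by rewrite wt wt' subrr.
  move=> r rt; rewrite !driftE/=.
  have := hB r rt; have := hA r rt; have := hZ r rt; have := hZ' r rt.
  move: (ler_dist_max0 (w r).2 (w' r).2).
  set m := Num.max _ _; set m' := Num.max (w' r).2 _ => h1 h2 h3 h4 h5.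
  have -> : - (ab r).2 * m ^+ 2 - 2 * (ab r).1 * m + c r ^+ 2 -
    (- (ab r).2 * m' ^+ 2 - 2 * (ab r).1 * m' + c r ^+ 2) =
    - ((ab r).2 * (m + m') + 2 * (ab r).1) * (m - m') by ring.
  rewrite normrM normrN ler_pM// (le_trans (ler_normD _ _))// lerD//.
    by rewrite normrM ler_pM// (le_trans (ler_normD _ _))// lerD.
  by rewrite normrM ger0_norm// ler_pM2l.
have e1 : forall r, 0 <= r <= t -> (w r).1 - (w' r).1 = 0.
  apply: (primitive_eq0 (L := A + B * Z) (primitiveB p1 p1')).
    by rewrite wt wt' subrr.
  move=> r rt; rewrite !driftE/=.
  move: (e2 r rt) => /eqP; rewrite subr_eq0 => /eqP <-.
  have := hB r rt; have := hA r rt; have := hZ r rt.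
  set m := Num.max _ _ => h1 h2 h3.
  have -> : - ((w r).1 + eta r) * ((ab r).1 + (ab r).2 * m) -
    - ((w' r).1 + eta r) * ((ab r).1 + (ab r).2 * m) =
    - ((ab r).1 + (ab r).2 * m) * ((w r).1 - (w' r).1) by ring.
  rewrite normrM normrN ler_wpM2r// (le_trans (ler_normD _ _))// lerD//.
  by rewrite normrM ler_pM.
move=> r rt; move/eqP: (e1 r rt); move/eqP: (e2 r rt); rewrite !subr_eq0.
by case: (w r) (w' r) => ? ? [? ?] /= /eqP -> /eqP ->.
Qed.

(** Forwards in time the second coordinate cannot leave the half-plane, since
    its derivative equals c^2 >= 0 wherever it is nonpositive; the other
    hypothesis of [primitive_gt0] holds with k = b w2 + 2 a. *)
Lemma trajectory_halfplane_path x t ab w : 0 <= t -> tame_control 0 t ab ->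
  trajectory c eta x t ab w -> 0 < (w 0).2 -> halfplane_path 0 t ab w.
Proof.
move=> t0 tab /(trajectory_primitive t0 tab)[p1 p2 wt] w0.
have [ta tb] := tab.
have wpos r : 0 <= r <= t -> 0 < (w r).2.
  have tk : tame 0 t (fun r => (ab r).2 * Num.max (w r).2 0 + 2 * (ab r).1).
    apply: tameD; first by apply: tameM => //;
      exact: tame_max0 (primitive_tame p2).
    by apply: tameM => //; exact: tame_cst.
  apply: (primitive_gt0 tk p2 w0) => {}r _ wr; rewrite driftE/=.
    rewrite max_r//; have := sqr_ge0 (c r); lra.
  rewrite max_l//; have := sqr_ge0 (c r); lra.
split=> //.
  apply: primitive_eq p1 => // r rt; rewrite driftE/= max_l// ltW// wpos//.
apply: primitive_eq p2 => // r rt; rewrite driftE/= max_l// ltW// wpos//.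
Qed.

Lemma halfplane_path_sub a b s t ab w : a <= s -> t <= b ->
  halfplane_path a b ab w -> halfplane_path s t ab w.
Proof.
move=> as_ tb [p1 p2 wp]; split;
  [exact: primitive_sub p1|exact: primitive_sub p2|].
by move=> r /andP[sr rt]; rewrite wp// (le_trans as_ sr) (le_trans rt).
Qed.

Lemma halfplane_path_cat a u b ab w ab' w' : a <= u -> u <= b ->
  halfplane_path a u ab w -> halfplane_path u b ab' w' -> w u = w' u ->
  halfplane_path a b (fun r => if r <= u then ab r else ab' r)
                     (fun r => if r <= u then w r else w' r).
Proof.
move=> au ub [p1 p2 wp] [p1' p2' wp'] wu.
have e r : u <= r -> (if r <= u then w r else w' r) = w' r.
  by case: ifP => // ru ur; rewrite (@le_anti _ _ r u) ?ru.
have ng r : u < r <= b -> (r <= u) = false.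
  by move=> /andP[ur _]; rewrite leNgt ur.
split.
- apply: (primitive_cat (g := fun r => - ((w' r).1 + eta r) *
     ((ab' r).1 + (ab' r).2 * (w' r).2)) au ub).
  + by apply: primitive_eq p1 => r /andP[_ ru]; rewrite ru.
  + by apply: primitive_eq p1' => // r /andP[ur _]; rewrite e.
  + by move=> r urb; rewrite ng.
- apply: (primitive_cat (g := fun r => - (ab' r).2 * (w' r).2 ^+ 2 -
     2 * (ab' r).1 * (w' r).2 + c r ^+ 2) au ub).
  + by apply: primitive_eq p2 => r /andP[_ ru]; rewrite ru.
  + by apply: primitive_eq p2' => // r /andP[ur _]; rewrite e.
  + by move=> r urb; rewrite ng.
- move=> r /andP[ar rb]; case: ifPn => [ru|]; first by rewrite wp// ar.
  by rewrite -ltNge => /ltW ur; rewrite wp'// ur.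
Qed.

End paths.

(** * Attained costs and dynamic programming *)

Section attain.
Context {R : realType}.
Variables (c eta : R -> R) (g : R -> R -> R -> \bar R) (v0 : R * R -> \bar R).
Variable A : set (R * R).
Hypotheses (cc : continuous c) (ce : continuous eta).
Hypothesis gc : continuous (fun q : R * R * R => g q.1.1 q.1.2 q.2).
Hypothesis g0 : forall t a b, (0 <= g t a b)%E.
Variable m : R.
Hypothesis v0_out : forall x, ~ halfplane x -> v0 x = +oo%E.
Hypothesis v0_lb : forall x, (m%:E <= v0 x)%E.
Implicit Types (a b s t u k : R) (ab w : R -> R * R) (x : R * R).
Notation mu := (@lebesgue_measure R).

Definition path_cost ab s t : \bar R :=
  (\int[mu]_(r in `[s, t]) g r (ab r).1 (ab r).2)%E.

Lemma path_cost_ge0 ab s t : (0 <= path_cost ab s t)%E.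
Proof. by apply: integral_ge0 => r _; exact: g0. Qed.

Lemma path_cost_measurable ab s t : tame_control s t ab ->
  measurable_fun (`[s, t] : set R) (fun r => g r (ab r).1 (ab r).2).
Proof.
move=> [[ma _] [mb _]].
exact: (continuous3_measurable gc _ (@measurable_id _ _ _) ma mb).
Qed.

Lemma path_cost_split ab s u t : tame_control s t ab -> s <= u -> u <= t ->
  path_cost ab s t = (path_cost ab s u + path_cost ab u t)%E.
Proof.
move=> tab su ut; rewrite /path_cost.
have e : [set` `[s, t]] = [set` `[s, u]] `|` [set` `]u, t]].
  by rewrite -itv_bndbnd_setU// bnd_simp.
rewrite e ge0_integral_setU//=; last 2 first.
- by rewrite -e; exact: path_cost_measurable.
- by apply/disj_setPS => y [/=]; rewrite 2!in_itv/= => /andP[_ yu] /andP[];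
    rewrite ltNge yu.
congr (_ + _)%E; rewrite integral_itv_obnd_cbnd//.
apply/emeasurable_fun_itv_obnd_cbndP.
apply: measurable_funS (path_cost_measurable tab) => //.
by move=> r /=; rewrite !in_itv/= => /andP[ur ->]; rewrite (le_trans su).
Qed.

(** Concatenation modifies the second control at its left end point, which is a
    null set. *)
Lemma eq_path_cost ab ab' s t : (forall r, s < r <= t -> ab r = ab' r) ->
  tame_control s t ab -> tame_control s t ab' ->
  path_cost ab s t = path_cost ab' s t.
Proof.
move=> e tab tab'; rewrite /path_cost.
have half_open ab0 : tame_control s t ab0 ->
    (\int[mu]_(r in `[s, t]) g r (ab0 r).1 (ab0 r).2 =
     \int[mu]_(r in `]s, t]) g r (ab0 r).1 (ab0 r).2)%E.
  move=> tab0; symmetry; apply: integral_itv_obnd_cbnd.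
  by apply/emeasurable_fun_itv_obnd_cbndP; exact: path_cost_measurable tab0.
rewrite !half_open//.
by apply: eq_integral => r; rewrite inE/= in_itv/= => /e ->.
Qed.

(** The value at (x, t) is less than k exactly when some k1 < k satisfies this
    condition, by [value_le_attains] and [attains_value]. As k is real, the
    running cost and the initial cost are then both finite. *)
Definition attains x t k : Prop := exists ab w,
  [/\ controls A ab, halfplane_path c eta 0 t ab w, w t = x &
      (path_cost ab 0%R t + v0 (w 0%R) <= k%:E)%E].

Lemma total_cost_path t ab w : 0 <= t -> tame_control 0 t ab ->
  halfplane_path c eta 0 t ab w ->
  total_cost c eta g v0 (w t) t ab = (path_cost ab 0%R t + v0 (w 0%R))%E.
Proof.
move=> t0 tab pw; rewrite /total_cost /initial_cost.
have tr := halfplane_path_trajectory t0 pw.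
case: asboolP => [ew|[]]; last by exists w.
congr (_ + v0 _)%E.
apply: (trajectory_unique cc ce t0 tab _ tr); last by rewrite lexx.
exact: (getPex ew).
Qed.

(** A finite total cost puts w 0 in the half-plane, and with it the whole
    trajectory. *)
Lemma attains_total_cost x t ab k : 0 <= t -> controls A ab ->
  (total_cost c eta g v0 x t ab <= k%:E)%E -> exists w,
  [/\ halfplane_path c eta 0 t ab w, w t = x &
      (path_cost ab 0%R t + v0 (w 0%R) <= k%:E)%E].
Proof.
move=> t0 cab hk; have tab := controls_tame t (lexx 0) cab.
move: (hk); rewrite /total_cost /initial_cost.
case: asboolP => [ew|_]; last first.
  rewrite addey ?leye_eq//.
  by rewrite gt_eqF// (lt_le_trans _ (path_cost_ge0 ab 0 t)).
have := getPex ew; set w := get _ => tw h.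
have hw0 : halfplane (w 0).
  apply: contrapT => nh; move: h; rewrite v0_out// addey ?leye_eq//.
  by rewrite gt_eqF// (lt_le_trans _ (path_cost_ge0 ab 0 t)).
exists w; split => //; first exact: trajectory_halfplane_path tw hw0.
by have [] := trajectory_primitive cc ce t0 tab tw.
Qed.

Lemma value_le_attains x t k : 0 <= t -> attains x t k ->
  (value c eta g v0 A (x, t) <= k%:E)%E.
Proof.
move=> t0 [ab [w [cab pw <- hk]]]; apply: le_trans hk.
rewrite -total_cost_path//; last exact: controls_tame cab.
by apply: ereal_inf_lbound; exists ab.
Qed.

Lemma total_cost_lb x t ab : (m%:E <= total_cost c eta g v0 x t ab)%E.
Proof.
rewrite -[m%:E]add0e leeD//; first exact: path_cost_ge0.
by rewrite /initial_cost; case: ifP => _ //; rewrite leey.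
Qed.

Lemma value_lb x t : (m%:E <= value c eta g v0 A (x, t))%E.
Proof. by apply: le_ereal_inf_tmp => _ [ab _ <-]; exact: total_cost_lb. Qed.

Lemma attains_value x t k : 0 <= t -> (value c eta g v0 A (x, t) < k%:E)%E ->
  exists2 k', k' < k & attains x t k'.
Proof.
move=> t0 /ereal_inf_lt[_ [ab cab <-] /= h].
have lb := total_cost_lb x t ab.
have fin : total_cost c eta g v0 x t ab \is a fin_num.
  by rewrite fin_numE gt_eqF ?(lt_le_trans _ lb)// ?ltNyr// lt_eqF//
    (lt_trans h)// ltry.
exists (fine (total_cost c eta g v0 x t ab)); first by rewrite -lte_fin fineK.
have hk :
  (total_cost c eta g v0 x t ab <= (fine (total_cost c eta g v0 x t ab))%:E)%E.
  by rewrite fineK.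
by have [w [? ? ?]] := attains_total_cost t0 cab hk; exists ab, w.
Qed.

Lemma controls_cat u ab ab' : 0 <= u -> controls A ab -> controls A ab' ->
  controls A (fun r => if r <= u then ab r else ab' r).
Proof.
move=> u0 [mab bab Aab] [mab' bab' Aab']; split.
- apply: measurable_fun_if => //.
  + by apply: measurable_fun_ler => //; exact: measurable_cst.
  + by apply: measurable_funS mab => // r [].
  + by apply: measurable_funS mab' => // r [].
- move=> T; have [K abK] := bab T; have [K' abK'] := bab' T.
  exists (Num.max K K') => s sT; rewrite le_max.
  by case: ifP => _; rewrite ?abK// abK'// orbT.
- by move=> s s0; case: ifP => _; [exact: Aab|exact: Aab'].
Qed.

(** Upper half of the dynamic programming principle, by concatenation. *)
Lemma attains_extend s t ab w k C : 0 <= s -> s <= t -> controls A ab ->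
  halfplane_path c eta s t ab w -> (path_cost ab s t <= C%:E)%E ->
  attains (w s) s k -> attains (w t) t (k + C).
Proof.
move=> s0 st cab pw hC [ab0 [w0 [cab0 pw0 w0s hk]]].
have cab' := controls_cat s0 cab0 cab.
exists (fun r => if r <= s then ab0 r else ab r),
  (fun r => if r <= s then w0 r else w r).
have tab' := controls_tame t (lexx 0) cab'.
split=> //.
- exact: halfplane_path_cat.
- by case: ifP => // ts; rewrite (@le_anti _ _ t s) ?ts// w0s.
rewrite s0 (@path_cost_split _ 0 s t)// EFinD addeAC leeD//.
  rewrite (@eq_path_cost _ ab0)//.
  - by move=> r /andP[_ ->].
  - exact: controls_tame cab'.
  - exact: controls_tame cab0.
rewrite (@eq_path_cost _ ab)//.
- by move=> r /andP[sr _]; rewrite leNgt sr.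
- exact: controls_tame cab'.
- exact: controls_tame cab.
Qed.

(** Lower half of the dynamic programming principle. The cost C on [s, t] is
    finite because the other terms are bounded below. *)
Lemma attains_restrict s t ab w k : 0 <= s -> s <= t -> controls A ab ->
  halfplane_path c eta 0 t ab w ->
    (path_cost ab 0%R t + v0 (w 0%R) <= k%:E)%E ->
  exists2 C, path_cost ab s t = C%:E & 0 <= C /\
   (path_cost ab 0%R s + v0 (w 0%R) <= (k - C)%:E)%E.
Proof.
move=> s0 st cab pw; rewrite (@path_cost_split _ 0 s t)//; last exact:
  controls_tame cab.
have := path_cost_ge0 ab 0 s; have := path_cost_ge0 ab s t; have := v0_lb (w 0).
case: (path_cost ab 0%R s) => [C0| |]; case: (path_cost ab s t) => [C1| |];
  case: (v0 (w 0%R)) => [V| |] //=; rewrite ?lee_fin => h1 h2 h3 h4.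
by exists C1 => //; split => //; rewrite lee_fin lerBrDr addrAC.
Qed.

End attain.

(** * A priori estimates for paths of bounded cost *)

Section bounds.
Context {R : realType}.
Variables (c eta : R -> R) (g : R -> R -> R -> \bar R) (v0 : R * R -> \bar R).
Variable A : set (R * R).
Hypotheses (cc : continuous c) (ce : continuous eta).
Hypothesis gc : continuous (fun q : R * R * R => g q.1.1 q.1.2 q.2).
Hypothesis g0 : forall t a b, (0 <= g t a b)%E.
Hypothesis g_superlinear : forall T N, 0 < T -> 0 < N ->
  exists2 r, 0 <= r & forall t a b, 0 <= t <= T -> 0 <= b ->
    ((N * (`|a| + b) - r)%:E <= g t a b)%E.
Variable m : R.
Hypothesis v0_lb : forall x, (m%:E <= v0 x)%E.
Hypothesis v0_coercive : coercive_initial_cost v0.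
Hypothesis v0_out : forall x, ~ halfplane x -> v0 x = +oo%E.
Hypothesis A_sub : A `<=` control_values.
Implicit Types (a b s t u k : R) (ab w : R -> R * R) (x : R * R).
Notation mu := (@lebesgue_measure R).
Local Notation path_cost := (path_cost g).

Lemma EFin_rint (f : R -> R) s t : tame s t f ->
  (\int[mu]_(r in `[s, t]) f r)%:E = (\int[mu]_(r in `[s, t]) (f r)%:E)%E.
Proof.
move=> tf; rewrite /Rintegral fineK//.
exact: integrable_fin_num (tame_integrable tf (lexx _) (lexx _)).
Qed.

Lemma le_path_cost ab s t f : tame_control s t ab -> tame s t f ->
  (forall r, s <= r <= t -> ((f r)%:E <= g r (ab r).1 (ab r).2)%E) ->
  ((\int[mu]_(r in `[s, t]) f r)%:E <= path_cost ab s t)%E.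
Proof.
move=> tab tf fg.
have := leey (path_cost ab s t); rewrite le_eqVlt => /predU1P[->|fin];
  first exact: leey.
rewrite EFin_rint//; apply: le_integral => //.
- exact: tame_integrable tf (lexx _) (lexx _).
- apply/integrableP; split; first exact: path_cost_measurable.
  by under eq_integral do rewrite gee0_abs//.
- by move=> r; rewrite inE/= in_itv/= => /fg.
Qed.

Lemma path_cost_le ab s t f : tame_control s t ab -> tame s t f ->
  (forall r, s <= r <= t -> (g r (ab r).1 (ab r).2 <= (f r)%:E)%E) ->
  (path_cost ab s t <= (\int[mu]_(r in `[s, t]) f r)%:E)%E.
Proof.
move=> tab tf fg; rewrite EFin_rint//; apply: ge0_le_integral => //.
- exact: path_cost_measurable.
- by apply/measurable_EFinP; case: tf.
Qed.

Lemma tame_control_size s t ab : tame_control s t ab ->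
  tame s t (fun r => `|(ab r).1| + (ab r).2).
Proof. by move=> [ta tb]; apply: tameD => //; exact: tame_norm. Qed.

(** Integrate the lower bound N (|a| + b) - r of the running cost. As N is
    arbitrary, controls of bounded cost are equi-integrable, which
    [path_modulus] exploits. *)
Lemma control_L1_bound T N : 0 < T -> 0 < N -> exists2 r, 0 <= r &
  forall s t ab K, 0 <= s -> s <= t -> t <= T -> controls A ab ->
  (path_cost ab s t <= K%:E)%E ->
  N * \int[mu]_(r in `[s, t]) (`|(ab r).1| + (ab r).2) <= r * (t - s) + K.
Proof.
move=> T0 N0; have [r r0 hr] := g_superlinear T0 N0; exists r => //.
move=> s t ab K s0 st tT cab hK; have tab := controls_tame t s0 cab.
have tf := tame_control_size tab.
have h := @le_path_cost ab s t (fun u => N * (`|(ab u).1| + (ab u).2) + (- r))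
  tab.
have := le_trans (h _ _) hK; rewrite lee_fin => {}h.
have {h} : \int[mu]_(u in `[s, t]) (N * (`|(ab u).1| + (ab u).2) + (- r)) <= K.
  apply: h; first by apply: tameD; [apply: tameM|] => //; exact: tame_cst.
  move=> u /andP[su ut]; apply: hr; first by rewrite (le_trans s0 su)
    (le_trans ut tT).
  by have [_ _ /(_ u (le_trans s0 su))/A_sub] := cab.
rewrite (@rintD _ s t)//; last 2 first.
- by apply: tameM => //; exact: tame_cst.
- exact: tame_cst.
rewrite (@rintZ _ s t)// rint_cst//; lra.
Qed.

Lemma path_cost_sub ab a s s' b : tame_control a b ab -> a <= s -> s <= s' ->
  s' <= b -> (path_cost ab s s' <= path_cost ab a b)%E.
Proof.
move=> tab as_ ss' s'b.
have tab' : tame_control a s' ab.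
  by case: tab => ? ?; split; exact: tame_sub (lexx _) s'b _.
rewrite (@path_cost_split _ _ gc g0 ab a s' b)//; last exact: le_trans ss'.
rewrite (@path_cost_split _ _ gc g0 ab a s s')//.
by rewrite -[leLHS]adde0 leeD ?path_cost_ge0// -[leLHS]add0e leeD
  ?path_cost_ge0.
Qed.

Lemma path_cost_le_excess t ab w k :
  (path_cost ab 0%R t + v0 (w 0%R) <= k%:E)%E ->
    (path_cost ab 0%R t <= (k - m)%:E)%E.
Proof.
move=> hk; move: hk (v0_lb (w 0%R)) (path_cost_ge0 g0 ab 0 t).
case: (path_cost ab 0%R t) => [?| |]; case: (v0 (w 0%R)) => [?| |] //=.
by rewrite !lee_fin; lra.
Qed.

(** Coercivity of the initial cost confines w 0. The integral bound on the
    control then confines the path through integrating factors: with A = int_0^s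
    a, the derivative of w2 exp(2 A) is at most c^2 exp(2 A) since b w2^2 >= 0,
    and w1 solves a linear equation with coefficient a + b w2. *)
Lemma path_bounds T k : 0 < T -> exists C d, [/\ 0 < C, 0 < d &
  forall t ab w, 0 <= t -> t <= T -> controls A ab ->
  halfplane_path c eta 0 t ab w ->
  (path_cost ab 0%R t + v0 (w 0%R) <= k%:E)%E ->
  [/\ forall s, 0 <= s <= t -> `|w s| <= C,
      \int[mu]_(r in `[0, t]) (`|(ab r).1| + (ab r).2) <= C &
      d <= (w 0).2]].
Proof.
move=> T0; have [r r0 hr] := control_L1_bound T0 ltr01.
have [hco1 hco2] := v0_coercive.
have [R0 hR0] := hco1 (k + 1); have [d d0 hd] := hco2 (k + 1).
have [Cc Cc0 hCc] := tame_bound (@tame_continuous _ 0 T _ cc).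
have [Ce Ce0 hCe] := tame_bound (@tame_continuous _ 0 T _ ce).
(* C1 bounds the integral of |a| + b, then C2 the second coordinate, C4 the
   integral of a + b w2, and C3 the first coordinate. *)
pose C1 := r * T + `|k - m|.
have C10 : 0 <= C1 by rewrite addr_ge0// mulr_ge0// ltW.
pose K2 := Cc ^+ 2 * expR (2 * C1).
have K20 : 0 <= K2 by rewrite mulr_ge0 ?sqr_ge0// expR_ge0.
pose C2 := (`|R0| + K2 * T) * expR (2 * C1).
have C20 : 0 <= C2.
  by rewrite mulr_ge0 ?expR_ge0// addr_ge0// mulr_ge0// ltW.
pose C4 := (1 + C2) * C1.
have C40 : 0 <= C4 by rewrite mulr_ge0// addr_ge0.
pose K3 := Ce * expR C4 * (1 + C2).
have K30 : 0 <= K3 by rewrite !mulr_ge0 ?expR_ge0 ?addr_ge0// ltW.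
pose C3 := (`|R0| + K3 * C1) * expR C4.
have C30 : 0 <= C3.
  by rewrite mulr_ge0 ?expR_ge0// addr_ge0// mulr_ge0.
exists (C1 + C2 + C3 + 1), d; split=> //; first by lra.
move=> t ab w t0 tT cab [p1 p2 wp] hk.
have tab := controls_tame t (lexx 0) cab; have [ta tb] := tab.
have tsz := tame_control_size tab.
have beta0 s : 0 <= s <= t -> 0 <= (ab s).2.
  by move=> /andP[s0 _]; have [_ _ /(_ s s0)/A_sub] := cab.
have hv : (v0 (w 0%R) <= k%:E)%E.
  by rewrite (le_trans _ hk)// -[leLHS]add0e leeD// path_cost_ge0.
have hC := path_cost_le_excess hk.
have w0R : `|w 0| <= R0.
  rewrite leNgt; apply/negP => /hR0 /le_trans/(_ hv); rewrite lee_fin; lra.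
have R00 : `|R0| = R0 by rewrite ger0_norm// (le_trans _ w0R).
have w0d : d <= (w 0).2.
  rewrite leNgt; apply/negP => w0d.
  have w00 : 0 < (w 0).2 by rewrite wp// lexx t0.
  have := hd (w 0).1 (w 0).2; rewrite w00 w0d -surjective_pairing => /(_ isT).
  by move=> /le_trans/(_ hv); rewrite lee_fin; lra.
have hI s : 0 <= s <= t -> \int[mu]_(r in `[0, s]) (`|(ab r).1| + (ab r).2) <=
  C1.
  move=> /andP[s0 st].
  have := hr 0 s ab (k - m) (lexx 0) s0 (le_trans st tT) cab.
  rewrite mul1r subr0 => h; apply: le_trans (h _) _.
    rewrite (le_trans _ hC)// (@path_cost_split _ _ gc g0 ab 0 s t)//
      -[leLHS]adde0.
    by rewrite leeD// path_cost_ge0.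
  by rewrite /C1 lerD ?ler_norm// ler_wpM2l// (le_trans st).
have pA := primitive_rint ta; set a := (fun s => \int[_]_(_ in _) _) in pA.
have aC1 s : 0 <= s <= t -> `|a s| <= C1.
  move=> st; apply: le_trans (hI s st); move/andP: st => [s0 st].
  apply: (@ler_norm_rint _ 0 t) => // u /andP[u0 us].
  by rewrite lerDl beta0// u0 (le_trans us).
have hw2 s : 0 <= s <= t -> (w s).2 <= C2.
  move=> sst; have /andP[s0 st] := sst.
  have pF := primitive_expM p2 (primitiveZ 2 pA).
  have := le_primitive pF (primitiveZ K2 (primitive_id 0 t)) (lexx 0) s0 st _.
  rewrite /a rint_pt !mulr0 expR0 !mulr1 subr0 -/a => h.
  have {}h : (w s).2 * expR (2 * a s) - (w 0).2 <= K2 * s.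
    apply: h => u /andP[u0 us]; have ut := le_trans us st.
    have h1 : - (ab u).2 * (w u).2 ^+ 2 - 2 * (ab u).1 * (w u).2 + c u ^+ 2 +
        2 * (ab u).1 * (w u).2 <= Cc ^+ 2.
      have := hCc u (ltac:(by rewrite u0 (le_trans ut))).
      rewrite -ler_sqr ?nnegrE ?(ltW Cc0)// real_normK ?num_real// => hc.
      have : 0 <= (ab u).2 * (w u).2 ^+ 2.
        by rewrite mulr_ge0 ?sqr_ge0// beta0// u0 ut.
      by move: hc; lra_from_goal.
    apply: le_trans (_ : Cc ^+ 2 * expR (2 * a u) <= _).
      by rewrite ler_wpM2r ?expR_ge0.
    rewrite ler_wpM2l ?sqr_ge0// ler_expR ler_pM2l// (le_trans (ler_norm _))//.
    by rewrite aC1// u0.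
  have e : (w s).2 = (w s).2 * expR (2 * a s) * expR (- (2 * a s)).
    by rewrite -mulrA expRxMexpNx_1 mulr1.
  rewrite e; apply: ler_pM; rewrite ?expR_ge0//.
  - by rewrite mulr_ge0 ?expR_ge0// ltW// wp.
  - have : (w 0).2 <= `|R0|.
      by rewrite R00 (le_trans _ w0R)// (le_trans (ler_norm _))// ler_norm2.
    have : K2 * s <= K2 * T by rewrite ler_wpM2l// (le_trans st).
    by move: h; lra_from_goal.
  - by rewrite ler_expR -mulrN ler_pM2l// (le_trans (ler_norm _))// normrN aC1.
pose gg u := (ab u).1 + (ab u).2 * (w u).2.
have tg : tame 0 t gg.
  by apply: tameD => //; apply: tameM => //; exact: primitive_tame p2.
have gle u : 0 <= u <= t -> `|gg u| <= (1 + C2) * (`|(ab u).1| + (ab u).2).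
  move=> ut; rewrite (le_trans (ler_normD _ _))// normrM
    (ger0_norm (beta0 u ut)).
  rewrite (gtr0_norm (wp u ut)).
  have h1 : (ab u).2 * (w u).2 <= (ab u).2 * C2.
    by rewrite ler_wpM2l ?hw2// beta0.
  have h2 : 0 <= C2 * `|(ab u).1| by rewrite mulr_ge0.
  by move: h1 h2 (beta0 u ut); lra_from_goal.
have pG := primitive_rint tg; set G := (fun s => \int[_]_(_ in _) _) in pG.
have GC4 s : 0 <= s <= t -> `|G s| <= C4.
  move=> sst; have /andP[s0 st] := sst.
  apply:
    le_trans (_ : (1 + C2) * \int[mu]_(r in `[0, s]) (`|(ab r).1| + (ab r).2) <=
    _).
    rewrite -(rintZ _ tsz)//; apply: (@ler_norm_rint _ 0 t) => //.
      by apply: tameM => //; exact: tame_cst.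
    by move=> u /andP[u0 us]; rewrite gle// u0 (le_trans us).
  by rewrite ler_wpM2l ?addr_ge0// hI.
have hw1 s : 0 <= s <= t -> `|(w s).1| <= C3.
  move=> sst; have /andP[s0 st] := sst.
  have pF := primitive_expM p1 pG; have [tF FE] := pF.
  have h : `|(w s).1 * expR (G s) - (w 0).1| <= K3 * C1.
    have := FE 0 s (lexx 0) s0 st; rewrite {2}/G rint_pt expR0 mulr1 => ->.
    apply: le_trans (_ : K3 * \int[mu]_(r in `[0, s]) (`|(ab r).1| + (ab r).2)
      <= _).
      rewrite -(rintZ _ tsz)//; apply: (@ler_norm_rint _ 0 t) => //.
        by apply: tameM => //; exact: tame_cst.
      move=> u /andP[u0 us]; have ut : 0 <= u <= t by rewrite u0 (le_trans us).
      rewrite -/(gg u).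
      have -> : - ((w u).1 + eta u) * gg u + gg u * (w u).1 = - (eta u * gg u).
        by ring.
      rewrite normrM normrN normrM (gtr0_norm (expR_gt0 _)).
      have -> : K3 * (`|(ab u).1| + (ab u).2) =
        Ce * ((1 + C2) * (`|(ab u).1| + (ab u).2)) * expR C4 by rewrite /K3;
          ring.
      rewrite ler_pM ?expR_ge0 ?mulr_ge0//.
        rewrite ler_pM// ?gle// hCe// u0 (le_trans us)// (le_trans st)//.
      by rewrite ler_expR (le_trans (ler_norm _))// GC4.
    by rewrite ler_wpM2l// hI.
  have -> : (w s).1 = (w s).1 * expR (G s) * expR (- G s).
    by rewrite -mulrA expRxMexpNx_1 mulr1.
  rewrite normrM (gtr0_norm (expR_gt0 (- _))) ler_pM ?expR_ge0//.
    have -> : (w s).1 * expR (G s) = (w 0).1 + ((w s).1 * expR (G s) - (w 0).1).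
      by ring.
    rewrite (le_trans (ler_normD _ _))// lerD// R00.
    by rewrite (le_trans _ w0R)// ler_norm1.
  by rewrite ler_expR (le_trans (ler_norm _))// normrN GC4.
split=> //.
- move=> s sst; rewrite norm_pair_le; apply/andP; split.
    by move: (hw1 s sst) C10 C20; lra_from_goal.
  by rewrite gtr0_norm ?wp//; move: (hw2 s sst) C10 C30; lra_from_goal.
- have := hI t; rewrite t0 lexx => /(_ isT); move: C20 C30; lra_from_goal.
Qed.

(** On a short interval the increment of w is at most D times the integral of
    |a| + b, up to a multiple of the length. With N of the order of D / e,
    [control_L1_bound] makes the first term small however singular the control
    is. *)
Lemma path_modulus T k e : 0 < T -> 0 < e -> exists2 h, 0 < h &
  forall t ab w s s', 0 <= t -> t <= T -> controls A ab ->
  halfplane_path c eta 0 t ab w ->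
    (path_cost ab 0%R t + v0 (w 0%R) <= k%:E)%E ->
  0 <= s -> s <= s' -> s' <= t -> s' - s <= h -> `|w s' - w s| <= e.
Proof.
move=> T0 e0; have [C [d [C0 d0 hb]]] := path_bounds k T0.
have [Cc Cc0 hCc] := tame_bound (@tame_continuous _ 0 T _ cc).
have [Ce Ce0 hCe] := tame_bound (@tame_continuous _ 0 T _ ce).
pose D := (C ^+ 2 + 2 * C) + (C + Ce) * (1 + C) + 1.
have D1 : 0 <= C ^+ 2 + 2 * C by have := sqr_ge0 C; lra.
have D2 : 0 <= (C + Ce) * (1 + C) by rewrite mulr_ge0// ?addr_ge0// ltW.
have D0 : 0 < D by rewrite /D; lra.
pose K := `|k - m| + 1.
have K0 : 0 < K by rewrite ltr_wpDl.
pose N := 4 * D * K / e.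
have N0 : 0 < N by rewrite divr_gt0// !mulr_gt0.
have [r r0 hr] := control_L1_bound T0 N0.
exists (Num.min ((r + 1)^-1) (e / (2 * (Cc ^+ 2 + 1)))).
  by rewrite lt_min invr_gt0 ltr_wpDl//= divr_gt0// mulr_gt0// ltr_wpDl//
    sqr_ge0.
move=> t ab w s s' t0 tT cab pw hk s0 ss' s't.
rewrite le_min => /andP[h1 h2].
have [hw _ _] := hb t ab w t0 tT cab pw hk; have [p1 p2 wp] := pw.
have tab := controls_tame t (lexx 0) cab; have [ta tb] := tab.
have tsz := tame_control_size tab.
have beta0 u : 0 <= u <= t -> 0 <= (ab u).2.
  by move=> /andP[u0 _]; have [_ _ /(_ u u0)/A_sub] := cab.
set I := \int[mu]_(r in `[s, s']) (`|(ab r).1| + (ab r).2).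
have hI : D * I <= e / 2.
  have := hr s s' ab (k - m) s0 ss' (le_trans s't tT) cab.
  rewrite -/I => h.
  have {}h : N * I <= r * (s' - s) + (k - m).
    apply: h; apply: le_trans (path_cost_le_excess hk).
    by apply: path_cost_sub.
  have h3 : r * (s' - s) <= 1.
    have : (s' - s) * (r + 1) <= 1.
      by rewrite -ler_pdivlMr ?div1r// ltr_wpDl.
    have : 0 <= s' - s by rewrite subr_ge0.
    by lra_from_goal.
  have h4 : N * I <= K.
    by move: (ler_norm (k - m)) h h3; rewrite /K; lra_from_goal.
  have -> : D * I = e / (4 * K) * (N * I).
    by rewrite /N; field; apply/andP; split; apply: lt0r_neq0.
  apply: le_trans (_ : e / (4 * K) * K <= _).
    by rewrite ler_wpM2l// divr_ge0// ?mulr_ge0// ltW.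
  have -> : e / (4 * K) * K = e / 4 by field; exact: lt0r_neq0.
  by move: e0; lra_from_goal.
have szge0 u : s <= u <= s' -> 0 <= `|(ab u).1| + (ab u).2.
  move=> /andP[su us']; rewrite addr_ge0// beta0// (le_trans s0 su).
  by rewrite (le_trans us').
have hbd u : s <= u <= s' -> [/\ `|(w u).1| <= C, 0 <= (w u).2, (w u).2 <= C,
    0 <= (ab u).2 & `|c u| <= Cc /\ `|eta u| <= Ce].
  move=> /andP[su us']; have u0 := le_trans s0 su; have ut := le_trans us' s't.
  have ut' : 0 <= u <= t by rewrite u0.
  have := hw u ut'; rewrite norm_pair_le => /andP[k1 k2].
  have uT : 0 <= u <= T by rewrite u0 (le_trans ut).
  split=> //; [exact/ltW/wp| |exact: beta0|by split; [exact: hCc|exact: hCe]].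
  by rewrite (le_trans _ k2)// ler_norm.
rewrite norm_pair_le; apply/andP; split.
  have -> : (w s' - w s).1 = (w s').1 - (w s).1 by [].
  have [_ ->//] := p1.
  apply: le_trans (_ : D * I <= _); last by move: hI e0; lra_from_goal.
  rewrite -(rintZ _ tsz)//; apply: (@ler_norm_rint _ 0 t) => //.
  - by case: p1.
  - by apply: tameM => //; exact: tame_cst.
  move=> u us; have [k1 k2 k3 k4 [k5 k6]] := hbd u us; have k7 := szge0 u us.
  rewrite normrM normrN.
  apply: le_trans (_ : (C + Ce) * ((1 + C) * (`|(ab u).1| + (ab u).2)) <= _).
    rewrite ler_pM//; first by rewrite (le_trans (ler_normD _ _))// lerD.
    rewrite (le_trans (ler_normD _ _))// normrM (ger0_norm k4) (ger0_norm k2).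
    have : (ab u).2 * (w u).2 <= (ab u).2 * C by rewrite ler_wpM2l.
    have : 0 <= C * `|(ab u).1| by rewrite mulr_ge0// ltW.
    by move: k4; lra_from_goal.
  by rewrite mulrA ler_wpM2r// /D; move: D1; lra_from_goal.
have -> : (w s' - w s).2 = (w s').2 - (w s).2 by [].
have [_ ->//] := p2.
apply: le_trans (_ : D * I + Cc ^+ 2 * (s' - s) <= _); last first.
  have : (s' - s) * (2 * (Cc ^+ 2 + 1)) <= e.
    by rewrite -ler_pdivlMr// mulr_gt0// ltr_wpDl// sqr_ge0.
  have : 0 <= s' - s by rewrite subr_ge0.
  by move: hI; lra_from_goal.
rewrite -(rintZ _ tsz)// -rint_cst// -(@rintD _ 0 t)//; last 2 first.
- by apply: tameM => //; exact: tame_cst.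
- exact: tame_cst.
apply: (@ler_norm_rint _ 0 t) => //.
- by case: p2.
- by apply: tameD; [apply: tameM => //|]; exact: tame_cst.
move=> u us; have [k1 k2 k3 k4 [k5 k6]] := hbd u us; have k7 := szge0 u us.
rewrite (le_trans (ler_normD _ _))// lerD//; last first.
  by rewrite normrX lerXn2r// ?nnegrE// ltW.
rewrite (le_trans (ler_normB _ _))//.
have -> : `|- (ab u).2 * (w u).2 ^+ 2| = (ab u).2 * (w u).2 ^+ 2.
  by rewrite normrM normrN (ger0_norm k4) ger0_norm ?sqr_ge0.
have -> : `|2 * (ab u).1 * (w u).2| = 2 * `|(ab u).1| * (w u).2.
  by rewrite !normrM (ger0_norm k2) (@ger0_norm _ 2).
have j1 : (ab u).2 * (w u).2 ^+ 2 <= (ab u).2 * C ^+ 2.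
  by rewrite ler_wpM2l// lerXn2r// nnegrE// ltW.
have j2 : 2 * `|(ab u).1| * (w u).2 <= 2 * `|(ab u).1| * C.
  by rewrite ler_wpM2l// mulr_ge0.
have j3 : (C ^+ 2 + 2 * C) * (`|(ab u).1| + (ab u).2) <=
  D * (`|(ab u).1| + (ab u).2).
  by rewrite ler_wpM2r// /D; move: D2; lra_from_goal.
have j4 : 0 <= C ^+ 2 * `|(ab u).1| by rewrite mulr_ge0// sqr_ge0.
have j5 : 0 <= C * (ab u).2 by rewrite mulr_ge0// ltW.
by move: j1 j2 j3 j4 j5; lra_from_goal.
Qed.

End bounds.

(** * Moving the end point of a path *)

Section perturbation.
Context {R : realType}.
Variables (c eta : R -> R) (g : R -> R -> R -> \bar R) (v0 : R * R -> \bar R).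
Variable A : set (R * R).
Hypotheses (cc : continuous c) (ce : continuous eta).
Hypothesis gc : continuous (fun q : R * R * R => g q.1.1 q.1.2 q.2).
Hypothesis g0 : forall t a b, (0 <= g t a b)%E.
Hypothesis g_superlinear : forall T N, 0 < T -> 0 < N ->
  exists2 r, 0 <= r & forall t a b, 0 <= t <= T -> 0 <= b ->
    ((N * (`|a| + b) - r)%:E <= g t a b)%E.
Variable m : R.
Hypothesis v0_lb : forall x, (m%:E <= v0 x)%E.
Hypothesis v0_coercive : coercive_initial_cost v0.
Hypothesis v0_out : forall x, ~ halfplane x -> v0 x = +oo%E.
Hypothesis A_sub : A `<=` control_values.
Implicit Types (a b s t u k : R) (ab w : R -> R * R) (x : R * R).
Notation mu := (@lebesgue_measure R).
Local Notation path_cost := (path_cost g).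
Hypothesis v0_fin : forall x, halfplane x -> v0 x \is a fin_num.
Hypothesis v0_lip : locally_lipschitz halfplane (fine \o v0).
Local Notation attains := (attains c eta g v0 A).

Lemma attains_le x t k k' : k <= k' -> attains x t k -> attains x t k'.
Proof.
move=> kk' [ab [w [? ? ? h]]]; exists ab, w; split => //.
by rewrite (le_trans h)// lee_fin.
Qed.

(** The Lipschitz bounds near the points of the compact set |z| <= C, z.2 >= d
    yield a modulus of continuity valid on all of it. *)
Lemma initial_cost_uniform C d e : 0 < d -> 0 < e -> exists2 rho, 0 < rho &
  forall z z', `|z| <= C -> d <= z.2 -> `|z' - z| <= rho ->
  (v0 z' <= v0 z + e%:E)%E.
Proof.
move=> d0 e0.
pose K : set (R * R) := `[- C, C] `*` `[d, C].
have cK : compact K by apply: compact_setX; exact: segment_compact.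
pose P (rho : R) (z : R * R) := forall z', `|z' - z| <= rho ->
  (v0 z' <= v0 z + e%:E)%E.
have : \forall rho \near 0^'+, K `<=` P rho.
  apply: (compact_near_coveringP K).1 => // z0 [/= _]; rewrite in_itv/= =>
    /andP[dz0 _].
  have [] := v0_lip (lt_le_trans d0 dz0) => N /nbhs_ballP[r /= r0 rN].
  move=> [L [_ /(_ (Num.max 1 (L + 1)))]].
  rewrite lt_max ltrDl ltr01 orbT => /(_ isT); set L' := Num.max _ _ => hL.
  have L'0 : 0 < L' by rewrite lt_max ltr01.
  pose r' := Num.min r d.
  have r'0 : 0 < r' by rewrite lt_min r0.
  exists (ball z0 (r' / 2), [set rho | rho < r' / 2 /\ rho < e / L']).
    split => /=; first by apply: nbhsx_ballx; rewrite divr_gt0.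
    near=> rho; split; near: rho; apply: nbhs_right_lt; rewrite divr_gt0//.
  move=> [z rho] /= [] zz0 [rhor rhoe] z' z'z.
  rewrite -ball_normE/= in zz0.
  have N1 (u : R * R) : `|z0 - u| < r' -> N u /\ halfplane u.
    move=> h; split.
      by apply: rN; rewrite -ball_normE/=; apply: lt_le_trans h _;
        rewrite ge_min lexx.
    have : `|(z0 - u).2| < d.
      by rewrite (le_lt_trans (ler_norm2 _))// (lt_le_trans h)// ge_min lexx
        orbT.
    by rewrite /halfplane/= ltr_norml; have := dz0; lra.
  have [Nz hz] : N z /\ halfplane z by apply: N1; lra.
  have [Nz' hz'] : N z' /\ halfplane z'.
    apply: N1; have -> : z0 - z' = (z0 - z) - (z' - z) by rewrite opprB addrA
      subrK.
    rewrite (le_lt_trans (ler_normB _ _))//; lra.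
  have := hL (z', z) (conj (conj Nz' hz') (conj Nz hz)); rewrite /= => h.
  rewrite -(fineK (v0_fin hz)) -(fineK (v0_fin hz')) -EFinD lee_fin.
  have h2 : L' * `|z' - z| <= e.
    by rewrite mulrC -ler_pdivlMr//; lra.
  have := le_trans h h2; rewrite ler_norml; lra.
rewrite near_withinE => /nbhs_ballP[r /= r0 hr].
exists (r / 2); first by rewrite divr_gt0.
move=> z z' zC dz; apply: (hr (r / 2)).
- by rewrite -ball_normE/= sub0r normrN gtr0_norm; lra.
- by rewrite divr_gt0.
move: zC; rewrite norm_pair_le => /andP[h1 h2]; split => /=.
  by rewrite in_itv/= -ler_norml.
by rewrite in_itv/= dz/= (le_trans (ler_norm _)).
Unshelve. all: by end_near. Qed.

(** The perturbed path has the same control. Its second coordinate is w2 + Dl,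
    where Dl solves the Bernoulli equation Dl_s = - 2 (a + b w2) Dl - b Dl^2
    with end value dl = y.2 - w2(t). Explicitly Dl = dl E / D with E(s) = exp(2
    int_s^t (a + b w2)) and D(s) = 1 - dl int_s^t b E. For small dl the
    denominator stays above 1/2 and Dl is of the order of dl. The difference of
    the first coordinates solves a linear equation and is of the same order. So
    the initial points are close, and the initial cost hardly changes. *)
Lemma path_perturb T k e : 0 < T -> 0 < e -> exists2 rho, 0 < rho &
  forall t ab w y k', 0 <= t -> t <= T -> controls A ab ->
  halfplane_path c eta 0 t ab w ->
    (path_cost ab 0%R t + v0 (w 0%R) <= k'%:E)%E ->
  k' <= k -> `|y - w t| <= rho -> attains y t (k' + e).
Proof.
move=> T0 e0.
have [C [d [C0 d0 hb]]] :=
  path_bounds cc ce gc g0 g_superlinear v0_lb v0_coercive A_sub k T0.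
have [rho1 rho10 hv] := initial_cost_uniform C d0 e0.
have [Ce Ce0 hCe] := tame_bound (@tame_continuous _ 0 T _ ce).
(* C4 and C6 bound the exponents in the formulas for the second and for the
   first coordinate; an end point moved by rho moves the initial point by at
   most rho X. *)
pose C4 := (1 + C) * C.
have C40 : 0 <= C4 by rewrite mulr_ge0// ?addr_ge0// ltW.
pose E2 := expR (2 * C4); have E20 : 0 < E2 by exact: expR_gt0.
pose C6 := (2 + C) * C.
pose E6 := expR C6; have E60 : 0 < E6 by exact: expR_gt0.
pose X := 2 * E2 * C + 2 * E2 + (E6 + E6 * (C + Ce) * C * (2 * E2)).
have X1 : 0 < 2 * E2 * C by rewrite !mulr_gt0.
have X2 : 0 < E6 * (C + Ce) * C * (2 * E2) by rewrite !mulr_gt0// addr_gt0.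
have X0 : 0 < X by rewrite /X; lra.
(* A displacement nu keeps D above 1/2, the second coordinate at time 0
   positive, and the initial cost within e. *)
pose nu := Num.min (Num.min (2^-1) (d / 2)) rho1.
have nu0 : 0 < nu.
  by rewrite !lt_min; apply/andP; split; [apply/andP; split|] => //; lra.
exists (nu / X); first by rewrite divr_gt0.
move=> t ab w y k' t0 tT cab pw hk k'k; rewrite norm_pair_le => /andP[y1 y2].
have hk2 : (path_cost ab 0%R t + v0 (w 0%R) <= k%:E)%E.
  by rewrite (le_trans hk)// lee_fin.
have [hw hI w0d] := hb t ab w t0 tT cab pw hk2; have [p1 p2 wp] := pw.
set rho := nu / X in y1 y2.
have rho0 : 0 < rho by rewrite divr_gt0.
have rhoX : rho * X = nu by rewrite /rho divfK// lt0r_neq0.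
have [nu1 nu2 nu3] : [/\ nu <= 2^-1, nu <= d / 2 & nu <= rho1].
  by split; rewrite /nu !ge_min lexx ?orbT.
have r1 : 0 <= rho * (2 * E2 * C) by rewrite mulr_ge0// ltW.
have r2 : 0 <= rho * (2 * E2).
  by apply: mulr_ge0; [exact: ltW|apply: mulr_ge0 => //; exact: ltW].
have r3 : 0 <= rho * (E6 + E6 * (C + Ce) * C * (2 * E2)).
  by apply: mulr_ge0; [exact: ltW|apply: addr_ge0; exact: ltW].
have rsum : rho * (2 * E2 * C) + rho * (2 * E2) +
   rho * (E6 + E6 * (C + Ce) * C * (2 * E2)) = nu by rewrite -rhoX /X; ring.
have [hr1 hr2 hr3] : [/\ rho * (2 * E2 * C) <= nu, rho * (2 * E2) <= nu &
    rho * (E6 + E6 * (C + Ce) * C * (2 * E2)) <= nu].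
  by split; move: r1 r2 r3 rsum; lra_from_goal.
have tab := controls_tame t (lexx 0) cab; have [ta tb] := tab.
have tsz := tame_control_size tab.
have beta0 s : 0 <= s <= t -> 0 <= (ab s).2.
  by move=> /andP[s0 _]; have [_ _ /(_ s s0)/A_sub] := cab.
have sz0 s : 0 <= s <= t -> 0 <= `|(ab s).1| + (ab s).2.
  by move=> st; rewrite addr_ge0// beta0.
have sub_size (f : R -> R) D : 0 <= D -> tame 0 t f ->
    (forall s, 0 <= s <= t -> `|f s| <= D * (`|(ab s).1| + (ab s).2)) ->
    forall s s', 0 <= s -> s <= s' -> s' <= t -> `|\int[mu]_(r in `[s, s']) f r|
      <= D * C.
  move=> D0 tf hf s s' s0 ss' s't.
  apply: le_trans (_ : D * \int[mu]_(r in `[s, s']) (`|(ab r).1| + (ab r).2) <=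
    _).
    rewrite -(rintZ _ tsz)//; apply: (@ler_norm_rint _ 0 t) => //.
      by apply: tameM => //; exact: tame_cst.
    by move=> u /andP[su us']; apply: hf; rewrite (le_trans s0) ?(le_trans us').
  rewrite ler_wpM2l// (le_trans _ hI)//.
  rewrite (@rint_split _ 0 t _ 0 s' t)//; last exact: le_trans ss'.
  rewrite (@rint_split _ 0 t _ 0 s s')//.
  have nn u v : 0 <= u -> v <= t -> 0 <= \int[mu]_(r in `[u, v])
    (`|(ab r).1| + (ab r).2).
    move=> u0 vt; apply: Rintegral_ge0 => r /=; rewrite in_itv/= =>
      /andP[ur rv].
    by rewrite sz0// (le_trans u0 ur) (le_trans rv).
  rewrite -addrA addrCA lerDl addr_ge0// nn//; first exact: le_trans s't.
  exact: le_trans ss'.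
have hwC s : 0 <= s <= t -> `|(w s).1| <= C /\ `|(w s).2| <= C.
  by move=> /hw; rewrite norm_pair_le => /andP[].
pose gg u := (ab u).1 + (ab u).2 * (w u).2.
have tg : tame 0 t gg.
  by apply: tameD => //; apply: tameM => //; exact: primitive_tame p2.
pose G s := \int[mu]_(r in `[0, t]) gg r - \int[mu]_(r in `[0, s]) gg r.
have pG : primitive 0 t G (fun s => 0 - gg s).
  by apply: primitiveB (primitive_rint tg); exact: primitive_cst.
have GC s : 0 <= s <= t -> `|G s| <= C4.
  move=> /andP[s0 st]; rewrite /G (@rint_split _ 0 t _ 0 s t)// addrAC subrr
    add0r.
  apply: sub_size => //; first by rewrite addr_ge0// ltW.
  move=> u ut; rewrite (le_trans (ler_normD _ _))// normrM
    (ger0_norm (beta0 u ut)).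
  have h1 : (ab u).2 * `|(w u).2| <= (ab u).2 * C.
    by rewrite ler_wpM2l ?beta0//; have [] := hwC u ut.
  have h2 : 0 <= C * `|(ab u).1| by rewrite mulr_ge0// ltW.
  by move: h1 h2 (beta0 u ut); lra_from_goal.
pose E s := expR (2 * G s).
have pE : primitive 0 t E (fun s => E s * (2 * (0 - gg s))).
  exact: primitive_expR (primitiveZ 2 pG).
have EE s : 0 <= s <= t -> 0 < E s <= E2.
  move=> st; rewrite expR_gt0 ler_expR ler_pM2l// (le_trans (ler_norm _))//.
  exact: GC.
pose dl := y.2 - (w t).2.
have dlr : `|dl| <= rho by [].
have tbE := tameM tb (primitive_tame pE).
pose Q s := \int[mu]_(r in `[0, t]) ((ab r).2 * E r) - \int[mu]_(r in `[0, s])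
  ((ab r).2 * E r).
have QC s : 0 <= s <= t -> `|Q s| <= E2 * C.
  move=> /andP[s0 st]; rewrite /Q (@rint_split _ 0 t _ 0 s t)// addrAC subrr
    add0r.
  apply: sub_size => //; first exact: ltW.
  move=> u ut; rewrite normrM (ger0_norm (beta0 u ut)) mulrC.
  have /andP[h1 h2] := EE u ut; rewrite (gtr0_norm h1) ler_pM ?beta0//
    ?(ltW h1)//.
  by rewrite lerDr.
pose D s := 1 - dl * Q s.
have pD : primitive 0 t D (fun s => dl * ((ab s).2 * E s)).
  have pQ : primitive 0 t Q (fun s => 0 - (ab s).2 * E s).
    by apply: primitiveB (primitive_rint tbE); exact: primitive_cst.
  apply: primitive_eq (primitiveB (primitive_cst 0 t 1) (primitiveZ dl pQ)) =>
    // s _; ring.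
have D2 s : 0 <= s <= t -> 2^-1 <= D s.
  move=> st; have : `|dl * Q s| <= rho * (E2 * C) by rewrite normrM ler_pM// QC.
  have : rho * (E2 * C) = rho * (2 * E2 * C) / 2 by field.
  rewrite ler_norml /D => E' /andP[_ h].
  by move: E' h hr1 nu1; lra_from_goal.
have i20 : (0 : R) < 2^-1 by rewrite invr_gt0.
have pV := primitive_inv i20 D2 pD.
pose Dl s := dl * (E s * (D s)^-1).
have D0 s : 0 <= s <= t -> D s != 0.
  by move=> /D2 h; apply: lt0r_neq0; exact: lt_le_trans h.
have pDl : primitive 0 t Dl (fun s => - 2 * gg s * Dl s - (ab s).2 * Dl s ^+ 2).
  apply: primitive_eq (primitiveZ dl (primitiveM pE pV)) => // s /D0 Ds.
  by rewrite /Dl; field.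
have Dlr s : 0 <= s <= t -> `|Dl s| <= rho * (2 * E2).
  move=> st; rewrite /Dl normrM ler_pM// normrM mulrC ler_pM//.
    have Ds := D2 s st.
    rewrite ger0_norm ?invr_ge0; last exact: le_trans (ltW i20) Ds.
    by rewrite -[leRHS]invrK lef_pV2 ?posrE ?(lt_le_trans i20 Ds).
  by have /andP[h1 h2] := EE s st; rewrite gtr0_norm.
have nu_le1 : nu <= 1 by move: nu1; lra_from_goal.
have Dl1 s : 0 <= s <= t -> `|Dl s| <= 1.
  by move=> /Dlr h; rewrite (le_trans h)// (le_trans hr2).
have Dlt : Dl t = dl.
  rewrite /Dl /E /D /Q /G !subrr !mulr0 subr0 expR0 invr1; ring.
pose v2 s := (w s).2 + Dl s.
have pv2 : primitive 0 t v2
    (fun s => - (ab s).2 * v2 s ^+ 2 - 2 * (ab s).1 * v2 s + c s ^+ 2).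
  apply: primitive_eq (primitiveD p2 pDl) => // s _; rewrite /v2 /gg; ring.
have v20 : 0 < v2 0.
  have := Dlr 0; rewrite lexx t0 => /(_ isT); rewrite /v2 ler_norml =>
    /andP[h _].
  by move: h w0d hr2 nu2 d0; lra_from_goal.
have tv2 := primitive_tame pv2.
have v2p s : 0 <= s <= t -> 0 < v2 s.
  move=> /andP[s0 st].
  have tk : tame 0 t (fun r => (ab r).2 * v2 r + 2 * (ab r).1).
    by apply: tameD; apply: tameM => //; exact: tame_cst.
  have := primitive_nondecreasing (primitive_expM pv2 (primitive_rint tk))
    (lexx 0) s0 st _.
  rewrite rint_pt expR0 mulr1 => h.
  have : 0 < v2 s * expR
    (\int[mu]_(r in `[0, s]) ((ab r).2 * v2 r + 2 * (ab r).1)).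
    apply: lt_le_trans v20 (h _) => u _; rewrite mulr_ge0 ?expR_ge0//.
    by move: (sqr_ge0 (c u)); lra_from_goal.
  by rewrite pmulr_lgt0// expR_gt0.
pose kk u := (ab u).1 + (ab u).2 * v2 u.
have tkk : tame 0 t kk by apply: tameD => //; exact: tameM.
have teta : tame 0 t eta by exact: tame_continuous.
have [v1 pv1 v1t] := linear_ode y.1 t0 tkk (tameN (tameM teta tkk)).
pose w' s := (v1 s, v2 s).
have pw' : halfplane_path c eta 0 t ab w'.
  split=> //; apply: primitive_eq pv1 => // s _; rewrite /w'/= /kk; ring.
have w't : w' t = y.
  by rewrite /w' v1t /v2 Dlt /dl addrC subrK -surjective_pairing.
have w'0 : `|w' 0 - w 0| <= nu.
  have t00 : (0 : R) <= 0 <= t by apply/andP.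
  rewrite norm_pair_le; apply/andP; split; last first.
    have -> : (w' 0 - w 0).2 = Dl 0 by rewrite /= /v2 addrC addKr.
    exact: le_trans (Dlr 0 t00) hr2.
  have -> : (w' 0 - w 0).1 = v1 0 - (w 0).1 by [].
  have pZ := primitive_expM (primitiveB pv1 p1) (primitive_rint tkk).
  have KC s : 0 <= s <= t -> `|\int[mu]_(r in `[0, s]) kk r| <= C6.
    move=> /andP[s0 st]; apply: sub_size => //; first by rewrite addr_ge0// ltW.
    move=> u ut; rewrite (le_trans (ler_normD _ _))// normrM
      (ger0_norm (beta0 u ut)).
    have h1 : (ab u).2 * `|v2 u| <= (ab u).2 * (C + 1).
      rewrite ler_wpM2l ?beta0// (le_trans (ler_normD _ _))// lerD ?Dl1//.
      by have [] := hwC u ut.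
    have h2 : 0 <= C * `|(ab u).1| by rewrite mulr_ge0// ltW.
    by move: h1 h2 (beta0 u ut) (normr_ge0 (ab u).1); lra_from_goal.
  have [tZ ZE] := pZ; have := ZE 0 t (lexx 0) t0 (lexx t).
  rewrite rint_pt expR0 mulr1 v1t => hZ.
  set IZ := (X in _ = X) in hZ.
  have hIZ : `|IZ| <= (E6 * (C + Ce) * (rho * (2 * E2))) * C.
    have hD : 0 <= E6 * (C + Ce) * (rho * (2 * E2)).
      by apply: mulr_ge0 => //; apply: mulr_ge0;
        [exact: ltW|rewrite addr_ge0// ltW].
    apply: (sub_size _ _ hD tZ) => //.
    move=> u ut; have /andP[u0 u_t] := ut.
    have -> : - (eta u * kk u) - kk u * v1 u -
       (- ((w u).1 + eta u) * ((ab u).1 + (ab u).2 * (w u).2)) +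
       kk u * (v1 u - (w u).1) = - (((w u).1 + eta u) * (Dl u * (ab u).2)).
      by rewrite /kk /v2; ring.
    have -> : E6 * (C + Ce) * (rho * (2 * E2)) * (`|(ab u).1| + (ab u).2) =
      ((C + Ce) * ((rho * (2 * E2)) * (`|(ab u).1| + (ab u).2))) * E6 by ring.
    rewrite normrM normrN (gtr0_norm (expR_gt0 _)) ler_pM ?expR_ge0//;
      last first.
      by rewrite ler_expR (le_trans (ler_norm _))// KC.
    rewrite normrM ler_pM//.
      rewrite (le_trans (ler_normD _ _))// lerD//; first by have [] := hwC u ut.
      by rewrite hCe// u0 (le_trans u_t).
    rewrite normrM ler_pM ?Dlr// (ger0_norm (beta0 u ut)) lerDr//.
  have hKt : `|(y.1 - (w t).1) * expR (\int[mu]_(r in `[0, t]) kk r)| <=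
    rho * E6.
    rewrite normrM (gtr0_norm (expR_gt0 _)) ler_pM// ?expR_ge0//.
    by rewrite ler_expR (le_trans (ler_norm _))// KC// t0 lexx.
  have -> : v1 0 - (w 0).1 =
     (y.1 - (w t).1) * expR (\int[mu]_(r in `[0, t]) kk r) - IZ.
    by rewrite -hZ subKr.
  rewrite (le_trans (ler_normB _ _))//.
  have : rho * (E6 + E6 * (C + Ce) * C * (2 * E2)) =
    rho * E6 + (E6 * (C + Ce) * (rho * (2 * E2))) * C by ring.
  by move=> E'; rewrite E' in hr3; exact: le_trans (lerD hKt hIZ) hr3.
exists ab, w'; split=> //.
apply: le_trans (_ : (path_cost ab 0%R t + (v0 (w 0%R) + e%:E) <= _)%E).
  rewrite leeD2l//; apply: hv => //; first by apply: hw; rewrite lexx.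
  exact: le_trans nu3.
by rewrite addeA EFinD leeD.
Qed.

End perturbation.

(** * Paths with an affine second coordinate *)

Section steering.
Context {R : realType}.
Variables (c eta : R -> R) (g : R -> R -> R -> \bar R).
Hypotheses (cc : continuous c) (ce : continuous eta).
Hypothesis gc : continuous (fun q : R * R * R => g q.1.1 q.1.2 q.2).
Hypothesis g0 : forall t a b, (0 <= g t a b)%E.
Hypothesis g_fin : forall t a b, 0 < b -> (g t a b < +oo)%E.
Implicit Types (a b s t u k : R) (ab w : R -> R * R) (x y : R * R).
Notation mu := (@lebesgue_measure R).

(** The value of a for which the second component of the drift is m at time r
    and second coordinate v = y.2 + (r - t) m, given the value b of the other
    control. *)
Definition linear_drift_control t m b y r : R :=
  (c r ^+ 2 - b * (y.2 + (r - t) * m) ^+ 2 - m) / (2 * (y.2 + (r - t) * m)).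

Lemma linear_drift_control_continuous t m b y r : y.2 + (r - t) * m != 0 ->
  {for r, continuous (linear_drift_control t m b y)}.
Proof.
move=> h.
have cl : {for r, continuous (fun r => y.2 + (r - t) * m)}.
  apply: cvgD; first exact: cvg_cst.
  by apply: cvgM; [apply: cvgB; [exact: cvg_id|exact: cvg_cst]|exact: cvg_cst].
apply: cvgM; last first.
  apply: cvgV; first by rewrite mulf_neq0.
  by apply: cvgM; [exact: cvg_cst|exact: cl].
apply: cvgB; last exact: cvg_cst.
apply: cvgB; first by apply: cvgM; exact: cc.
by apply: cvgM; [exact: cvg_cst|apply: cvgM; exact: cl].
Qed.

(** Prescribing the second coordinate and solving the Riccati equation for the
    control gives explicit paths to y; the first coordinate is then obtained
    from [linear_ode]. *)
Lemma linear_path A s t m b y : s <= t ->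
  (forall r, s <= r <= t -> 0 < y.2 + (r - t) * m) ->
  (forall r, s <= r <= t -> A (linear_drift_control t m b y r, b)) ->
  exists ab w, [/\ controls A ab, halfplane_path c eta s t ab w, w t = y &
    forall r, s <= r <= t -> ab r = (linear_drift_control t m b y r, b) /\
      (w r).2 = y.2 + (r - t) * m].
Proof.
move=> st pos Aal; set al := linear_drift_control t m b y in Aal *.
(* Freezing the control outside [s, t] makes it continuous and bounded on the
   line. *)
pose al' r := al (clamp s t r).
have al'c : continuous al'.
  move=> r; apply: (@continuous_comp _ _ _ (clamp s t) al).
    exact: clamp_continuous.
  by apply: linear_drift_control_continuous; apply: lt0r_neq0; exact/pos/clampP.
have tal := tame_continuous s t al'c.
have pw2 : primitive s t (fun r => y.2 + (r - t) * m) (fun=> m).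
  have := primitiveD (primitive_cst s t (y.2 - t * m))
    (primitiveZ m (primitive_id s t)).
  by apply: primitive_eq => r _; ring.
have tb := tame_cst s t b.
have tk : tame s t (fun r => al' r + b * (y.2 + (r - t) * m)).
  by apply: tameD => //; apply: tameM => //; exact: primitive_tame pw2.
have teta := tame_continuous s t ce.
have [w1 pw1 w1t] := linear_ode y.1 st tk (tameN (tameM teta tk)).
exists (fun r => (al' r, b)), (fun r => (w1 r, y.2 + (r - t) * m)); split.
- split.
  + apply: measurable_funTS; apply: measurable_fun_pair; last exact:
      measurable_cst.
    exact: continuous_measurable_fun.
  + move=> T; have [L L0 hL] := tame_bound tal; exists (Num.max L `|b|) => r _.
    rewrite norm_pair_le/= !le_max lexx orbT andbT.
    have := hL _ (clampP r st); rewrite /al' (clamp_id (clampP r st)) => ->.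
    by [].
  + by move=> r _; exact/Aal/clampP.
- split => //=.
  + apply: primitive_eq pw1 => // r _; ring.
  + apply: primitive_eq pw2 => // r rst; have := pos r rst => /lt0r_neq0 h.
    rewrite /al' clamp_id// /al /linear_drift_control; field.
    by [].
- by rewrite w1t subrr mul0r addr0 -surjective_pairing.
- by move=> r rst; rewrite /al' clamp_id.
Qed.

(** For b > 0 the cost is finite and upper semicontinuous on the compact set of
    the other two arguments. *)
Lemma running_cost_bounded T L b : 0 < b -> exists2 C, 0 <= C &
  forall t a, 0 <= t <= T -> `|a| <= L -> (g t a b <= C%:E)%E.
Proof.
move=> b0.
pose K : set (R * R) := `[0, T] `*` `[- L, L].
have cK : compact K by apply: compact_setX; exact: segment_compact.
have : \forall C \near +oo, K `<=` (fun q => (g q.1 q.2 b <= C%:E)%E).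
  apply: (compact_near_coveringP K).1 => // q0 _.
  have [y hy] : exists y : R, (g q0.1 q0.2 b < y%:E)%E.
    have := g_fin q0.1 q0.2 b0; have := g0 q0.1 q0.2 b.
    by case: (g _ _ _) => // r _ _; exists (r + 1); rewrite lte_fin ltrDl.
  exists ([set q | (g q.1 q.2 b < y%:E)%E], [set C | y <= C]).
    split => /=; last by apply: nbhs_pinfty_ge; exact: num_real.
    have h : {for q0, continuous (fun q : R * R => (q, b))}.
      exact: (cvg_pair (@cvg_id _ (nbhs q0)) (@cvg_cst _ b _ (nbhs q0) _)).
    have hO : nbhs (g q0.1 q0.2 b) [set z | z < y%:E]%E.
      by apply: open_nbhs_nbhs; split => //; exact: open_ereal_lt_ereal.
    exact: (h _ (@gc (q0, b) _ hO)).
  move=> [q C] /= [h1 h2]; rewrite (le_trans (ltW h1))// lee_fin//.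
move=> [C [_ hC]]; exists (Num.max C 0 + 1); first by rewrite addr_ge0// le_max
  lexx orbT.
move=> t a tT aL; apply: (hC (Num.max C 0 + 1) _ (t, a)).
  by rewrite ltr_pwDr// le_max lexx.
by split => /=; rewrite in_itv//= -ler_norml.
Qed.

(** The first coordinate solves a linear equation with coefficient k and source
    - eta k; the factor 2 comes from the length of the interval. *)
Lemma damped_bound s t (Y k : R -> R) kap Ce : s <= t -> t - s <= 2 ->
  0 <= kap -> 0 <= Ce ->
  primitive s t Y (fun r => - (Y r + eta r) * k r) -> tame s t k ->
  (forall r, s <= r <= t -> `|k r| <= kap) ->
  (forall r, s <= r <= t -> `|eta r| <= Ce) ->
  forall r, s <= r <= t -> `|Y r| <=
    (`|Y t| * expR (2 * kap) + Ce * kap * expR (2 * kap) * 2) * expR (2 * kap).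
Proof.
move=> st ts2 kap0 Ce0 pY tk hk he r rst; have /andP[sr rt] := rst.
have pK := primitive_rint tk; set K := (fun s => \int[_]_(_ in _) _) in pK.
have hK u : s <= u <= t -> `|K u| <= 2 * kap.
  move=> /andP[su ut]; apply: le_trans (_ : kap * (u - s) <= _).
    rewrite -rint_cst//; apply: (@ler_norm_rint _ s t) => //; first exact:
      tame_cst.
    by move=> v /andP[sv vu]; rewrite hk// sv (le_trans vu).
  by rewrite [leRHS]mulrC ler_wpM2l//; lra.
have pF := primitive_expM pY pK; have [tF FE] := pF.
have hF : `|Y t * expR (K t) - Y r * expR (K r)| <= Ce * kap * expR (2 * kap)
  * 2.
  rewrite FE//; apply: le_trans (_ : Ce * kap * expR (2 * kap) * (t - r) <= _).
    rewrite -rint_cst//; apply: (@ler_norm_rint _ s t) => //; first exact: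
      tame_cst.
    move=> u /andP[ru ut]; have ust : s <= u <= t by rewrite (le_trans sr).
    have -> : - (Y u + eta u) * k u + k u * Y u = - (eta u * k u) by ring.
    rewrite normrM normrN (gtr0_norm (expR_gt0 _)) ler_pM ?expR_ge0//.
      by rewrite normrM ler_pM// ?he ?hk.
    by rewrite ler_expR (le_trans (ler_norm _))// hK.
  rewrite ler_wpM2l ?mulr_ge0 ?expR_ge0//; lra.
have -> : Y r = Y r * expR (K r) * expR (- K r).
  by rewrite -mulrA expRxMexpNx_1 mulr1.
rewrite normrM (gtr0_norm (expR_gt0 _)) ler_pM ?expR_ge0//; last first.
  by rewrite ler_expR (le_trans (ler_norm _))// normrN hK.
rewrite -[X in `|X|](subKr (Y t * expR (K t))).
rewrite (le_trans (ler_normB _ _))// lerD//.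
rewrite normrM (gtr0_norm (expR_gt0 _)) ler_wpM2l// ler_expR
  (le_trans (ler_norm _))//.
by rewrite hK// st lexx.
Qed.

(** Points near x can be reached in a short time with controls of size M,
    however small M is. Indeed, for the slope m = c(t)^2 the numerator c^2 - b
    v^2 - m of the control is small when b and r - t are. *)
Lemma steer x t M : 0 < x.2 -> 0 <= t -> 0 < M ->
  exists2 rho, 0 < rho & exists2 C, 0 <= C &
  forall t1 t2 y, 0 <= t1 -> t1 <= t2 -> `|t1 - t| <= rho -> `|t2 - t| <= rho ->
  `|y - x| <= rho -> exists ab w, [/\ controls (control_values_le M) ab,
     halfplane_path c eta t1 t2 ab w, w t2 = y,
     (path_cost g ab t1 t2 <= (C * (t2 - t1))%:E)%E &
     `|w t1 - y| <= C * (t2 - t1)].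
Proof.
move=> x0 t0 M0.
(* The second coordinate v will stay between z and Z. *)
pose z := x.2 / 2; pose Z := 2 * x.2.
pose m := c t ^+ 2; have m0 : 0 <= m by exact: sqr_ge0.
(* The constant b ensures that b + b Z^2 / (2 z) <= M / 2, and the continuity of
   c that |c(r)^2 - m| / (2 z) <= M / 4. *)
pose b := M / (2 + 4 * Z ^+ 2 / x.2).
have den0 : 0 < 2 + 4 * Z ^+ 2 / x.2.
  by rewrite addr_gt0// divr_gt0// mulr_gt0// exprn_gt0// /Z mulr_gt0.
have b0 : 0 < b by rewrite divr_gt0.
have bE : b * 2 + b * (4 * Z ^+ 2 / x.2) = M.
  by rewrite -mulrDr /b divfK// lt0r_neq0.
have c2 : (fun r => c r ^+ 2) @ t --> m by apply: cvgM; exact: cc.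
have e0 : 0 < M * x.2 / 4 by rewrite divr_gt0// mulr_gt0.
have hn : nbhs t [set r | `|m - c r ^+ 2| < M * x.2 / 4].
  exact: ((cvgrPdist_lt _ _).1 c2 _ e0).
have [rho1 /= rho10 hc] := (nbhs_ballP _ _).1 hn.
have [Cg Cg0 hg] := running_cost_bounded (t + 1) M b0.
have [Ce Ce0 hCe] := tame_bound (@tame_continuous _ 0 (t + 1) _ ce).
pose kap := M + M * Z.
have Z0 : 0 < Z by rewrite mulr_gt0.
have kap0 : 0 <= kap by rewrite addr_ge0// ltW// mulr_gt0.
pose W := ((`|x| + 1) * expR (2 * kap) + Ce * kap * expR (2 * kap) * 2) * expR
  (2 * kap).
have W0 : 0 <= W.
  have k1 : 0 <= Ce * kap by rewrite mulr_ge0// ltW.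
  have k2 : 0 <= (`|x| + 1) * expR (2 * kap).
    by rewrite mulr_ge0 ?expR_ge0// addr_ge0.
  by rewrite mulr_ge0 ?expR_ge0// addr_ge0// mulr_ge0// mulr_ge0 ?expR_ge0.
exists (Num.min (Num.min (rho1 / 2) 1) (x.2 / (2 * (1 + 2 * m)))).
  by rewrite !lt_min divr_gt0//= ltr01 divr_gt0// mulr_gt0//; lra.
exists (Cg + m + (W + Ce) * kap).
  by rewrite !addr_ge0// mulr_ge0// addr_ge0// ltW.
move=> t1 t2 y t10 t12; rewrite !le_min => /andP[/andP[a1 a2] a3]
  /andP[/andP[b1 b2] b3].
move=> /andP[/andP[y1 y2] y3].
have t2T : t2 <= t + 1.
  by move: b2; rewrite ler_norml => /andP[_]; lra_from_goal.
have rt r : t1 <= r <= t2 -> `|r - t2| <= t2 - t1.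
  by move=> /andP[h1 h2]; rewrite ler0_norm ?subr_le0// opprB lerD2l lerN2.
have t21 : t2 - t1 <= 2 * (x.2 / (2 * (1 + 2 * m))).
  move: a3 b3; rewrite !ler_norml => /andP[h1 _] /andP[_ h2].
  by move: h1 h2; lra_from_goal.
have w2b r : t1 <= r <= t2 -> z <= y.2 + (r - t2) * m <= Z.
  move=> /rt hr.
  have h1 : `|(r - t2) * m| <= 2 * (x.2 / (2 * (1 + 2 * m))) * m.
    by rewrite normrM (ger0_norm m0) ler_wpM2r// (le_trans hr).
  have h2 : `|y.2 - x.2| <= x.2 / (2 * (1 + 2 * m)).
    by apply: le_trans y3; exact: (ler_norm2 (y - x)).
  have h3 : 2 * (x.2 / (2 * (1 + 2 * m))) * m + x.2 / (2 * (1 + 2 * m)) = z.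
    have : 0 < 1 + 2 * m by rewrite ltr_pwDl// mulr_ge0.
    by rewrite /z => /lt0r_neq0 ?; field.
  by move: h1 h2 h3 x0; rewrite !ler_norml /Z /z; lra_from_goal.
have z0 : 0 < z by rewrite divr_gt0.
have w2p r : t1 <= r <= t2 -> 0 < y.2 + (r - t2) * m.
  by move=> /w2b/andP[h _]; exact: lt_le_trans h.
have alM r : t1 <= r <= t2 -> `|linear_drift_control t2 m b y r| + b <= M.
  move=> r12; have /andP[h1 h2] := w2b r r12; have h3 := w2p r r12.
  rewrite /linear_drift_control; set v := y.2 + _ in h1 h2 h3 *.
  have hcr : `|c r ^+ 2 - m| <= M * x.2 / 4.
    apply: ltW; rewrite distrC; apply: hc; rewrite -ball_normE/= distrC.
    move: a1 b1 r12; rewrite !ler_norml => h4 h5 /andP[h6 h7].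
    by rewrite ltr_norml; move: h4 h5 h6 h7 rho10; lra_from_goal.
  have hv : v ^+ 2 <= Z ^+ 2 by rewrite lerXn2r// nnegrE ltW.
  have num : `|c r ^+ 2 - b * v ^+ 2 - m| <= M * x.2 / 4 + b * Z ^+ 2.
    have -> : c r ^+ 2 - b * v ^+ 2 - m = (c r ^+ 2 - m) - b * v ^+ 2 by ring.
    rewrite (le_trans (ler_normB _ _))// lerD// ger0_norm ?ler_pM2l//.
    by rewrite mulr_ge0 ?sqr_ge0// ltW.
  have -> : `|(c r ^+ 2 - b * v ^+ 2 - m) / (2 * v)| =
      `|c r ^+ 2 - b * v ^+ 2 - m| / (2 * v).
    by rewrite normrM normfV (@gtr0_norm _ (2 * v))// mulr_gt0.
  have : `|c r ^+ 2 - b * v ^+ 2 - m| / (2 * v) <= (M * x.2 / 4 + b * Z ^+ 2) /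
    (2 * z).
    rewrite ler_pM ?invr_ge0//; first by rewrite mulr_ge0// ltW.
    by rewrite lef_pV2 ?posrE ?mulr_gt0// ler_pM2l.
  have -> : (M * x.2 / 4 + b * Z ^+ 2) / (2 * z) =
    M / 4 + b * (4 * Z ^+ 2 / x.2) / 4.
    by rewrite /z; field; exact: lt0r_neq0.
  have : 0 <= b * (4 * Z ^+ 2 / x.2).
    by rewrite mulr_ge0 ?(ltW b0)// divr_ge0 ?(ltW x0)// mulr_ge0// sqr_ge0.
  move: bE b0; lra_from_goal.
have hA r : t1 <= r <= t2 ->
  control_values_le M (linear_drift_control t2 m b y r, b).
  by move=> r12; split; [exact: ltW|exact: alM].
have [ab [w [cab pw wt2 hr]]] := linear_path t12 w2p hA.
exists ab, w; split => //.
- have tab := controls_tame t2 t10 cab.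
  apply: le_trans (path_cost_le gc g0 tab (tame_cst t1 t2 Cg) _) _.
    move=> r r12; have [-> _] := hr r r12; apply: hg => //=.
      by move/andP: r12 => [h1 h2]; rewrite (le_trans t10 h1) (le_trans h2).
    by move: (alM r r12) b0; lra_from_goal.
  rewrite rint_cst// lee_fin ler_wpM2r ?subr_ge0// -addrA lerDl.
  by rewrite !addr_ge0// mulr_ge0// addr_ge0// ltW.
- have t1t1 : t1 <= t1 <= t2 by rewrite lexx.
  rewrite norm_pair_le; apply/andP; split; last first.
    have -> : (w t1 - y).2 = (w t1).2 - y.2 by [].
    have [_ ->] := hr t1 t1t1.
    have -> : y.2 + (t1 - t2) * m - y.2 = - (m * (t2 - t1)) by ring.
    have hm : 0 <= m * (t2 - t1) by apply: mulr_ge0; rewrite ?subr_ge0.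
    rewrite normrN (ger0_norm hm) ler_wpM2r ?subr_ge0//.
    by rewrite addrAC lerDr addr_ge0// mulr_ge0// addr_ge0// ltW.
  have -> : (w t1 - y).1 = - ((w t2).1 - (w t1).1) by rewrite wt2 opprB.
  rewrite normrN; have [p1 p2 wp] := pw; have [tf ->//] := p1.
  have hk r : t1 <= r <= t2 -> `|(ab r).1 + (ab r).2 * (w r).2| <= kap.
    move=> r12; have [-> ->] := hr r r12; have := alM r r12;
      have /andP[h1 h2] := w2b r r12.
    rewrite /=; set v := y.2 + _ in h1 h2 *;
      set al := linear_drift_control _ _ _ _ _ => h3.
    have v0 : 0 <= v by apply: le_trans h1; exact: ltW.
    have bM : b <= M by move: h3 (normr_ge0 al); lra_from_goal.
    have alM' : `|al| <= M by move: h3 b0; lra_from_goal.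
    rewrite (le_trans (ler_normD _ _))// lerD// ger0_norm; last first.
      by apply: mulr_ge0 => //; exact: ltW.
    by apply: ler_pM => //; exact: ltW.
  have he r : t1 <= r <= t2 -> `|eta r| <= Ce.
    by move=> /andP[h1 h2]; rewrite hCe// (le_trans t10 h1) (le_trans h2).
  have [ta tb] := controls_tame t2 t10 cab.
  have tk : tame t1 t2 (fun r => (ab r).1 + (ab r).2 * (w r).2).
    by apply: tameD => //; apply: tameM => //; exact: primitive_tame p2.
  have hW r : t1 <= r <= t2 -> `|(w r).1| <= W.
    move=> r12;
      apply: le_trans (damped_bound t12 _ kap0 (ltW Ce0) p1 tk hk he r12) _.
      by move: a2 b2; rewrite !ler_norml; lra_from_goal.
    rewrite ler_wpM2r ?expR_ge0// lerD2r ler_wpM2r ?expR_ge0// wt2.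
    have -> : y.1 = x.1 + (y - x).1 by rewrite /= addrC subrK.
    rewrite (le_trans (ler_normD _ _))// lerD ?ler_norm1//.
    by rewrite (le_trans (ler_norm1 _)).
  apply: le_trans (_ : (W + Ce) * kap * (t2 - t1) <= _); last first.
    by rewrite ler_wpM2r ?subr_ge0// lerDr addr_ge0.
  rewrite -rint_cst//; apply: (@ler_norm_rint _ t1 t2) => //; first exact:
    tame_cst.
  move=> r r12; rewrite normrM normrN ler_pM ?hk//.
  by rewrite (le_trans (ler_normD _ _))// lerD// ?hW ?he.
Qed.

End steering.

(** * Continuity estimate for the value *)

Section nearby.
Context {R : realType}.
Variables (c eta : R -> R) (g : R -> R -> R -> \bar R) (v0 : R * R -> \bar R).
Variable A : set (R * R).
Hypotheses (cc : continuous c) (ce : continuous eta).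
Hypothesis gc : continuous (fun q : R * R * R => g q.1.1 q.1.2 q.2).
Hypothesis g0 : forall t a b, (0 <= g t a b)%E.
Hypothesis g_superlinear : forall T N, 0 < T -> 0 < N ->
  exists2 r, 0 <= r & forall t a b, 0 <= t <= T -> 0 <= b ->
    ((N * (`|a| + b) - r)%:E <= g t a b)%E.
Variable m : R.
Hypothesis v0_lb : forall x, (m%:E <= v0 x)%E.
Hypothesis v0_coercive : coercive_initial_cost v0.
Hypothesis v0_out : forall x, ~ halfplane x -> v0 x = +oo%E.
Hypothesis A_sub : A `<=` control_values.
Implicit Types (a b s t u k : R) (ab w : R -> R * R) (x : R * R).
Notation mu := (@lebesgue_measure R).
Local Notation path_cost := (path_cost g).
Hypothesis v0_fin : forall x, halfplane x -> v0 x \is a fin_num.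
Hypothesis v0_lip : locally_lipschitz halfplane (fine \o v0).
Hypothesis g_fin : forall t a b, 0 < b -> (g t a b < +oo)%E.
Hypothesis A_small : exists2 M, 0 < M & control_values_le M `<=` A.
Local Notation attains := (attains c eta g v0 A).
Local Notation value := (value c eta g v0 A).

Lemma controls_subset (B C : set (R * R)) ab : B `<=` C -> controls B ab ->
  controls C ab.
Proof. by move=> BC [? ? h]; split => // s /h /BC. Qed.

(** If t2 <= t1, cut the path at t2; it is then close to y1 by equicontinuity,
    and its end point can be moved to y2. If t1 <= t2, steer to (y2, t2) from
    some point at time t1, which is close to y1, and move the end point of the
    given path to that point. *)
Lemma attains_nearby x t K e : 0 < x.2 -> 0 <= t -> 0 < e ->
  exists2 rho, 0 < rho &
  forall y1 t1 y2 t2 k, 0 <= t1 -> 0 <= t2 ->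
  `|y1 - x| <= rho -> `|t1 - t| <= rho ->
  `|y2 - x| <= rho -> `|t2 - t| <= rho -> k <= K ->
  attains y1 t1 k -> attains y2 t2 (k + e).
Proof.
move=> x0 t0 e0; have T0 : 0 < t + 1 by rewrite ltr_wpDl.
have [M0 M0_gt0 A_sup] := A_small.
have e20 : 0 < e / 2 by rewrite divr_gt0.
have [r1 r10 h1] := path_perturb cc ce gc g0 g_superlinear v0_lb v0_coercive
  A_sub
  v0_fin v0_lip K T0 e20.
have r120 : 0 < r1 / 2 by rewrite divr_gt0.
have [h h0 h2] := path_modulus cc ce gc g0 g_superlinear v0_lb v0_coercive A_sub
  K T0 r120.
have [r3 r30 [C C0 h3]] := steer cc ce gc g0 g_fin x0 t0 M0_gt0.
(* D rho is twice a bound for the sum of |y2 - y1| and of the displacement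
   caused by steering. *)
pose D := 4 * C + 4.
have D0 : 0 < D by rewrite ltr_wpDl// mulr_ge0.
pose rho := Num.min (Num.min (Num.min 1 (h / 2)) (Num.min r3 (r1 / D))) (e / D).
have rho0 : 0 < rho by rewrite !lt_min ltr01 !divr_gt0// r30.
have rho1 : rho <= 1 by rewrite /rho !ge_min lexx.
have rhoh : rho <= h / 2 by rewrite /rho !ge_min lexx !orbT.
have rho3 : rho <= r3 by rewrite /rho !ge_min lexx !orbT.
have rhor1 : rho * D <= r1 by rewrite -ler_pdivlMr// /rho !ge_min lexx !orbT.
have rhoe : rho * D <= e by rewrite -ler_pdivlMr// /rho !ge_min lexx !orbT.
exists rho => // y1 t1 y2 t2 k t10 t20 y1x t1t y2x t2t kK.
have y12 : `|y2 - y1| <= 2 * rho.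
  have -> : y2 - y1 = (y2 - x) - (y1 - x) by rewrite opprB addrA subrK.
  by rewrite (le_trans (ler_normB _ _))// mulr_natl mulr2n lerD.
have t1T : t1 <= t + 1.
  by move: t1t rho1; rewrite ler_norml => /andP[]; lra_from_goal.
have t2T : t2 <= t + 1.
  by move: t2t rho1; rewrite ler_norml => /andP[]; lra_from_goal.
have t12 : `|t2 - t1| <= 2 * rho.
  by move: t1t t2t; rewrite !ler_norml => /andP[] a1 a2 /andP[] a3 a4;
    apply/andP; move: a1 a2 a3 a4; lra_from_goal.
have rr : 4 * rho <= r1.
  have : 0 <= rho * (4 * C) by rewrite mulr_ge0// ?mulr_ge0// ltW.
  by move: rhor1; rewrite /D; lra_from_goal.
have hCr : 4 * (C * rho) <= e.
  by move: rhoe rho0; rewrite /D; lra_from_goal.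
have hCr1 : 4 * (C * rho) + 4 * rho <= r1.
  by move: rhor1; rewrite /D; lra_from_goal.
have [t21|/ltW t1t2] := leP t2 t1.
  move=> [ab [w [cab pw wt1 hk]]].
  have [C' _ [C'0 hC']] := attains_restrict gc g0 v0_lb t20 t21 cab pw hk.
  have hk' : (path_cost ab 0%R t1 + v0 (w 0%R) <= K%:E)%E.
    by rewrite (le_trans hk)// lee_fin.
  have hw : `|w t1 - w t2| <= r1 / 2.
    apply: (h2 t1 ab w t2 t1) => //.
    by move: t12 rhoh; rewrite ler_norml => /andP[]; lra_from_goal.
  apply: (@attains_le _ _ _ _ _ _ _ _ (k - C' + e / 2)).
    by move: C'0 e0; lra_from_goal.
  apply: (h1 t2 ab w) => //.
  - exact: halfplane_path_sub t21 pw.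
  - by move: C'0 kK; lra_from_goal.
  have -> : y2 - w t2 = (y2 - y1) + (w t1 - w t2) by rewrite wt1 addrA subrK.
  rewrite (le_trans (ler_normD _ _))//.
  by move: y12 hw rr; lra_from_goal.
move=> [ab [w [cab pw wt1 hk]]].
have [|||ab' [w' [cab' pw' w't2 hc' hw']]] := h3 t1 t2 y2 t10 t1t2.
  exact: le_trans rho3.
  exact: le_trans rho3.
  exact: le_trans rho3.
have t12' : C * (t2 - t1) <= 2 * (C * rho).
  rewrite mulrCA ler_wpM2l//.
  by move: t12; rewrite ler_norml => /andP[].
have aw : attains (w' t1) t1 (k + e / 2).
  apply: (h1 t1 ab w) => //; rewrite wt1.
  have -> : w' t1 - y1 = (w' t1 - y2) + (y2 - y1) by rewrite addrA subrK.
  rewrite (le_trans (ler_normD _ _))//.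
  by move: y12 hw' hCr1 t12' r10; lra_from_goal.
rewrite -w't2.
apply: (@attains_le _ _ _ _ _ _ _ _ (k + e / 2 + C * (t2 - t1))).
  by move: t12' hCr; lra_from_goal.
exact: (attains_extend gc g0 t10 t1t2 (controls_subset A_sup cab') pw' hc' aw).
Qed.

(** Continuity of the value as a map into ]-oo, +oo]: a bound at one point near
    x gives one at all points near x. *)
Lemma value_nearby x t K e : 0 < x.2 -> 0 <= t -> 0 < e ->
  exists2 rho, 0 < rho &
  forall y1 t1 y2 t2 k, 0 <= t1 -> 0 <= t2 ->
  `|y1 - x| <= rho -> `|t1 - t| <= rho ->
  `|y2 - x| <= rho -> `|t2 - t| <= rho -> k <= K ->
  (value (y1, t1) < k%:E)%E -> (value (y2, t2) < (k + e)%:E)%E.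
Proof.
move=> x0 t0 e0; have [rho rho0 h] := attains_nearby K x0 t0 e0.
exists rho => // y1 t1 y2 t2 k t10 t20 ? ? ? ? kK.
move=> /(attains_value cc ce g0 v0_out v0_lb t10)[k' k'k hk'].
have := h y1 t1 y2 t2 k' t10 t20; move=> /(_ _ _ _ _ _ hk') hh.
have a2 : attains y2 t2 (k' + e).
  by apply: hh => //; rewrite (le_trans (ltW k'k)).
apply: le_lt_trans (value_le_attains cc ce t20 a2) _.
by rewrite lte_fin ltrD2r.
Qed.

End nearby.

(** * Increments of test functions *)

Section test_functions.
Context {R : realType}.
Implicit Types (phi : R * R * R -> R) (q y v xi : R * R * R).

Lemma line_derive phi y v (th : R) : differentiable phi (y + th *: v) ->
  is_derive th 1 (fun th : R => phi (y + th *: v)) ('D_v phi (y + th *: v)).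
Proof.
move=> df; have dv := diff_derivable (v := v) df.
have e :
  (fun h : R => h^-1 *:
  (((fun th : R => phi (y + th *: v)) \o shift th) (h *: 1)
     - phi (y + th *: v))) =
   (fun h => h^-1 *:
     ((phi \o shift (y + th *: v)) (h *: v) - phi (y + th *: v))).
  apply/funext => h /=; congr (_ *: (phi _ - _)).
  by rewrite /shift/= scalerDl addrCA addrC [h *: 1]mulr1 addrC addrCA.
apply: DeriveDef; first by rewrite /derivable e.
by rewrite /derive e.
Qed.

Lemma line_mvt phi y v : (forall th : R, 0 <= th <= 1 ->
  differentiable phi (y + th *: v)) ->
  exists2 th : R, 0 <= th <= 1 & phi (y + v) - phi y = 'D_v phi (y + th *: v).
Proof.
move=> dphi.
have hd (th : R) : th \in `]0, 1[%R ->
    is_derive th 1 (fun th : R => phi (y + th *: v)) ('D_v phi (y + th *: v)).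
  rewrite in_itv/= => /andP[/ltW h0 /ltW h1]; apply: line_derive; apply: dphi.
  by rewrite h0.
have [|th] := MVT_segment (@ler01 R) hd.
  apply: derivable_within_continuous => th; rewrite in_itv/= => h01.
  by have [] := line_derive (dphi th h01).
rewrite in_itv/= => h01; rewrite scale1r scale0r addr0 subr0 mulr1 => ->.
by exists th.
Qed.

Lemma derive_coordinates phi xi v : differentiable phi xi ->
  'D_v phi xi = v.1.1 * 'D_(1, 0, 0) phi xi + v.1.2 * 'D_(0, 1, 0) phi xi
    + v.2 * 'D_(0, 0, 1) phi xi.
Proof.
move=> df; rewrite !deriveE//.
have e : v = v.1.1 *: (1, 0, 0) + v.1.2 *: (0, 1, 0) + v.2 *: (0, 0, 1).
  case: v => -[v1 v2] v3 /=; congr (_, _, _); rewrite /=.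
  - by rewrite [v1 *: _]mulr1 ![_ *: 0]mulr0 !addr0.
  - by rewrite [v2 *: _]mulr1 ![_ *: 0]mulr0 !addr0 add0r.
  - by rewrite [v3 *: _]mulr1 ![_ *: 0]mulr0 !add0r.
by rewrite {1}e !linearD !linearZ.
Qed.

(** The mean value theorem on the segment from y to q: a single point xi serves
    for the three partial derivatives. *)
Lemma C1_increment O phi q r y : C1_on O phi -> ball q r `<=` O ->
  `|y - q| < r ->
  exists2 xi, `|xi - q| <= `|y - q| &
    phi q - phi y = (q.1.1 - y.1.1) * 'D_(1, 0, 0) phi xi +
      (q.1.2 - y.1.2) * 'D_(0, 1, 0) phi xi + (q.2 - y.2) * 'D_(0, 0, 1) phi xi.
Proof.
move=> C1 qO yr.
have near th : 0 <= th <= 1 -> `|y + th *: (q - y) - q| <= `|y - q|.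
  move=> /andP[h0 h1].
  have -> : y + th *: (q - y) - q = (1 - th) *: (y - q).
    by rewrite scalerBl scale1r -[in RHS](opprB q y) scalerN opprK addrAC opprB.
  by rewrite normrZ ler_piMl// ger0_norm; lra.
have df th : 0 <= th <= 1 -> differentiable phi (y + th *: (q - y)).
  move=> h; have [|//] := C1 (y + th *: (q - y)).
  apply: qO; rewrite -ball_normE/= distrC; exact: le_lt_trans (near th h) yr.
have [th h01] := line_mvt df.
rewrite (_ : y + (q - y) = q); last by rewrite addrC subrK.
move=> ->; exists (y + th *: (q - y)); first exact: near.
by rewrite derive_coordinates//; exact: df.
Qed.

End test_functions.

(** * Stability of a strict inequality over all controls *)

Section gap.
Context {R : realType}.
Variable g : R -> R -> R -> \bar R.
Hypothesis gc : continuous (fun q : R * R * R => g q.1.1 q.1.2 q.2).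
Hypothesis g0 : forall t a b, (0 <= g t a b)%E.
Hypothesis g_superlinear : forall T N, 0 < T -> 0 < N ->
  exists2 r, 0 <= r & forall t a b, 0 <= t <= T -> 0 <= b ->
    ((N * (`|a| + b) - r)%:E <= g t a b)%E.
Variable A : set (R * R).
Hypothesis A_sub : A `<=` control_values.
Implicit Types (a b s t u k : R).

(** Lower semicontinuity in time, uniform over a compact set of controls.
    Truncation at N accounts for the points where the cost is infinite. *)
Lemma running_cost_lsc_uniform t L N d : 0 < d -> exists2 r, 0 < r &
  forall s a b y, `|s - t| <= r -> `|a| <= L -> 0 <= b <= L -> y <= N ->
    (y%:E <= g t a b)%E -> ((y - d)%:E <= g s a b)%E.
Proof.
move=> d0.
pose K : set (R * R) := `[- L, L] `*` `[0, L].
have cK : compact K by apply: compact_setX; exact: segment_compact.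
pose P (s : R) (q : R * R) := forall y : R, y <= N -> (y%:E <= g t q.1 q.2)%E ->
  ((y - d)%:E <= g s q.1 q.2)%E.
have : \forall s \near t, K `<=` P s.
  apply: ((compact_near_coveringP K).1 cK R (nbhs t) P _) => -[a0 b0] _.
  have lsc (z : R) : (z%:E < g t a0 b0)%E ->
    nbhs (t, a0, b0) [set q : R * R * R | (z%:E < g q.1.1 q.1.2 q.2)%E].
    move=> h; have hO : nbhs (g t a0 b0) [set y | z%:E < y]%E.
      by apply: open_nbhs_nbhs; split => //; exact: open_ereal_gt_ereal.
    exact: (@gc (t, a0, b0) _ hO).
  have usc (z : R) : (g t a0 b0 < z%:E)%E ->
    nbhs (t, a0, b0) [set q : R * R * R | (g q.1.1 q.1.2 q.2 < z%:E)%E].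
    move=> h; have hO : nbhs (g t a0 b0) [set y | y < z%:E]%E.
      by apply: open_nbhs_nbhs; split => //; exact: open_ereal_lt_ereal.
    exact: (@gc (t, a0, b0) _ hO).
  have main B : nbhs (t, a0, b0) B ->
      (forall s q, B (s, q.1, q.2) -> B (t, q.1, q.2) -> P s q) ->
      \forall x' \near (a0, b0) & i \near t, P i x'.
    move=> /nbhs_ballP[r /= r0 hB] hP.
    exists (ball (a0, b0) r, ball t r) => /=.
      by split; apply: nbhsx_ballx.
    move=> [[a b] s] /= [[ha hb] hs]; apply: hP; apply: hB; split => //;
      split => //.
    exact: ballxx.
  have := g0 t a0 b0; move: (lsc) (usc); case E : (g t a0 b0) => [G0| |] // lsc'
    usc' _.
    have n1 := lsc' (G0 - d / 2)
      (ltac:(by rewrite lte_fin ltrBlDr ltrDl divr_gt0)).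
    have n2 := usc' (G0 + d / 2) (ltac:(by rewrite lte_fin ltrDl divr_gt0)).
    apply: (main _ (filterI n1 n2)) => s q [/= h1 h2] [/= h3 h4] y yN hy.
    have := le_lt_trans hy h4; rewrite lte_fin => hy'.
    apply: le_trans (ltW h1); rewrite lee_fin; lra.
  have n1 := lsc' N (ltry _).
  apply: (main _ n1) => s q /= h1 _ y yN _.
  apply: le_trans (ltW h1); rewrite lee_fin; lra.
move=> /nbhs_ballP[r /= r0 hr]; exists (r / 2); first by rewrite divr_gt0.
move=> s a b y st aL bL yN hy; apply: (hr s _ (a, b)) => //.
  by rewrite -ball_normE/= distrC; lra.
by split; rewrite /= in_itv//= -ler_norml.
Qed.

(** Superlinear growth takes care of the large controls, and
    [running_cost_lsc_uniform] of the others; half of the gap is given up. *)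
Lemma local_gap t al be ka d : 0 <= t -> 0 < d ->
  (forall ab, A ab ->
    ((ab.1 * al + ab.2 * be + ka + 2 * d)%:E <= g t ab.1 ab.2)%E) ->
  exists2 r, 0 < r & forall s al' be' ka' ab, 0 <= s -> `|s - t| <= r ->
    `|al' - al| <= r -> `|be' - be| <= r -> `|ka' - ka| <= r -> A ab ->
    ((ab.1 * al' + ab.2 * be' + ka' + d)%:E <= g s ab.1 ab.2)%E.
Proof.
move=> t0 d0 hA.
pose B := `|al| + `|be| + `|ka| + 1.
have B0 : 0 < B by rewrite ltr_wpDl// !addr_ge0.
have T0 : 0 < t + 1 by rewrite ltr_wpDl.
have B10 : 0 < B + 1 by rewrite addr_gt0.
have [r r0 hr] := g_superlinear T0 B10.
(* If |a| + b > L then (B + 1) (|a| + b) - r is at least B (|a| + b) + B + d. *)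
pose L := r + B + d.
have L0 : 0 < L by rewrite /L; lra.
have d20 : 0 < d / 2 by rewrite divr_gt0.
have [r1 r10 h1] := running_cost_lsc_uniform t L (B * (L + L) + B + 2 * d) d20.
pose r2 := d / (2 * (2 * L + 1)).
have r20 : 0 < r2 by rewrite divr_gt0// mulr_gt0//; lra.
have r2E : r2 * L + r2 * L + r2 = d / 2.
  by rewrite /r2; field; apply: lt0r_neq0; lra.
exists (Num.min (Num.min 1 r1) r2); first by rewrite !lt_min ltr01 r10.
move=> s al' be' ka' [a b] s0; rewrite !le_min /=.
move=> /andP[/andP[s1 s2] _] /andP[/andP[a1 _] a2] /andP[/andP[b1 _] b2]
  /andP[/andP[k1 _] k2] Aab.
have b_ge0 : 0 <= b by exact: A_sub Aab.
have alB : `|al'| <= B.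
  have -> : al' = al + (al' - al) by rewrite addrC subrK.
  rewrite (le_trans (ler_normD _ _))// /B.
  by move: (normr_ge0 be) (normr_ge0 ka) a1; lra_from_goal.
have beB : `|be'| <= B.
  have -> : be' = be + (be' - be) by rewrite addrC subrK.
  rewrite (le_trans (ler_normD _ _))// /B.
  by move: (normr_ge0 al) (normr_ge0 ka) b1; lra_from_goal.
have kaB : `|ka'| <= B.
  have -> : ka' = ka + (ka' - ka) by rewrite addrC subrK.
  rewrite (le_trans (ler_normD _ _))// /B.
  by move: (normr_ge0 al) (normr_ge0 be) k1; lra_from_goal.
have [big|small] := leP L (`|a| + b).
  have sT : 0 <= s <= t + 1.
    by rewrite s0; move: s1; rewrite ler_norml; lra_from_goal.
  apply: le_trans (hr s a b sT b_ge0); rewrite lee_fin.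
  have e1 : a * al' <= `|a| * B.
    by rewrite (le_trans (ler_norm _))// normrM ler_wpM2l.
  have e2 : b * be' <= b * B.
    by rewrite ler_wpM2l// (le_trans (ler_norm _)).
  have e3 := le_trans (ler_norm _) kaB.
  by move: e1 e2 e3 big; rewrite /L; lra_from_goal.
have aL : `|a| <= L by move: small b_ge0; lra_from_goal.
have bL : 0 <= b <= L.
  by rewrite b_ge0; move: small (normr_ge0 a); lra_from_goal.
have := hA _ Aab; rewrite /=; set y := _ + 2 * d => hy.
have yN : y <= B * (L + L) + B + 2 * d.
  have e1 : a * al <= L * B.
    rewrite (le_trans (ler_norm _))// normrM ler_pM// /B.
    by move: (normr_ge0 be) (normr_ge0 ka); lra_from_goal.
  have e2 : b * be <= L * B.
    rewrite (le_trans (ler_norm _))// normrM ler_pM//.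
      by rewrite ger0_norm//; case/andP: bL.
    by rewrite /B; move: (normr_ge0 al) (normr_ge0 ka); lra_from_goal.
  have e3 : ka <= B.
    rewrite (le_trans (ler_norm _))// /B.
    by move: (normr_ge0 al) (normr_ge0 be); lra_from_goal.
  by rewrite /y; move: e1 e2 e3; lra_from_goal.
apply: le_trans (h1 s a b y s2 aL bL yN hy); rewrite lee_fin /y.
have e1 : a * (al' - al) <= r2 * L.
  by rewrite (le_trans (ler_norm _))// normrM mulrC ler_pM.
have e2 : b * (be' - be) <= r2 * L.
  rewrite (le_trans (ler_norm _))// normrM mulrC ler_pM// ger0_norm//.
  by case/andP: bL.
have e3 : ka' - ka <= r2 by rewrite (le_trans (ler_norm _)).
by move: e1 e2 e3 r2E; lra_from_goal.
Qed.

End gap.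

(** * The Hamiltonian as a supremum of affine expressions *)

Section coefficients.
Context {R : realType}.
Variables (c eta : R -> R).
Hypotheses (cc : continuous c) (ce : continuous eta).
Implicit Types (phi : R * R * R -> R) (q z xi : R * R * R).

Lemma norm3_le (z : R * R * R) e : (`|z| <= e) = (`|z.1| <= e) && (`|z.2| <= e).
Proof. by case: z => x y; rewrite {1}/Num.norm/= ge_max. Qed.

Lemma norm3_lt (z : R * R * R) e : (`|z| < e) = (`|z.1| < e) && (`|z.2| < e).
Proof. by case: z => x y; rewrite {1}/Num.norm/= gt_max. Qed.

(** The expression f . grad phi + phi_t is affine in the control, with
    coefficients [coef_a], [coef_b] and constant term [coef_0]. The drift is
    taken at z and the derivatives of phi at xi, as required by
    [path_increment]. *)
Definition coef_a phi z xi : R :=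
  - (z.1.1 + eta z.2) * 'D_(1, 0, 0) phi xi - 2 * z.1.2 * 'D_(0, 1, 0) phi xi.
Definition coef_b phi z xi : R :=
  - (z.1.1 + eta z.2) * z.1.2 * 'D_(1, 0, 0) phi xi - z.1.2 ^+ 2 * 'D_(0, 1, 0)
      phi xi.
Definition coef_0 phi z xi : R :=
  c z.2 ^+ 2 * 'D_(0, 1, 0) phi xi + 'D_(0, 0, 1) phi xi.

Lemma near_diagonal (f : R * R * R -> R * R * R -> R) q e : 0 < e ->
  (fun p => f p.1 p.2) @ nbhs (q, q) --> f q q ->
  exists2 r, 0 < r & forall z xi, `|z - q| <= r -> `|xi - q| <= r ->
    `|f z xi - f q q| <= e.
Proof.
move=> e0 fq.
have hn : nbhs (q, q) [set p | `|f q q - f p.1 p.2| <= e].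
  exact: ((cvgrPdist_le _ _).1 fq _ e0).
have [r /= r0 hr] := (nbhs_ballP _ _).1 hn.
exists (r / 2); first by rewrite divr_gt0.
have r2 : r / 2 < r by rewrite ltr_pdivrMr// ltr_pMr// ltr1n.
move=> z xi zq xiq; rewrite distrC; apply: (hr (z, xi)); split.
  by rewrite -ball_normE/= distrC (le_lt_trans zq).
by rewrite -ball_normE/= distrC (le_lt_trans xiq).
Qed.

Lemma coefs_near O phi q e : C1_on O phi -> O q -> 0 < e ->
  exists2 r, 0 < r & forall z xi, `|z - q| <= r -> `|xi - q| <= r ->
    [/\ `|coef_a phi z xi - coef_a phi q q| <= e,
        `|coef_b phi z xi - coef_b phi q q| <= e &
        `|coef_0 phi z xi - coef_0 phi q q| <= e].
Proof.
move=> C1 Oq e0; have [_ dc] := C1 q Oq.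
have cx1 : (fun p : R * R * R * (R * R * R) => p.1.1.1) @ nbhs (q, q) --> q.1.1.
  by apply/cvgrPdist_lt => r r0; apply/nbhs_ballP;
    exists r => // p [[[h _] _] _].
have cx2 : (fun p : R * R * R * (R * R * R) => p.1.1.2) @ nbhs (q, q) --> q.1.2.
  by apply/cvgrPdist_lt => r r0; apply/nbhs_ballP;
    exists r => // p [[[_ h] _] _].
have ct : (fun p : R * R * R * (R * R * R) => p.1.2) @ nbhs (q, q) --> q.2.
  by apply/cvgrPdist_lt => r r0; apply/nbhs_ballP; exists r => // p [[_ h] _].
have cet : (fun p : R * R * R * (R * R * R) => eta p.1.2) @ nbhs (q, q) -->
  eta q.2.
  exact: (cvg_comp _ _ ct (@ce _)).
have cct : (fun p : R * R * R * (R * R * R) => c p.1.2) @ nbhs (q, q) --> c q.2.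
  exact: (cvg_comp _ _ ct (@cc _)).
have cd v : (fun p : R * R * R * (R * R * R) => 'D_v phi p.2) @ nbhs (q, q) -->
  'D_v phi q.
  have csnd : (fun p : R * R * R * (R * R * R) => p.2) @ nbhs (q, q) --> nbhs q.
    exact: cvg_snd.
  exact: (cvg_comp _ _ csnd (dc v)).
have cxe := cvgN (cvgD cx1 cet).
have c2 : (fun _ : R * R * R * (R * R * R) => 2 : R) @ nbhs (q, q) --> (2 : R).
  exact: cvg_cst.
have ca : (fun p => coef_a phi p.1 p.2) @ nbhs (q, q) --> coef_a phi q q.
  apply: cvgB; first by apply: cvgM; [exact: cxe|exact: cd].
  by apply: cvgM; [apply: cvgM; [exact: c2|exact: cx2]|exact: cd].
have cb : (fun p => coef_b phi p.1 p.2) @ nbhs (q, q) --> coef_b phi q q.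
  apply: cvgB; first by apply: cvgM;
    [apply: cvgM; [exact: cxe|exact: cx2]|exact: cd].
  by apply: cvgM; [apply: cvgM; exact: cx2|exact: cd].
have c0 : (fun p => coef_0 phi p.1 p.2) @ nbhs (q, q) --> coef_0 phi q q.
  by apply: cvgD; [apply: cvgM; [apply: cvgM; exact: cct|exact: cd]|exact: cd].
have [r1 r10 h1] := near_diagonal (f := coef_a phi) e0 ca.
have [r2 r20 h2] := near_diagonal (f := coef_b phi) e0 cb.
have [r3 r30 h3] := near_diagonal (f := coef_0 phi) e0 c0.
exists (Num.min (Num.min r1 r2) r3); first by rewrite !lt_min r10 r20.
move=> z xi; rewrite !le_min => /andP[/andP[z1 z2] z3] /andP[/andP[x1 x2] x3].
by split; [exact: h1|exact: h2|exact: h3].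
Qed.

Lemma hamiltonian_term phi q (ab : R * R) : 0 < q.1.2 ->
  (drift c eta q.1 q.2 ab).1 * (space_gradient phi q).1 +
  (drift c eta q.1 q.2 ab).2 * (space_gradient phi q).2 +
  time_derivative phi q =
  ab.1 * coef_a phi q q + ab.2 * coef_b phi q q + coef_0 phi q q.
Proof.
move=> x0; rewrite driftE/= max_l ?ltW// /space_gradient /time_derivative.
rewrite /coef_a /coef_b /coef_0.
move: ('D_(1, 0, 0) phi q) ('D_(0, 1, 0) phi q) ('D_(0, 0, 1) phi q) =>
  d1 d2 d3.
by move: (eta q.2) (c q.2) q.1.1 q.1.2 ab.1 ab.2 => *; ring.
Qed.

(** By [C1_increment] the increment of phi along a path is a combination, with
    coefficients that are constant in time, of the increments of w1, w2 and
    time, each of which is an integral over [s, t]. *)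
Lemma path_increment phi s t ab w O q r :
  tame_control s t ab -> halfplane_path c eta s t ab w -> s <= t ->
  C1_on O phi -> ball (w t, t) r `<=` O -> `|(w s, s) - (w t, t)| < r ->
  q = (w t, t) -> exists2 xi, `|xi - q| <= `|(w s, s) - (w t, t)| &
    tame s t (fun u => (ab u).1 * coef_a phi (w u, u) xi +
      (ab u).2 * coef_b phi (w u, u) xi + coef_0 phi (w u, u) xi) /\
    phi (w t, t) - phi (w s, s) = \int[lebesgue_measure]_(u in `[s, t])
      ((ab u).1 * coef_a phi (w u, u) xi +
       (ab u).2 * coef_b phi (w u, u) xi + coef_0 phi (w u, u) xi).
Proof.
move=> tab [p1 p2 wp] st C1 bO yr ->.
have [xi hxi E] := C1_increment C1 bO yr; exists xi => //.
set d1 := 'D_(1, 0, 0) phi xi in E; set d2 := 'D_(0, 1, 0) phi xi in E.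
set d3 := 'D_(0, 0, 1) phi xi in E.
have pF := primitiveD (primitiveD (primitiveZ d1 p1) (primitiveZ d2 p2))
  (primitiveZ d3 (primitive_id s t)).
have {}pF : primitive s t (fun u => d1 * (w u).1 + d2 * (w u).2 + d3 * u)
   (fun u => (ab u).1 * coef_a phi (w u, u) xi +
      (ab u).2 * coef_b phi (w u, u) xi + coef_0 phi (w u, u) xi).
  apply: primitive_eq pF => // u _; rewrite /coef_a /coef_b /coef_0 /= -/d1 -/d2
    -/d3.
  move: (d1) (d2) (d3) (eta u) (c u) (w u).1 (w u).2 (ab u).1 (ab u).2 => *;
    ring.
have [tf Ff] := pF; split=> //.
rewrite E -Ff//=; move: (d1) (d2) (d3) => *; ring.
Qed.

End coefficients.

(** * The supersolution property *)

Lemma gap_arith (R : realFieldType) (X D h G : R) :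
  X - G <= h -> X + D + 2 * ((- D - h) / 2) <= G.
Proof. by lra. Qed.

(** The contradiction in [supersolution] (and, with the opposite inequalities,
    in [subsolution_pos]): V and P are the values of v and phi at the end of a
    short time interval, the primed letters those at its beginning, C is the
    running cost in between and I the increment of phi. *)
Lemma descent_arith (R : realFieldType) (V V' P P' k C I dl : R) :
  V - P <= V' - P' -> V' <= k - C -> k < V + dl / 2 -> P - P' = I ->
    I + dl <= C -> 0 < dl -> False.
Proof. by lra. Qed.

Section viscosity.
Context {R : realType}.
Variables (c eta : R -> R) (g : R -> R -> R -> \bar R) (v0 : R * R -> \bar R).
Variable A : set (R * R).
Hypotheses (cc : continuous c) (ce : continuous eta).
Hypothesis gc : continuous (fun q : R * R * R => g q.1.1 q.1.2 q.2).
Hypothesis g0 : forall t a b, (0 <= g t a b)%E.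
Hypothesis g_superlinear : forall T N, 0 < T -> 0 < N ->
  exists2 r, 0 <= r & forall t a b, 0 <= t <= T -> 0 <= b ->
    ((N * (`|a| + b) - r)%:E <= g t a b)%E.
Variable m : R.
Hypothesis v0_lb : forall x, (m%:E <= v0 x)%E.
Hypothesis v0_coercive : coercive_initial_cost v0.
Hypothesis v0_out : forall x, ~ halfplane x -> v0 x = +oo%E.
Hypothesis A_sub : A `<=` control_values.
Implicit Types (a b s t u k : R) (ab w : R -> R * R) (x : R * R).
Notation mu := (@lebesgue_measure R).
Local Notation path_cost := (path_cost g).
Hypothesis v0_fin : forall x, halfplane x -> v0 x \is a fin_num.
Hypothesis v0_lip : locally_lipschitz halfplane (fine \o v0).
Hypothesis g_fin : forall t a b, 0 < b -> (g t a b < +oo)%E.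
Local Notation attains := (attains c eta g v0 A).
Local Notation value := (value c eta g v0 A).
Local Notation hamiltonian := (hamiltonian c eta g A).

Lemma value_fin x t : (value (x, t) < +oo)%E -> value (x, t) \is a fin_num.
Proof.
have := value_lb c eta A g0 v0_lb x t.
by case: (value (x, t)) => //.
Qed.

(** If the inequality fails, then f . grad phi + phi_t + 2 d <= gamma at (x, t)
    for every control in A. On a short interval before t a nearly optimal path
    stays close to x, so that its running cost exceeds the increment of phi by d
    times the length of the interval, by [local_gap] and [path_increment]. Then
    v - phi would be smaller at the beginning of the interval than at (x, t), by
    [attains_restrict]. *)
Lemma supersolution O phi x t : open O -> O `<=` cylinder ->
  (forall q, O q -> (value q < +oo)%E) -> C1_on O phi -> O (x, t) ->
  local_min (fun y => fine (value y) - phi y) (x, t) ->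
  (0 <= (time_derivative phi (x, t))%:E + hamiltonian x t
    (space_gradient phi (x, t)))%E.
Proof.
move=> oO Ocyl Ofin C1 Oq lm; have [x0 /= t0] := Ocyl _ Oq.
set q := (x, t) in lm Oq *.
rewrite leNgt; apply/negP => neg.
have [h hH hphi] : exists2 h : R, (hamiltonian x t (space_gradient phi q) <=
  h%:E)%E &
    h < - time_derivative phi q.
  case E : (hamiltonian x t (space_gradient phi q)) neg => [h| |] //= neg.
    by exists h => //; move: neg; rewrite -EFinD lte_fin; lra.
  by exists (- time_derivative phi q - 1); [rewrite leNye|lra].
pose d := (- time_derivative phi q - h) / 2.
have d0 : 0 < d by rewrite divr_gt0// subr_gt0.
have hA (ab : R * R) : A ab ->
  ((ab.1 * coef_a eta phi q q + ab.2 * coef_b eta phi q q +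
    coef_0 c phi q q + 2 * d)%:E <= g t ab.1 ab.2)%E.
  move=> Aab; rewrite -hamiltonian_term//.
  have := le_trans (ereal_sup_ubound (ex_intro2 _ _ ab Aab erefl)) hH.
  rewrite /q /d/=; case: (g t ab.1 ab.2) (g0 t ab.1 ab.2) => [G _| |] //=.
    by rewrite -EFinB !lee_fin => ?; exact: gap_arith.
  by move=> _ _; exact: leey.
have [r1 r10 hg] := local_gap gc g0 g_superlinear A_sub (ltW t0) d0 hA.
have [r2 r20 hc] := coefs_near cc ce C1 Oq r10.
have [r3 /= r30 hlm] := (nbhs_ballP _ _).1 lm.
have [r4 /= r40 hO] := (nbhs_ballP _ _).1 (open_nbhs_nbhs (conj oO Oq)).
have Vfin := value_fin (Ofin _ Oq).
pose V := fine (value q).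
pose e := Num.min (Num.min r1 r2) (Num.min (r3 / 2) (r4 / 2)).
have e0 : 0 < e by rewrite !lt_min r10 r20 !divr_gt0.
have er1 : e <= r1 by rewrite /e !ge_min lexx.
have er2 : e <= r2 by rewrite /e !ge_min lexx !orbT.
have er3 : e < r3.
  apply: (@le_lt_trans _ _ (r3 / 2)); first by rewrite /e !ge_min lexx !orbT.
  by rewrite ltr_pdivrMr// ltr_pMr// ltr1n.
have er4 : e < r4.
  apply: (@le_lt_trans _ _ (r4 / 2)); first by rewrite /e !ge_min lexx !orbT.
  by rewrite ltr_pdivrMr// ltr_pMr// ltr1n.
clearbody e.
have [h0 h00 hmod] := path_modulus cc ce gc g0 g_superlinear v0_lb v0_coercive
  A_sub
  (V + d) t0 e0.
pose l := Num.min (Num.min h0 e) (Num.min t 1).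
have l0 : 0 < l by rewrite !lt_min h00 e0 t0 ltr01.
have lh0 : l <= h0 by rewrite /l !ge_min lexx.
have le_ : l <= e by rewrite /l !ge_min lexx ?orbT.
have lt_ : l <= t by rewrite /l !ge_min lexx ?orbT.
have l1 : l <= 1 by rewrite /l !ge_min lexx ?orbT.
pose s := t - l.
have s0 : 0 <= s by rewrite subr_ge0.
have st : s <= t by rewrite gerBl ltW.
have tsl : t - s = l by rewrite /s subKr.
have dl0 : 0 < d * l by rewrite mulr_gt0.
have dl1 : d * l <= d by rewrite ler_piMr// ltW.
have [k kV [ab [w [cab pw wt hk]]]] : exists2 k, k < V + d * l / 2 & attains x t
  k.
  apply: (attains_value cc ce g0 v0_out v0_lb (ltW t0)).
  by rewrite -(fineK Vfin) lte_fin ltrDl divr_gt0.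
have hk' : (path_cost ab 0%R t + v0 (w 0%R) <= (V + d)%:E)%E.
  rewrite (le_trans hk)// lee_fin (le_trans (ltW kV))// lerD2l.
  by rewrite ler_pdivrMr// (le_trans dl1)// ler_peMr ?ler1n// ltW.
have [C hC [C0 hk2]] := attains_restrict gc g0 v0_lb s0 st cab pw hk.
have near_t u : s <= u <= t -> `|(w u, u) - q| <= e.
  move=> /andP[su ut]; rewrite norm3_le /=; apply/andP; split.
    rewrite distrC -wt; apply: (hmod t ab w u t) => //; first exact: ltW.
      exact: le_trans su.
    by apply: le_trans lh0; rewrite -tsl lerD2l lerN2.
  rewrite distrC ger0_norm ?subr_ge0//; apply: le_trans le_.
  by rewrite -tsl lerD2l lerN2.
have ss : s <= s <= t by rewrite lexx.
have hys : `|(w s, s) - (w t, t)| <= e by rewrite wt near_t.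
have as_ : attains (w s) s (k - C).
  by exists ab, w; split => //; exact: halfplane_path_sub (lexx 0) st pw.
have Vs := value_le_attains cc ce s0 as_.
have Vs_fin : value (w s, s) \is a fin_num.
  by apply: value_fin; rewrite (le_lt_trans Vs)// ltry.
have := hlm (w s, s); rewrite -ball_normE/= => /(_ _).
have hball : `|q - (w s, s)| < r3 by rewrite distrC (le_lt_trans (near_t s ss)).
move=> /(_ hball); rewrite -/V => hmin.
have {}Vs : fine (value (w s, s)) <= k - C by rewrite -lee_fin fineK.
have tab := controls_tame t s0 cab.
have tq : q = (w t, t) by rewrite wt.
have [xi hxi [tf hphi2]] := @path_increment _ c eta phi s t ab w O q r4 tab
  (halfplane_path_sub s0 (lexx t) pw) st C1 (ltac:(by rewrite wt))
    (le_lt_trans hys er4) tq.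
have hxe := le_trans hxi hys.
have hcost : ((\int[mu]_(u in `[s, t]) (((ab u).1 * coef_a eta phi (w u, u) xi +
   (ab u).2 * coef_b eta phi (w u, u) xi + coef_0 c phi (w u, u) xi) + d))%:E
   <= path_cost ab s t)%E.
  apply: (le_path_cost gc g0 tab).
    by apply: tameD => //; exact: tame_cst.
  move=> u ust; have nu := near_t u ust.
  have [k1 k2 k3] := hc (w u, u) xi (le_trans nu er2) (le_trans hxe er2).
  have /andP[su ut] := ust.
  have u0 := le_trans s0 su.
  apply: hg => //; last by have [_ _ /(_ u u0)] := cab.
  by move: nu; rewrite norm3_le/= => /andP[_ nu]; exact: le_trans er1.
move: hcost; rewrite hC lee_fin (@rintD _ s t)//; last exact: tame_cst.
rewrite rint_cst// tsl => hcost.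
move: hphi2; rewrite wt -/q => hphi2.
exact: (descent_arith hmin Vs kV hphi2 hcost dl0).
Qed.

End viscosity.

(** * The subsolution property *)

Lemma subsolution_arith (R : realFieldType)
    (a' a b al al' be be' ka ka' e d : R) :
  0 <= b -> 0 <= e -> e <= 1 -> e * (`|a| + 1 + `|al| + b + 1) <= d ->
  `|a' - a| <= e -> `|al' - al| <= e -> `|be' - be| <= e -> `|ka' - ka| <= e ->
  a * al + b * be + ka - d <= a' * al' + b * be' + ka'.
Proof.
move=> b0 e0 e1 ed ha hal hbe hka.
have a'1 : `|a'| <= `|a| + 1.
  have -> : a' = a + (a' - a) by rewrite addrC subrK.
  by rewrite (le_trans (ler_normD _ _))// lerD2l (le_trans ha).
have h1 : `|a' * (al' - al)| <= (`|a| + 1) * e by rewrite normrM ler_pM.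
have h2 : `|(a' - a) * al| <= e * `|al| by rewrite normrM ler_pM.
have h3 : `|b * (be' - be)| <= b * e by rewrite normrM ger0_norm// ler_wpM2l.
have E : a' * al' + b * be' + ka' = a * al + b * be + ka +
  (a' * (al' - al) + (a' - a) * al + b * (be' - be) + (ka' - ka)) by ring.
move: h1 h2 h3 hka; rewrite E !ler_norml => /andP[h1 _] /andP[h2 _] /andP[h3 _]
  /andP[h4 _].
move: h1 h2 h3 h4 ed; clear; lra.
Qed.

Lemma ascent_arith (R : realFieldType) (V V' P P' k C I dl : R) :
  V' - P' <= V - P -> V <= k + C -> k < V' + dl / 2 -> P - P' = I ->
    C = I - dl -> 0 < dl -> False.
Proof. by move=> *; lra. Qed.

Section subsolution.
Context {R : realType}.
Variables (c eta : R -> R) (g : R -> R -> R -> \bar R) (v0 : R * R -> \bar R).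
Hypotheses (cc : continuous c) (ce : continuous eta).
Hypothesis gc : continuous (fun q : R * R * R => g q.1.1 q.1.2 q.2).
Hypothesis g0 : forall t a b, (0 <= g t a b)%E.
Hypothesis g_fin : forall t a b, 0 < b -> (g t a b < +oo)%E.
Variable m : R.
Hypothesis v0_lb : forall x, (m%:E <= v0 x)%E.
Hypothesis v0_out : forall x, ~ halfplane x -> v0 x = +oo%E.
Hypothesis v0_fin : forall x, halfplane x -> v0 x \is a fin_num.
Implicit Types (a b s t u k : R) (ab w : R -> R * R) (x : R * R).
Notation mu := (@lebesgue_measure R).
Local Notation path_cost := (path_cost g).
Local Notation attains := (attains c eta g v0 control_values).
Local Notation value := (value c eta g v0 control_values).
Local Notation hamiltonian := (hamiltonian c eta g control_values).

(** Take b = 1 and a constant second coordinate. *)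
Lemma attains_exists x t : 0 < x.2 -> 0 <= t -> exists k, attains x t k.
Proof.
move=> x0 t0.
have pos r : 0 <= r <= t -> 0 < x.2 + (r - t) * 0 by rewrite mulr0 addr0.
have hA r : 0 <= r <= t -> control_values (linear_drift_control c t 0 1 x r, 1).
  by move=> _; rewrite /control_values/=.
have [ab [w [cab pw wt hr]]] := linear_path cc ce t0 pos hA.
have tab := controls_tame t (lexx 0) cab.
have [L L0 hL] := tame_bound tab.1.
have [C C0 hC] := running_cost_bounded gc g0 g_fin t L ltr01.
have hcost : (path_cost ab 0%R t <= (C * (t - 0))%:E)%E.
  rewrite -rint_cst//; apply: (path_cost_le gc g0 tab (tame_cst 0 t C)) => r rt.
  have := hr r rt => -[e _]; rewrite e/=; apply: hC => //.
  by have := hL r rt; rewrite e.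
have w00 : halfplane (w 0) by case: pw => _ _; apply; rewrite lexx.
exists (C * (t - 0) + fine (v0 (w 0))), ab, w; split => //.
by rewrite EFinD fineK ?v0_fin// leeD2r.
Qed.

Lemma value_fin_num x t : 0 < x.2 -> 0 <= t -> value (x, t) \is a fin_num.
Proof.
move=> x0 t0; have [k hk] := attains_exists x0 t0.
have := value_le_attains cc ce t0 hk.
have := value_lb c eta control_values g0 v0_lb x t.
by case: (value (x, t)).
Qed.

Lemma running_cost_usc t a b z : (g t a b < z%:E)%E -> exists2 r, 0 < r &
  forall s a' b', `|s - t| < r -> `|a' - a| < r -> `|b' - b| < r ->
    (g s a' b' < z%:E)%E.
Proof.
move=> h; have hO : nbhs (g t a b) [set y | y < z%:E]%E.
  by apply: open_nbhs_nbhs; split => //; exact: open_ereal_lt_ereal.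
have [r /= r0 hr] := (nbhs_ballP _ _).1 (@gc (t, a, b) _ hO).
exists r => // s a' b' h1 h2 h3; apply: (hr (s, a', b')).
by split; [split|]; rewrite /ball/= distrC.
Qed.

(** If the inequality fails, the cost is finite at (t, a, b) and stays below the
    affine expression nearby. A continuous control that equals (a, b) at time t
    and makes the second coordinate affine leads to x; prolonging nearly optimal
    paths by it on a short interval would make v - phi smaller at (x, t) than
    shortly before, by [attains_extend]. *)
Lemma subsolution_pos O phi x t a b : open O -> O `<=` cylinder ->
  C1_on O phi ->
  O (x, t) -> local_max (fun y => fine (value y) - phi y) (x, t) -> 0 < b ->
  ((a * coef_a eta phi (x, t) (x, t) + b * coef_b eta phi (x, t) (x, t) +
    coef_0 c phi (x, t) (x, t))%:E <= g t a b)%E.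
Proof.
move=> oO Ocyl C1 Oq lm b0; have [x0 /= t0] := Ocyl _ Oq.
set q := (x, t) in lm Oq *.
set al0 := coef_a _ _ _ _; set be0 := coef_b _ _ _ _; set ka0 := coef_0 _ _ _ _.
rewrite leNgt; apply/negP => neg.
set X := _ + ka0 in neg.
have [d d0 hd] : exists2 d : R, 0 < d & (g t a b < (X - 2 * d)%:E)%E.
  have := g0 t a b; case: (g t a b) neg => [G| |] //; rewrite lte_fin => GX _.
  by exists ((X - G) / 3); [rewrite divr_gt0// subr_gt0|rewrite lte_fin; lra].
pose Y := `|a| + 1 + `|al0| + b + 1.
have Y0 : 0 < Y by rewrite addr_gt0// addr_gt0// ltr_wpDl// ltr_wpDl.
pose e := Num.min 1 (d / Y).
have e0 : 0 < e by rewrite lt_min ltr01 divr_gt0.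
have e1 : e <= 1 by rewrite /e ge_min lexx.
have eY : e * Y <= d by rewrite -ler_pdivlMr// /e ge_min lexx orbT.
clearbody e.
have [r1 r10 hg] := running_cost_usc hd.
have [r2 r20 hc] := coefs_near cc ce C1 Oq e0.
have [r3 /= r30 hlm] := (nbhs_ballP _ _).1 lm.
have [r4 /= r40 hO] := (nbhs_ballP _ _).1 (open_nbhs_nbhs (conj oO Oq)).
(* With this slope, [linear_drift_control] takes the value a at time t. *)
pose mm := - b * x.2 ^+ 2 - 2 * a * x.2 + c t ^+ 2.
have al_t : linear_drift_control c t mm b x t = a.
  rewrite /linear_drift_control subrr mul0r addr0 /mm; field.
  by rewrite lt0r_neq0.
have al_c : {for t, continuous (linear_drift_control c t mm b x)}.
  apply: linear_drift_control_continuous => //.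
  by rewrite subrr mul0r addr0 lt0r_neq0.
have e10 : 0 < Num.min e (r1 / 2) by rewrite lt_min e0 divr_gt0.
have hn : nbhs t [set r | `|a - linear_drift_control c t mm b x r| <=
  Num.min e (r1 / 2)].
  by rewrite -al_t; exact: ((cvgrPdist_le _ _).1 al_c _ e10).
have [r5 /= r50 hal] := (nbhs_ballP _ _).1 hn.
pose h0 := Num.min t (x.2 / (2 * (`|mm| + 1))).
have m10 : 0 < `|mm| + 1 by rewrite ltr_wpDl.
have h00 : 0 < h0 by rewrite lt_min t0 divr_gt0// mulr_gt0.
have h0t : h0 <= t by rewrite /h0 ge_min lexx.
have h0m : h0 * (2 * (`|mm| + 1)) <= x.2.
  by rewrite -ler_pdivlMr ?mulr_gt0// /h0 ge_min lexx orbT.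
clearbody h0.
pose s0 := t - h0.
have s00 : 0 <= s0 by rewrite subr_ge0.
have s0t : s0 <= t by rewrite gerBl ltW.
have pos r : s0 <= r <= t -> 0 < x.2 + (r - t) * mm.
  move=> /andP[sr rt].
  have h1 : `|(r - t) * mm| <= h0 * (`|mm| + 1).
    rewrite normrM ler_pM//; last by rewrite lerDl.
    by rewrite distrC ger0_norm ?subr_ge0// lerBlDr -lerBlDl.
  have h2 : 2 * (h0 * (`|mm| + 1)) <= x.2 by rewrite mulrCA.
  move: h1; rewrite ler_norml => /andP[h1 _].
  rewrite -ltrBlDl sub0r; apply: lt_le_trans h1.
  rewrite ltrN2 -(ltr_pM2l (ltr0n R 2)); apply: le_lt_trans h2 _.
  by rewrite ltr_pMl// ltr1n.
have hA r : s0 <= r <= t ->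
  control_values (linear_drift_control c t mm b x r, b).
  by move=> _; exact: ltW.
have [ab [w [cab pw wt hr]]] := linear_path cc ce s0t pos hA.
have [p1 p2 wp] := pw.
have [L1 L10 hL1] := primitive_lipschitz p1; have [L2 L20 hL2] :=
  primitive_lipschitz p2.
pose L := L1 + L2 + 1.
have L0 : 0 < L by rewrite !addr_gt0.
pose rho := Num.min (Num.min r1 r2) (Num.min (Num.min r3 r4) r5).
have rho0 : 0 < rho by rewrite !lt_min r10 r20 r30 r40.
have rhor1 : rho <= r1 by rewrite /rho !ge_min lexx.
have rhor2 : rho <= r2 by rewrite /rho !ge_min lexx ?orbT.
have rhor3 : rho <= r3 by rewrite /rho !ge_min lexx ?orbT.
have rhor4 : rho <= r4 by rewrite /rho !ge_min lexx ?orbT.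
have rhor5 : rho <= r5 by rewrite /rho !ge_min lexx ?orbT.
clearbody rho.
pose l := Num.min h0 (rho / (2 * L)).
have l0 : 0 < l by rewrite lt_min h00 divr_gt0// mulr_gt0.
have lh0 : l <= h0 by rewrite /l ge_min lexx.
have lL : 2 * (L * l) <= rho.
  by rewrite mulrA mulrC -ler_pdivlMr ?mulr_gt0// /l ge_min lexx orbT.
clearbody l.
have Ll0 : 0 < L * l by rewrite mulr_gt0.
have Llrho : L * l < rho.
  by apply: lt_le_trans lL; rewrite ltr_pMl// ltr1n.
have llrho : l < rho.
  apply: le_lt_trans Llrho; rewrite ler_peMl ?(ltW l0)//.
  by rewrite /L lerDr addr_ge0// ltW.
pose s := t - l.
have ss0 : s0 <= s by rewrite lerD2l lerN2.
have s_ge0 : 0 <= s by exact: le_trans ss0.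
have st : s <= t by rewrite gerBl ltW.
have tsl : t - s = l by rewrite /s subKr.
have pws := halfplane_path_sub ss0 (lexx t) pw.
have near_t u : s <= u <= t -> `|(w u, u) - q| < rho.
  move=> /andP[su ut]; rewrite norm3_lt /=.
  have us0 : s0 <= u <= t by rewrite ut (le_trans ss0).
  have ts0 : s0 <= t <= t by rewrite s0t lexx.
  have ul : `|u - t| <= l.
    by rewrite distrC ger0_norm ?subr_ge0// -tsl lerD2l lerN2.
  rewrite (le_lt_trans ul llrho) andbT -wt; apply: le_lt_trans Llrho.
  rewrite norm_pair_le; apply/andP; split.
    apply: le_trans (hL1 _ _ ts0 us0) _; rewrite ler_pM ?(ltW L10)//.
    by rewrite /L -addrA lerDl addr_ge0// ltW.
  apply: le_trans (hL2 _ _ ts0 us0) _; rewrite ler_pM ?(ltW L20)//.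
  by rewrite /L addrAC lerDr addr_ge0// ltW.
have ss : s <= s <= t by rewrite lexx.
have hys : `|(w s, s) - (w t, t)| < rho by rewrite wt near_t.
have tab := controls_tame t s_ge0 cab.
have tq : q = (w t, t) by rewrite wt.
have [xi hxi [tf hphi2]] := @path_increment _ c eta phi s t ab w O q r4 tab
  pws st C1 (ltac:(by rewrite wt)) (lt_le_trans hys rhor4) tq.
have hxe := le_trans hxi (ltW hys).
set I := (X in _ = X) in hphi2.
have hcost : (path_cost ab s t <= (I - d * l)%:E)%E.
  have -> : I - d * l = \int[mu]_(u in `[s, t])
    (((ab u).1 * coef_a eta phi (w u, u) xi +
    (ab u).2 * coef_b eta phi (w u, u) xi + coef_0 c phi (w u, u) xi) + (- d)).
    by rewrite (@rintD _ s t)// ?rint_cst// ?tsl ?mulNr//; exact: tame_cst.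
  apply: (path_cost_le gc g0 tab).
    by apply: tameD => //; exact: tame_cst.
  move=> u ust; have nu := near_t u ust; have /andP[su ut] := ust.
  have us0 : s0 <= u <= t by rewrite ut (le_trans ss0).
  have [k1 k2 k3] := hc (w u, u) xi (le_trans (ltW nu) rhor2)
    (le_trans hxe rhor2).
  have ut_rho : `|u - t| < rho by move: nu; rewrite norm3_lt => /andP[].
  have := hal u; rewrite -ball_normE/= distrC =>
    /(_ (lt_le_trans ut_rho rhor5)).
  have [-> _] := hr u us0; rewrite /=.
  set a' := linear_drift_control _ _ _ _ _ _; rewrite distrC le_min =>
    /andP[a1 a2].
  have a3 : `|a' - a| < r1.
    by rewrite (le_lt_trans a2)// ltr_pdivrMr// ltr_pMr// ltr1n.
  have := hg u a' b (lt_le_trans ut_rho rhor1) a3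
    (ltac:(by rewrite subrr normr0)).
  move=> /ltW /le_trans; apply; rewrite lee_fin.
  have := subsolution_arith (ltW b0) (ltW e0) e1 eY a1 k1 k2 k3.
  rewrite -/al0 -/be0 -/ka0 -/X => h.
  have -> : X - 2 * d = X - d - d by rewrite mulr_natl mulr2n opprD addrA.
  by rewrite lerD2r.
have dl0 : 0 < d * l by rewrite mulr_gt0.
have ws0 : 0 < (w s).2 by apply: wp; rewrite ss0.
have Vs_fin := value_fin_num ws0 s_ge0.
have Vq_fin := value_fin_num x0 (ltW t0).
have [k kV ak] : exists2 k, k < fine (value (w s, s)) + d * l / 2 & attains
  (w s) s k.
  apply: (attains_value cc ce g0 v0_out v0_lb s_ge0).
  by rewrite -[X in (X < _)%E](fineK Vs_fin) lte_fin ltrDl divr_gt0.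
have := attains_extend gc g0 s_ge0 st cab pws hcost ak; rewrite wt.
move=> /(value_le_attains cc ce (ltW t0)).
rewrite -[X in (X <= _)%E](fineK Vq_fin) lee_fin => hV.
have := hlm (w s, s); rewrite -ball_normE/= => /(_ _).
have hball : `|q - (w s, s)| < r3 by rewrite distrC (lt_le_trans (near_t s ss)).
move=> /(_ hball) => hmax.
rewrite wt in hphi2.
exact: (ascent_arith hmax hV kV hphi2 erefl dl0).
Qed.

(** The case b = 0 is the limit of the case b > 0 as b decreases to 0, by upper
    semicontinuity of the cost. *)
Lemma subsolution O phi x t : open O -> O `<=` cylinder -> C1_on O phi ->
  O (x, t) -> local_max (fun y => fine (value y) - phi y) (x, t) ->
  ((time_derivative phi (x, t))%:E + hamiltonian x t (space_gradient phi (x, t))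
    <= 0)%E.
Proof.
move=> oO Ocyl C1 Oq lm; have [x0 /= t0] := Ocyl _ Oq.
have pos a b := @subsolution_pos O phi x t a b oO Ocyl C1 Oq lm.
have all (ab : R * R) : 0 <= ab.2 -> ((ab.1 * coef_a eta phi (x, t) (x, t) +
    ab.2 * coef_b eta phi (x, t) (x, t) + coef_0 c phi (x, t) (x, t))%:E <=
      g t ab.1 ab.2)%E.
  rewrite le_eqVlt => /predU1P[b0|]; last exact: pos.
  rewrite -b0 mul0r addr0; rewrite leNgt; apply/negP.
  move: ab.1 pos => a /(_ a); set be := coef_b _ _ _ _;
    set X := _ + coef_0 _ _ _ _.
  move=> pos neg.
  have [y hy yX] : exists2 y : R, (g t a 0 < y%:E)%E & y < X.
    have := g0 t a 0; case: (g t a 0) neg => [G| |] //; rewrite lte_fin => GX _.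
    by exists ((G + X) / 2); rewrite ?lte_fin; lra.
  have [r r0 hr] := running_cost_usc hy.
  pose b := Num.min (r / 2) ((X - y) / (`|be| + 1)).
  have be0 : 0 < `|be| + 1 by rewrite ltr_wpDl.
  have b0' : 0 < b by rewrite lt_min !divr_gt0// subr_gt0.
  have br : b < r.
    apply: (@le_lt_trans _ _ (r / 2)); first by rewrite /b ge_min lexx.
    by rewrite ltr_pdivrMr// ltr_pMr// ltr1n.
  have bX : b * (`|be| + 1) <= X - y.
    by rewrite -ler_pdivlMr// /b ge_min lexx orbT.
  have := hr t a b; rewrite !subrr !normr0 subr0 (gtr0_norm b0') =>
    /(_ r0 r0 br) hgb.
  have := le_lt_trans (pos b b0') hgb; rewrite lte_fin.
  have hb : - (b * `|be|) <= b * be.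
    by rewrite -mulrN ler_wpM2l ?(ltW b0')// lerNl -normrN ler_norm.
  by rewrite addrAC -/X; move: hb bX b0'; lra.
rewrite addeC -[leRHS](subee (x := (time_derivative phi (x, t))%:E))//.
rewrite [leRHS]addeC leeD2r//; apply: ge_ereal_sup => _ [ab Aab <-].
have := all ab Aab; rewrite -hamiltonian_term//=.
set F := _ + _ * 'D_(0, 1, 0) phi (x, t); set T := time_derivative phi (x, t).
have := g0 t ab.1 ab.2; case: (g t ab.1 ab.2) => [G| |] //=.
  by move=> _; rewrite -EFinB !lee_fin => FT; rewrite lerBlDr [X in _ <= X]addrC
    lerBrDr.
by move=> _ _; rewrite addeNy leNye.
Qed.

End subsolution.

(** * The set of finiteness and its boundary *)

Section regularity.
Context {R : realType}.
Variables (c eta : R -> R) (g : R -> R -> R -> \bar R) (v0 : R * R -> \bar R).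
Variable A : set (R * R).
Hypotheses (cc : continuous c) (ce : continuous eta).
Hypothesis gc : continuous (fun q : R * R * R => g q.1.1 q.1.2 q.2).
Hypothesis g0 : forall t a b, (0 <= g t a b)%E.
Hypothesis g_superlinear : forall T N, 0 < T -> 0 < N ->
  exists2 r, 0 <= r & forall t a b, 0 <= t <= T -> 0 <= b ->
    ((N * (`|a| + b) - r)%:E <= g t a b)%E.
Variable m : R.
Hypothesis v0_lb : forall x, (m%:E <= v0 x)%E.
Hypothesis v0_coercive : coercive_initial_cost v0.
Hypothesis v0_out : forall x, ~ halfplane x -> v0 x = +oo%E.
Hypothesis A_sub : A `<=` control_values.
Implicit Types (a b s t u k : R) (ab w : R -> R * R) (x : R * R).
Notation mu := (@lebesgue_measure R).
Local Notation path_cost := (path_cost g).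
Hypothesis v0_fin : forall x, halfplane x -> v0 x \is a fin_num.
Hypothesis v0_lip : locally_lipschitz halfplane (fine \o v0).
Hypothesis g_fin : forall t a b, 0 < b -> (g t a b < +oo)%E.
Hypothesis A_small : exists2 M, 0 < M & control_values_le M `<=` A.
Local Notation attains := (attains c eta g v0 A).
Local Notation value := (value c eta g v0 A).

(** The derivative of w2 exp(int_0^s (b w2 + 2 a)) is c^2 times an exponential,
    so that this product is nondecreasing; [path_bounds] controls its exponent
    and its initial value. *)
Lemma attains_away_from_boundary T K : 0 < T -> exists2 rho, 0 < rho &
  forall y t, 0 <= t -> t <= T -> attains y t K -> rho <= y.2.
Proof.
move=> T0.
have [C [d [C0 d0 hb]]] :=
  path_bounds cc ce gc g0 g_superlinear v0_lb v0_coercive A_sub K T0.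
exists (d * expR (- ((C + 2) * C))); first by rewrite mulr_gt0// expR_gt0.
move=> y t t0 tT [ab [w [cab pw <- hk]]].
have [hw hI w0d] := hb t ab w t0 tT cab pw hk; have [p1 p2 wp] := pw.
have tab := controls_tame t (lexx 0) cab; have [ta tb] := tab.
have tsz := tame_control_size tab.
have tk : tame 0 t (fun r => (ab r).2 * (w r).2 + 2 * (ab r).1).
  by apply: tameD; apply: tameM => //;
    [exact: primitive_tame p2|exact: tame_cst].
have pF := primitive_expM p2 (primitive_rint tk).
have := primitive_nondecreasing pF (lexx 0) t0 (lexx t) _.
rewrite rint_pt expR0 mulr1; set k := \int[_]_(_ in _) _ => h.
have {}h : (w 0).2 <= (w t).2 * expR k.
  apply: h => u _; rewrite mulr_ge0 ?expR_ge0//.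
  have -> : - (ab u).2 * (w u).2 ^+ 2 - 2 * (ab u).1 * (w u).2 + c u ^+ 2 +
    ((ab u).2 * (w u).2 + 2 * (ab u).1) * (w u).2 = c u ^+ 2 by ring.
  exact: sqr_ge0.
have kC : k <= (C + 2) * C.
  apply: (le_trans (ler_norm _)).
  apply:
    le_trans (_ : (C + 2) * \int[mu]_(r in `[0, t]) (`|(ab r).1| + (ab r).2) <=
    _).
    rewrite -(rintZ _ tsz)//; apply: (@ler_norm_rint _ 0 t) => //.
      by apply: tameM => //; exact: tame_cst.
    move=> u /[dup] ut /andP[u0 _].
    have b0 : 0 <= (ab u).2 by have [_ _ /(_ u u0)/A_sub] := cab.
    have := hw u ut; rewrite norm_pair_le => /andP[_ h2].
    rewrite (le_trans (ler_normD _ _))// !normrM (ger0_norm b0)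
      (@ger0_norm _ 2)//.
    have h3 : (ab u).2 * `|(w u).2| <= C * (ab u).2 by rewrite mulrC ler_wpM2r.
    have h4 : 0 <= C * `|(ab u).1| by rewrite mulr_ge0// ltW.
    by move: h3 h4 b0; lra.
  by rewrite ler_wpM2l// addr_ge0// ltW.
have -> : (w t).2 = (w t).2 * expR k * expR (- k).
  by rewrite -mulrA expRxMexpNx_1 mulr1.
rewrite ler_pM ?expR_ge0//; first exact: ltW.
  exact: le_trans h.
by rewrite ler_expR lerN2.
Qed.

Lemma value_nbhs x t K e : 0 < x.2 -> 0 <= t -> 0 < e -> exists2 rho, 0 < rho &
  forall y1 y2 : R * R * R, 0 <= y1.2 -> 0 <= y2.2 ->
  ball (x, t) rho y1 -> ball (x, t) rho y2 -> forall k, k <= K ->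
  (value y1 < k%:E)%E -> (value y2 < (k + e)%:E)%E.
Proof.
move=> x0 t0 e0.
have [rho rho0 h] := value_nearby cc ce gc g0 g_superlinear v0_lb v0_coercive
  v0_out
  A_sub v0_fin v0_lip g_fin A_small K x0 t0 e0.
exists rho => // -[y1 t1] [y2 t2] /= t10 t20.
rewrite -!ball_normE/= !norm3_lt /= => /andP[h1 h2] /andP[h3 h4] k kK.
by apply: h => //; rewrite distrC ltW.
Qed.

Lemma cylinder_open : open (@cylinder R).
Proof.
rewrite openE => -[x t] [/= x0 t0]; apply/nbhs_ballP.
rewrite /halfplane/= in x0.
exists (Num.min x.2 t); first by rewrite /= lt_min x0.
move=> [y s]; rewrite -ball_normE/= norm3_lt norm_pair_lt /= !lt_min.
move=> /andP[/andP[_ /andP[h1 _]] /andP[_ h2]]; split; rewrite /halfplane/=.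
  by rewrite -subr_gt0 in x0; move: h1; rewrite ltr_norml => /andP[_]; lra.
by move: h2; rewrite ltr_norml => /andP[_]; lra.
Qed.

Lemma finite_set_open : open (finite_set_of value).
Proof.
rewrite openE => -[x t] [[/= x0 t0] vfin].
have [k hk] : exists k : R, (value (x, t) < k%:E)%E.
  case: (value (x, t)) vfin => [r| |] // _.
    by exists (r + 1); rewrite lte_fin ltrDl.
  by exists 0; exact: ltNyr.
have [rho rho0 h] := value_nbhs k x0 (ltW t0) ltr01.
have cylq : nbhs (x, t) (@cylinder R).
  by apply: open_nbhs_nbhs; split => //; exact: cylinder_open.
have ballq : nbhs (x, t) (ball (x, t) rho) by exact: nbhsx_ballx.
apply: filterS (filterI cylq ballq) => y [cy by_]; split => //.
have := h (x, t) y (ltW t0) (ltW cy.2) (ballxx _ rho0) by_ k (lexx k) hk.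
by move=> /lt_le_trans; apply; exact: leey.
Qed.

Lemma value_continuous : {within finite_set_of value, continuous
  (fine \o value)}.
Proof.
apply: continuous_in_subspaceT => -[x t]; rewrite inE => -[[/= x0 t0] vfin].
have fin y : finite_set_of value y -> value y \is a fin_num.
  by case: y => y s [_]; exact: (value_fin g0 v0_lb).
have q_fin : finite_set_of value (x, t) by [].
set V := fine (value (x, t)).
apply/cvgrPdist_lt => e e0; have e20 : 0 < e / 2 by rewrite divr_gt0.
have [rho rho0 h] := value_nbhs (V + 2 * e) x0 (ltW t0) e20.
have nq : nbhs (x, t) (finite_set_of value).
  by apply: open_nbhs_nbhs; split => //; exact: finite_set_open.
have ballq : nbhs (x, t) (ball (x, t) rho) by exact: nbhsx_ballx.
apply: filterS (filterI nq ballq) => y [ny by_] /=; rewrite -/V.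
have vy := fin y ny; have vq := fin _ q_fin.
have cy := ny.1.2.
have h1 : fine (value y) < V + e.
  have := h (x, t) y (ltW t0) (ltW cy) (ballxx _ rho0) by_ (V + e / 2) _ _.
  rewrite -[X in (X < _)%E -> _](fineK vq) -[X in _ -> _ -> (X < _)%E](fineK vy)
    !lte_fin -/V.
  rewrite ltrDl e20 -addrA -splitr; apply => //.
  by rewrite lerD2l; lra.
have h2 : V < fine (value y) + e.
  have := h y (x, t) (ltW cy) (ltW t0) by_ (ballxx _ rho0)
    (fine (value y) + e / 2) _ _.
  rewrite -[X in (X < _)%E -> _](fineK vy) -[X in _ -> _ -> (X < _)%E](fineK vq)
    !lte_fin -/V.
  rewrite ltrDl e20 -addrA -splitr; apply => //.
  by move: h1; move: (fine _) => Vy; lra.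
by move: h1 h2; move: (fine (value y)) => Vy h1 h2; rewrite ltr_norml;
  apply/andP; split; lra.
Qed.

(** There are infinite values arbitrarily near q. If q.1 lies in the half-plane,
    a value less than K near q would bound all values near q, even when q is at
    time 0, by [value_nbhs]. Otherwise the second coordinate of q.1 is 0 and
    [attains_away_from_boundary] applies. *)
Lemma value_boundary q : boundary (cylinder `\` finite_set_of value) q ->
  value y @[y --> within cylinder (nbhs q)] --> +oo%E.
Proof.
case: q => x t [cl _].
have meet r : 0 < r -> exists y : R * R * R,
  [/\ cylinder y, ~ finite_set_of value y & ball (x, t) r y].
  by move=> r0; have [y [[? ?] ?]] := cl _ (nbhsx_ballx (x, t) r r0); exists y.
have x0 : 0 <= x.2.
  rewrite leNgt; apply/negP => x0.
  have [|y [[/= y0 _] _]] := meet (- x.2); first by rewrite oppr_gt0.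
  rewrite -ball_normE/= norm3_lt norm_pair_lt /= => /andP[/andP[_]].
  rewrite ltr_norml => /andP[+ _] _; rewrite /halfplane/= in y0; lra.
have t0 : 0 <= t.
  rewrite leNgt; apply/negP => t0.
  have [|y [[_ /= y0] _]] := meet (- t); first by rewrite oppr_gt0.
  rewrite -ball_normE/= norm3_lt /= => /andP[_].
  rewrite ltr_norml => /andP[+ _]; lra.
apply/cvgeyPge => K; rewrite near_withinE.
have [x0'|x0'] := ltP 0 x.2.
  have [rho rho0 h] := value_nbhs K x0' t0 ltr01.
  have [y2 [c2 n2 b2]] := meet rho rho0.
  have ballq : nbhs (x, t) (ball (x, t) rho) by exact: nbhsx_ballx.
  apply: filterS ballq => y by_ cy; rewrite leNgt; apply/negP => vK.
  apply: n2; split => //.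
  have := h y y2 (ltW cy.2) (ltW c2.2) by_ b2 K (lexx K) vK.
  by move=> /lt_le_trans; apply; exact: leey.
have x00 : x.2 = 0 by apply/le_anti; rewrite x0 x0'.
have T0 : 0 < t + 1 by rewrite ltr_wpDl.
have [rho rho0 h] := attains_away_from_boundary K T0.
have r0 : 0 < Num.min rho 1 by rewrite lt_min rho0 ltr01.
have ballq : nbhs (x, t) (ball (x, t) (Num.min rho 1)) by exact: nbhsx_ballx.
apply: filterS ballq => -[y s]; rewrite -ball_normE/= norm3_lt norm_pair_lt /=
  !lt_min.
move=> /andP[/andP[_ /andP[h1 _]] /andP[_ h2]] [/= y0 s0].
rewrite leNgt; apply/negP => vK.
have [k kK ak] := attains_value cc ce g0 v0_out v0_lb (ltW s0) vK.
have sT : s <= t + 1 by move: h2; rewrite ltr_norml => /andP[+ _]; lra.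
have := h y s (ltW s0) sT (attains_le (ltW kK) ak).
by rewrite /halfplane/= in y0; move: h1; rewrite x00 sub0r normrN (gtr0_norm y0)
  ltNge => /negP.
Qed.

End regularity.

(** * Extension of the data to all times *)

Section extension.
Context {R : realType}.
Implicit Types (c eta : R -> R) (s t : R).

(** Used with r a retraction onto D, to extend data that are given on D. *)
Lemma retract_continuous (S T U : topologicalType) (D : set T) (f : T -> U)
  (r : S -> T) :
  continuous r -> (forall p, D (r p)) -> {within D, continuous f} ->
    continuous (f \o r).
Proof.
move=> cr Dr /subspace_continuousP cf p B /= fB.
have h : nbhs p (fun u => D (r u) -> B (f (r u))) :=
  cr p _ (cf (r p) (Dr p) B fB).
by apply: (filterS _ h) => u; apply; exact: Dr.
Qed.

Lemma max0_continuous : continuous (fun s : R => Num.max s 0).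
Proof.
by move=> s; apply: (@continuous_max _ _ id (fun=> 0));
  [exact: cvg_id|exact: cvg_cst].
Qed.

Lemma holder_continuous eta : locally_holder_below_half eta ->
  continuous (fun s => eta (Num.max s 0)).
Proof.
move=> he t; apply/cvgrPdist_lt => e e0.
(* The exponent 1/4, whence the fourth power in the radius. *)
have th : 0 < (4^-1 : R) < 2^-1 by lra.
have T0 : 0 < Num.max t 0 + 1 by rewrite ltr_wpDl// le_max lexx orbT.
have [C hC] := he _ th _ T0.
pose D := `|C| + 1; have D0 : 0 < D by rewrite ltr_wpDl.
have d0 : 0 < Num.min 1 ((e / D) ^+ 4).
  by rewrite lt_min ltr01 exprn_gt0// divr_gt0.
have ballt : nbhs t (ball t (Num.min 1 ((e / D) ^+ 4))) by exact: nbhsx_ballx.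
apply: filterS ballt => s; rewrite -ball_normE/= lt_min => /andP[h1 h2].
have lip := ler_dist_max0 t s.
have st1 : Num.max s 0 <= Num.max t 0 + 1.
  have := le_lt_trans lip h1; rewrite ltr_norml => /andP[]; lra.
have m0 (u : R) : 0 <= Num.max u 0 by rewrite le_max lexx orbT.
apply: le_lt_trans (hC _ _ _ _) _; rewrite /= ?in_itv/= ?m0//.
  by rewrite /= lerDl.
have eD : e / D = ((e / D) ^+ 4) `^ 4^-1.
  rewrite -powR_mulrn ?divr_ge0 ?(ltW e0) ?(ltW D0)// -powRrM divff ?powRr1
    ?pnatr_eq0//.
  by rewrite divr_ge0 ?(ltW e0) ?(ltW D0).
have h3 : `|Num.max t 0 - Num.max s 0| `^ 4^-1 < e / D.
  rewrite eD; apply: gt0_ltr_powR; rewrite ?nnegrE ?invr_gt0 ?exprn_ge0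
    ?divr_ge0 ?(ltW e0) ?(ltW D0)//.
  exact: le_lt_trans lip h2.
have -> : e = D * (e / D) by rewrite mulrCA divff ?mulr1// lt0r_neq0.
apply: (@le_lt_trans _ _ (D * `|Num.max t 0 - Num.max s 0| `^ 4^-1));
  last by rewrite ltr_pM2l.
by rewrite ler_wpM2r ?powR_ge0// (le_trans (ler_norm _))// lerDl.
Qed.

(** As p > 1, |a|^p + b^p >= |a| + b - 2, and this is at least half of |a| + b
    once |a| + b > 4. *)
Lemma running_cost_superlinear (gamma : R -> R -> R -> \bar R) : running_cost
  gamma ->
  forall T N, 0 < T -> 0 < N -> exists2 r, 0 <= r & forall t a b, 0 <= t <= T ->
    0 <= b -> ((N * (`|a| + b) - r)%:E <= gamma t a b)%E.
Proof.
move=> [g0 _ _ [p p1 hp]] T N T0 N0; have [r hr] := hp T T0 (2 * N).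
have pow_ge (x : R) : 0 <= x -> x - 1 <= x `^ p.
  move=> x0; have [x1|/ltW x1] := leP x 1.
    by apply: le_trans (powR_ge0 _ _); rewrite subr_le0.
  by apply: le_trans (le1r_powR x1 (ltW p1)); rewrite gerBl.
pose L := Num.max r 4.
have L0 : 0 <= L by rewrite le_max ler0n orbT.
exists (N * L); first by rewrite mulr_ge0// ltW.
move=> t a b tT b0; have t0 : 0 <= t by case/andP: tT.
have [small|big] := leP (`|a| + b) L.
  apply: le_trans (g0 t a b t0 b0); rewrite lee_fin subr_le0.
  by rewrite ler_pM2l.
have rb : r < `|a| + b by rewrite (le_lt_trans _ big)// le_max lexx.
have b4 : 4 < `|a| + b by rewrite (le_lt_trans _ big)// le_max lexx orbT.
set S := `|a| `^ p + b `^ p.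
have hS : (`|a| + b) / 2 <= S.
  have := pow_ge `|a| (normr_ge0 a); have := pow_ge b b0; rewrite /S.
  by move: b4; move: (`|a| `^ p) (b `^ p) => u v; lra.
have S0 : 0 < S by apply: lt_le_trans hS; rewrite divr_gt0// (lt_trans _ b4).
have := hr a b b0 rb => /le_trans /(_ (ereal_inf_lbound _)) h.
have {h} : ((2 * N)%:E <= gamma t a b * (S^-1)%:E)%E.
  by apply: h; exists t => //=; rewrite in_itv.
have := g0 t a b t0 b0; case: (gamma t a b) => [G| |] // _;
  last by rewrite leey.
rewrite -EFinM !lee_fin ler_pdivlMr// => h.
rewrite lerBlDr; apply: (@le_trans _ _ G); last by rewrite lerDl mulr_ge0// ltW.
apply: le_trans h; rewrite -mulrA mulrCA ler_pM2l//.
by rewrite mulrC -ler_pdivrMr.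
Qed.

Definition extend_time (f : R -> R) t : R := f (Num.max t 0).

Definition extend_cost (gamma : R -> R -> R -> \bar R) t a b : \bar R :=
  gamma (Num.max t 0) a (Num.max b 0).

Lemma extend_cost_continuous (gamma : R -> R -> R -> \bar R) : running_cost
  gamma ->
  continuous (fun q : R * R * R => extend_cost gamma q.1.1 q.1.2 q.2).
Proof.
move=> [_ gc _ _].
pose ret (q : R * R * R) : R * R * R := (Num.max q.1.1 0, q.1.2, Num.max q.2 0).
have cret : continuous ret.
  move=> q; apply/cvgrPdist_lt => e e0.
  have bq : nbhs q (ball q e) by exact: nbhsx_ballx.
  apply: filterS bq => q' [[/= h1 h2] h3].
  rewrite norm3_lt norm_pair_lt/=; apply/andP; split; [apply/andP; split|].
  - exact: le_lt_trans (ler_dist_max0 _ _) h1.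
  - exact: h2.
  - exact: le_lt_trans (ler_dist_max0 _ _) h3.
apply: (retract_continuous cret _ gc) => q.
by split; rewrite /= le_max lexx orbT.
Qed.

Lemma extend_time_id f t : 0 <= t -> extend_time f t = f t.
Proof. by move=> t0; rewrite /extend_time max_l. Qed.

Lemma extend_cost_id gamma t a b : 0 <= t -> 0 <= b -> extend_cost gamma t a b =
  gamma t a b.
Proof. by move=> t0 b0; rewrite /extend_cost !max_l. Qed.

Lemma drift_extend c eta z t ab : 0 <= t ->
  drift (extend_time c) (extend_time eta) z t ab = drift c eta z t ab.
Proof. by move=> t0; rewrite !driftE !extend_time_id. Qed.

Lemma trajectory_extend c eta x t ab :
  trajectory (extend_time c) (extend_time eta) x t ab = trajectory c eta x t ab.
Proof.
apply/funext => w; rewrite /trajectory; congr (_ /\ _); apply/propext.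
split=> h s st; have [h1 h2] := h s st; move/andP: st => [s0 st].
  by split; rewrite ?h1 ?h2; congr (_ - _); apply: eq_rint => r /andP[sr _];
    rewrite drift_extend// (le_trans s0).
by split; rewrite ?h1 ?h2; congr (_ - _); apply: eq_rint => r /andP[sr _];
  rewrite drift_extend// (le_trans s0).
Qed.

Lemma value_extend c eta gamma v0 (A : set (R * R)) : A `<=` control_values ->
  value (extend_time c) (extend_time eta) (extend_cost gamma) v0 A =
    value c eta gamma v0 A.
Proof.
move=> AC; apply/funext => -[x t]; rewrite /value; congr ereal_inf.
apply: eq_imagel => ab [_ _ hab]; rewrite /total_cost; congr (_ + _)%E.
  apply: eq_integral => s; rewrite inE/= in_itv/= => /andP[s0 _].
  by rewrite extend_cost_id//; exact/AC/hab.
by rewrite /initial_cost trajectory_extend.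
Qed.

Lemma hamiltonian_extend c eta gamma (A : set (R * R)) x t p :
  A `<=` control_values ->
  0 <= t -> hamiltonian (extend_time c) (extend_time eta) (extend_cost gamma) A
    x t p =
  hamiltonian c eta gamma A x t p.
Proof.
move=> AC t0; rewrite /hamiltonian; congr ereal_sup.
apply: eq_imagel => ab Aab; rewrite drift_extend// extend_cost_id//; exact: AC.
Qed.

End extension.

(** * Viscosity properties of the value functions *)

Theorem proposition4p9 (R : realType) (c eta : R -> R)
    (gamma : R -> R -> R -> \bar R) (v0 : R * R -> \bar R)
    (c_continuous : {within `[0, +oo[, continuous c})
    (eta_0 : eta 0 = 0)
    (eta_holder : locally_holder_below_half eta)
    (gammaP : running_cost gamma)
    (v0P : admissible_initial_cost v0) :
  ((forall q, cylinder q ->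
      value c eta gamma v0 control_values q \is a fin_num) /\
   viscosity_solution (hamiltonian c eta gamma control_values) cylinder
     (fine \o value c eta gamma v0 control_values)) /\
  (forall M : R, 0 < M ->
     extended_viscosity_supersolution
       (hamiltonian c eta gamma (control_values_le M))
       (value c eta gamma v0 (control_values_le M))).
Proof.
have [v0_out v0_fin [m v0_lb'] v0_lip v0_coercive] := v0P.
have v0_lb x : (m%:E <= v0 x)%E.
  by have [/v0_lb'//|/v0_out ->] := pselect (halfplane x); rewrite leey.
have cc : continuous (extend_time c).
  apply: (retract_continuous (@max0_continuous R) _ c_continuous) => s.
  by rewrite /= in_itv/= andbT le_max lexx orbT.
have ce : continuous (extend_time eta) by exact: holder_continuous.
have gc := extend_cost_continuous gammaP.
have g0 t a b : (0 <= extend_cost gamma t a b)%E.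
  by have [h _ _ _] := gammaP; apply: h; rewrite le_max lexx orbT.
have g_fin t a b : 0 < b -> (extend_cost gamma t a b < +oo)%E.
  move=> b0; have [_ _ h _] := gammaP; rewrite /extend_cost (max_l (ltW b0)).
  by apply: h => //; rewrite le_max lexx orbT.
have g_sup T N : 0 < T -> 0 < N -> exists2 r, 0 <= r & forall t a b, 0 <= t <=
  T ->
    0 <= b -> ((N * (`|a| + b) - r)%:E <= extend_cost gamma t a b)%E.
  move=> T0 N0; have [r r0 hr] := running_cost_superlinear gammaP T0 N0.
  exists r => // t a b tT b0; rewrite extend_cost_id//; first exact: hr.
  by case/andP: tT.
have leC M : control_values_le M `<=` (@control_values R) by move=> ab [].
have sub1 : @control_values R `<=` control_values by [].
(* Both claims contain the supersolution property, for different sets of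
   controls. *)
have superE (A : set (R * R)) (O : set (R * R * R)) phi q :
  A `<=` control_values ->
    open O -> O `<=` cylinder ->
    (forall q, O q -> (value c eta gamma v0 A q < +oo)%E) -> C1_on O phi ->
      O q ->
    local_min (fun y => fine (value c eta gamma v0 A y) - phi y) q ->
    (0 <= (time_derivative phi q)%:E +
      hamiltonian c eta gamma A q.1 q.2 (space_gradient phi q))%E.
  move=> AC oO Oc Ofin C1 Oq lm; case: q Oq lm => x t Oq lm.
  rewrite -hamiltonian_extend//; last by have [_ /ltW] := Oc _ Oq.
  rewrite -(value_extend c eta gamma v0 AC) in Ofin lm.
  exact: (supersolution cc ce gc g0 g_sup v0_lb v0_coercive v0_out AC oO Oc Ofin
    C1 Oq lm).
split.
  have vfin q : cylinder q -> value c eta gamma v0 control_values q \is a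
    fin_num.
    case: q => x t [x0 t0]; rewrite -value_extend//.
    exact: (value_fin_num cc ce gc g0 g_fin v0_lb v0_fin x0 (ltW t0)).
  have cont : {within cylinder, continuous
    (fine \o value c eta gamma v0 control_values)}.
    have <- : finite_set_of (value c eta gamma v0 control_values) = cylinder.
      apply/seteqP; split => [q []//|q cq]; split => //.
      by have := vfin q cq; rewrite ltey_eq => ->.
    rewrite -value_extend//.
    exact: (value_continuous cc ce gc g0 g_sup v0_lb v0_coercive v0_out sub1
      v0_fin v0_lip
      g_fin (ex_intro2 _ _ 1 ltr01 (leC 1))).
  split => //; split; split => // phi C1 q Oq lm.
    case: q Oq lm => x t Oq lm.
    rewrite -hamiltonian_extend//; last by have [_ /ltW] := Oq.
    rewrite -(value_extend c eta gamma v0 sub1) in lm.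
    exact:
      (subsolution cc ce gc g0 g_fin v0_lb v0_out v0_fin (@cylinder_open R) _ C1
      Oq lm).
  apply: (superE control_values cylinder) => //; first exact: cylinder_open.
  by move=> q' cq'; have := vfin q' cq'; rewrite ltey_eq => ->.
move=> M M0; have AC := leC M.
have AA : control_values_le M `<=` control_values_le M by [].
have oF : open (finite_set_of (value c eta gamma v0 (control_values_le M))).
  rewrite -value_extend//.
  exact: (finite_set_open cc ce gc g0 g_sup v0_lb v0_coercive v0_out AC v0_fin
    v0_lip
    g_fin (ex_intro2 _ _ M M0 AA)).
split => //.
- move=> [x t] _; rewrite -value_extend//.
  by apply: lt_le_trans (value_lb _ _ _ g0 v0_lb x t); exact: ltNyr.
- split.
    rewrite -value_extend//.
    exact: (value_continuous cc ce gc g0 g_sup v0_lb v0_coercive v0_out AC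
      v0_fin v0_lip
      g_fin (ex_intro2 _ _ M M0 AA)).
  move=> phi C1 q Oq lm; apply: (superE _ _ phi q AC oF _ _ C1 Oq lm) =>
    q' [] //.
- rewrite -value_extend//.
  exact: (value_boundary cc ce gc g0 g_sup v0_lb v0_coercive v0_out AC v0_fin
    v0_lip
      g_fin (ex_intro2 _ _ M M0 AA)).
Qed.
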